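(* Let $F$ be a local field. Fix an integer $k>0$ and for each integer $0\le i<k$ define the representations $\alpha_i=[0,i)\times[i,k)$ and $\widetilde{\alpha_i}=[i,k)\times[0,i)$ of $GL(k,F)$. Then for all integers $0\le i,j<k$ with $j\ne i$ there exists a non-zero intertwining operator $\widetilde{\alpha_j}\to\alpha_i$.
   Context: $F$ is a local field ($\mathbb{R}$, $\mathbb{C}$, or non-archimedean of any characteristic), $G_n=GL(n,F)$ ($G_0$ is the trivial group). For $z\in F^\times$, $\nu(z)>0$ is the scalar by which additive Haar measure on $F$ is multiplied under multiplication by $z$, and $\nu(g):=\nu(\det g)$ for $g\in G_n$. For integers $i\le j$, $[i,j)$ denotes the character $\nu^{(i+j)/2}$ of $G_{j-i}$. For $p_1+p_2=n$ let $P=P_{p_1,p_2}\subset G_n$ be the subgroup of block upper triangular matrices $x=\begin{pmatrix}x_{11}&x_{12}\\0&x_{22}\end{pmatrix}$ with $x_{ij}$ of size $p_i\times p_j$; its modular function is $\Delta_P=\nu^{p_2}\otimes\nu^{-p_1}$. For characters $\chi_i$ of $G_{p_i}$, $(\chi_1\otimes\chi_2)(x)=\chi_1(x_{11})\chi_2(x_{22})$, and $\chi_1\times\chi_2$ denotes the normalized induced representation: $G_n$ acts by right translation $(R_gf)(x)=f(xg)$ on the space of $f\in C^\infty(G_n)$ with $f(px)=(\chi_1\otimes\chi_2)(p)\,\Delta_P^{1/2}(p)f(x)$ for all $p\in P$, $x\in G_n$. If $p_1=0$ (resp. $p_2=0$) then $\chi_1\times\chi_2$ is just $\chi_2$ (resp.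 $\chi_1$). Intertwining operators are $G_n$-equivariant linear maps (continuous in the archimedean case). *)

(* Defs.v *)
From HB Require Import structures.
From mathcomp Require Import all_boot all_order all_algebra.
From mathcomp Require Import complex.
From mathcomp Require Import all_classical all_reals all_analysis.

Set Implicit Arguments.
Unset Strict Implicit.
Unset Printing Implicit Defensive.

Import Order.TTheory GRing.Theory Num.Theory.
Import numFieldNormedType.Exports.

Local Open Scope classical_set_scope.
Local Open Scope ring_scope.
Local Open Scope complex_scope.

(* A field carrying a topology. No compatibility is required here: continuity
   of the field operations follows from each clause of [local_field]. *)
#[short(type="topFieldType")]
HB.structure Definition TopField := {F of GRing.Field F & Topological F}.

Record nonarchimedean_abs (R : realType) (F : topFieldType) (abs : F -> R) :
    Prop := {
  nabs_ge0 : forall x, 0 <= abs x;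
  nabs_eq0 : forall x, abs x = 0 <-> x = 0;
  nabsM : forall x y, abs (x * y) = abs x * abs y;
  nabs_ultrametric : forall x y, abs (x + y) <= Num.max (abs x) (abs y);
  nabs_nontrivial : exists x, x != 0 /\ abs x != 1;
  nabs_nbhs : forall x (A : set F),
    nbhs x A <-> exists2 e, 0 < e & forall y, abs (y - x) < e -> A y
}.

Inductive local_field (R : realType) (F : topFieldType) : Type :=
| RealField (phi : {rmorphism R -> F}) (psi : F -> R) of
    cancel phi psi & cancel psi phi &
    continuous (phi : R^o -> F) & continuous (psi : F -> R^o)
| ComplexField (phi : {rmorphism R[i] -> F}) (psi : F -> R[i]) of
    cancel phi psi & cancel psi phi &
    continuous (phi : R[i]^o -> F) & continuous (psi : F -> R[i]^o)
| NonarchimedeanField (abs : F -> R) of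
    nonarchimedean_abs abs & locally_compact [set: F].

(* The embedding of the real numbers into F when F is archimedean. *)
Definition real_line (R : realType) (F : topFieldType) (LF : local_field R F) :
    option (R -> F) :=
  match LF with
  | RealField phi _ _ _ _ _ => Some (phi : R -> F)
  | ComplexField phi _ _ _ _ _ => Some (fun t : R => phi t%:C)
  | NonarchimedeanField _ _ _ => None
  end.

(* Sigma-algebras of the library live on pointed types. *)
Definition pointed_field (F : topFieldType) : Type := F.
HB.instance Definition _ (F : topFieldType) := Choice.on (pointed_field F).
HB.instance Definition _ (F : topFieldType) :=
  isPointed.Build (pointed_field F) (0 : F).

Definition borel (F : topFieldType) :=
  @g_sigma_algebraType (pointed_field F) (@open F).
HB.instance Definition _ (F : topFieldType) := Measurable.on (borel F).

Record haar_measure (R : realType) (F : topFieldType)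
    (mu : {measure set (borel F) -> \bar R}) : Prop := {
  haar_translation : forall (a : F) (A : set (borel F)), measurable A ->
    mu [set a + x | x in (A : set F)] = mu A;
  haar_compact : forall K : set F, compact K -> (mu K < +oo)%E;
  haar_open : forall U : set F, open U -> U !=set0 -> (0 < mu U)%E
}.

(* The value of nu at 0 is irrelevant. *)
Definition haar_modulus (R : realType) (F : topFieldType)
    (mu : {measure set (borel F) -> \bar R}) (nu : F -> R) : Prop :=
  forall z : F, z != 0 -> 0 < nu z /\
    forall A : set (borel F), measurable A ->
      mu [set z * x | x in (A : set F)] = ((nu z)%:E * mu A)%E.

Definition GL (F : topFieldType) (n : nat) : set 'M[F]_n :=
  [set x | x \in unitmx].

(* Complex functions on G_n are represented by functions on all n x n matrices,
   extended by 0 outside the open set G_n (see [induced]); the notions below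
   only depend on their values on G_n. *)

(* C^oo functions on G_n for archimedean F, with iota : R -> F the real line:
   all iterated real directional derivatives exist and are continuous. *)
Section Archimedean.
Context (R : realType) (F : topFieldType) (iota : R -> F) (n : nat).

Definition dderiv (v : 'M[F]_n) (h : 'M[F]_n -> R) (x : 'M[F]_n) : R :=
  derive1 (fun t : R => h (x + iota t *: v)) 0.

Definition dderivs (vs : seq 'M[F]_n) (h : 'M[F]_n -> R) : 'M[F]_n -> R :=
  foldr dderiv h vs.

Definition real_Cinfty (h : 'M[F]_n -> R) : Prop :=
  forall (vs : seq 'M[F]_n) (x : 'M[F]_n), GL x ->
    {for x, continuous (dderivs vs h)} /\
    forall v, derivable (fun t : R => dderivs vs h (x + iota t *: v)) 0 1.

Definition Cinfty (f : 'M[F]_n -> R[i]) : Prop :=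
  real_Cinfty (fun x => complex.Re (f x)) /\
  real_Cinfty (fun x => complex.Im (f x)).

Definition cdderivs (vs : seq 'M[F]_n) (f : 'M[F]_n -> R[i]) (x : 'M[F]_n) :
    R[i] :=
  dderivs vs (fun y => complex.Re (f y)) x +i*
  dderivs vs (fun y => complex.Im (f y)) x.

(* Neighborhoods of f in the Frechet space C^oo(G_n): uniform convergence on
   compact sets of all derivatives. *)
Definition Cinfty_nbhs (f : 'M[F]_n -> R[i]) : set_system ('M[F]_n -> R[i]) :=
  [set N | exists (K : set 'M[F]_n) (vss : seq (seq 'M[F]_n)) (e : R),
    [/\ compact K, K `<=` @GL F n, 0 < e &
      forall h, Cinfty h ->
        (forall vs x, vs \in vss -> K x ->
           `|cdderivs vs h x - cdderivs vs f x| < e%:C) -> N h]].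

End Archimedean.

Definition smooth (R : realType) (F : topFieldType) (LF : local_field R F)
    (n : nat) (f : 'M[F]_n -> R[i]) : Prop :=
  match real_line LF with
  | Some iota => Cinfty iota f
  | None => forall x, GL x -> \forall y \near x, f y = f x
  end.

(* [a, b) as a character of G_(b - a). *)
Definition segment (R : realType) (F : topFieldType) (nu : F -> R) (a b : nat)
    (g : 'M[F]_(b - a)) : R[i] :=
  (nu (\det g) `^ ((a + b)%:R / 2))%:C.

Definition parabolic (F : topFieldType) (p1 p2 : nat) : set 'M[F]_(p1 + p2) :=
  [set p | p \in unitmx /\ dlsubmx p = 0].

Definition modular (R : realType) (F : topFieldType) (nu : F -> R)
    (p1 p2 : nat) (p : 'M[F]_(p1 + p2)) : R :=
  nu (\det (ulsubmx p)) ^+ p2 * nu (\det (drsubmx p)) ^- p1.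

(* The space of chi1 x chi2. When p1 = 0 or p2 = 0 this is the line spanned by
   the other character, on which right translations act by that character. *)
Definition induced (R : realType) (F : topFieldType) (LF : local_field R F)
    (nu : F -> R) (n p1 p2 : nat) (e : (p1 + p2)%N = n)
    (chi1 : 'M[F]_p1 -> R[i]) (chi2 : 'M[F]_p2 -> R[i]) :
    set ('M[F]_n -> R[i]) :=
  [set f | [/\ forall x, ~ GL x -> f x = 0,
    smooth LF f &
    forall p x, parabolic p -> GL x ->
      f (castmx (e, e) p *m x) =
        chi1 (ulsubmx p) * chi2 (drsubmx p) *
        (Num.sqrt (modular nu p))%:C * f x]].

Definition rtranslate (R : realType) (F : topFieldType) (n : nat)
    (g : 'M[F]_n) (f : 'M[F]_n -> R[i]) : 'M[F]_n -> R[i] :=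
  fun x => f (x *m g).

(* T is an intertwining operator between spaces V, W of functions on G_n with
   G_n acting by right translations; the values of T outside V are irrelevant.
   Continuity refers to the topologies induced by C^oo(G_n). *)
Record intertwining (R : realType) (F : topFieldType) (LF : local_field R F)
    (n : nat) (V W : set ('M[F]_n -> R[i]))
    (T : ('M[F]_n -> R[i]) -> ('M[F]_n -> R[i])) : Prop := {
  intw_maps : forall f, V f -> W (T f);
  intw_linear : forall (a : R[i]) f g, V f -> V g ->
    T (fun x => a * f x + g x) = (fun x => a * T f x + T g x);
  intw_equivariant : forall g f, GL g -> V f ->
    T (rtranslate g f) = rtranslate g (T f);
  intw_continuous : forall iota, real_line LF = Some iota ->
    forall f, V f ->
      T @ within V (Cinfty_nbhs iota f) `=>` Cinfty_nbhs iota (T f)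
}.

Lemma alpha_size (k : nat) (i : 'I_k) : (i - 0 + (k - i))%N = k.
Proof. by rewrite subn0 subnKC // ltnW. Qed.

Lemma alphat_size (k : nat) (i : 'I_k) : (k - i + (i - 0))%N = k.
Proof. by rewrite subn0 subnK // ltnW. Qed.

Definition alpha (R : realType) (F : topFieldType) (LF : local_field R F)
    (nu : F -> R) (k : nat) (i : 'I_k) : set ('M[F]_k -> R[i]) :=
  induced LF nu (alpha_size i) (segment nu (a:=0) (b:=i)) (segment nu (a:=i) (b:=k)).

Definition alphat (R : realType) (F : topFieldType) (LF : local_field R F)
    (nu : F -> R) (k : nat) (i : 'I_k) : set ('M[F]_k -> R[i]) :=
  induced LF nu (alphat_size i) (segment nu (a:=i) (b:=k)) (segment nu (a:=0) (b:=i)).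

(* Main.v *)
(* Let P = P_(k-j,j).  Comparing characters, the space of [alphat j] consists of
   the functions nu(det x)^(k/2) u(x) with u a smooth density on the compact
   quotient P\GL_k, and [alpha i] contains the function nu(det x)^(k/2), which
   spans a one-dimensional representation.  With L u the integral of u over
   P\GL_k, the map nu(det)^(k/2) u |-> L u nu(det)^(k/2) is the required operator.

   L is an integral over the big cell, that is, an iterated integral of
   t |-> u((1 + t E_ab) x) over the pairs (a, b) of the lower left block.  Its
   invariance under GL_k only has to be checked on transvections and diagonal
   matrices; there it follows from the commutation relations of transvections and
   from the rank one formula: the integral of nu(1 + c t)^-2 f(t / (1 + c t)) is
   that of f.  L u is finite and continuous in u because a maximal minor of the
   lower rows bounds u by its values on finitely many compact translates of the
   integral points of the big cell. *)

Require Import Defs.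
From HB Require Import structures.
From mathcomp Require Import all_boot all_order all_algebra.
From mathcomp Require Import fingroup perm finmap complex.
From mathcomp Require Import all_classical all_reals all_analysis measurable_realfun.
From mathcomp Require Import ring lra.
Set Implicit Arguments.
Unset Strict Implicit.
Unset Printing Implicit Defensive.
Import Order.TTheory GRing.Theory Num.Theory.
Import numFieldNormedType.Exports.
Local Open Scope classical_set_scope.
Local Open Scope ring_scope.

(** Write [m = k - j], [n = j] and [N = k]. Times the square root of the modular function, the
    inducing character of [alphat j] is [nu^(n + N/2)] on the upper block and [nu^(N/2 - m)] on the
    lower one, that is [nu^(N/2)] times the modular function itself; for [alpha i] the exponent is
    [N/2] on both blocks. Right invariance of [L] is obtained from left invariance: the iterated
    integral is a function of a base point [x], and right translation of [u] by [g] only moves that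
    base point from [1] to [g]. No measure on the quotient is ever formed; only additive Haar
    measure on [F] enters. Once an absolute value defining the topology is available, the
    integration theory is uniform in [F]. The kind of field matters for smoothness, above all where
    the operator must be shown non-zero: this needs a smooth positive density, built from a norm of
    the maximal minors of the lower rows, which is a sum of squared moduli in the archimedean case
    and a maximum otherwise. *)

HB.instance Definition _ (F : topFieldType) := Topological.copy (pointed_field F) F.

(** * Locally compact fields with an absolute value *)

(** All three clauses of [local_field] produce such an absolute value. It is kept apart from the
    modulus [nu], which on the complex numbers is the square of the usual absolute value and
    violates the triangle inequality. [vf_small] excludes the trivial absolute value. *)
Record valued_field (R : realType) (F : topFieldType) (abs : F -> R) : Prop := {
  vf_ge0 : forall x, 0 <= abs x;
  vf_eq0 : forall x, abs x = 0 <-> x = 0;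
  vfM : forall x y, abs (x * y) = abs x * abs y;
  vf_triangle : forall x y, abs (x + y) <= abs x + abs y;
  vf_nbhs : forall x (A : set F),
    nbhs x A <-> exists2 e, 0 < e & forall y, abs (y - x) < e -> A y;
  vf_locally_compact : exists2 K : set F, compact K & nbhs 0 K;
  vf_small : exists x, 0 < abs x < 1
}.

Section ValuedField.
Context (R : realType) (F : topFieldType) (abs : F -> R).
Hypothesis V : valued_field abs.

Lemma vf0 : abs 0 = 0. Proof. exact/(vf_eq0 V). Qed.

Lemma vf_gt0 x : (0 < abs x) = (x != 0).
Proof.
rewrite lt_def (vf_ge0 V) andbT; congr (~~ _); apply/eqP/eqP; exact: (vf_eq0 V x).1 || exact: (vf_eq0 V x).2.
Qed.

Lemma vf1 : abs 1 = 1.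
Proof.
have h : abs 1 * abs 1 = abs 1 * 1 by rewrite -(vfM V) !mulr1.
apply: (mulfI _ h); by rewrite gt_eqF// vf_gt0 oner_neq0.
Qed.

Lemma vfN x : abs (- x) = abs x.
Proof.
rewrite -mulN1r (vfM V).
suff -> : abs (-1) = 1 by rewrite mul1r.
have h : abs (-1) ^+ 2 = 1 by rewrite expr2 -(vfM V) mulrNN mulr1 vf1.
by apply/eqP; rewrite -(@eqrXn2 _ 2) ?(vf_ge0 V)// h expr1n.
Qed.

Lemma vf_distC x y : abs (x - y) = abs (y - x).
Proof. by rewrite -vfN opprB. Qed.

Lemma vfV x : abs x^-1 = (abs x)^-1.
Proof.
have [->|x0] := eqVneq x 0; first by rewrite invr0 vf0 invr0.
have a0 : abs x != 0 by rewrite gt_eqF// vf_gt0.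
by apply: (mulfI a0); rewrite -(vfM V) divff// divff// vf1.
Qed.

Lemma vfX x n : abs (x ^+ n) = abs x ^+ n.
Proof. by elim: n => [|n IH]; rewrite ?expr0 ?vf1// !exprS (vfM V) IH. Qed.

Lemma vf_cont_at (X : topologicalType) (f : X -> F) x :
  continuous_at x f <->
  forall e, 0 < e -> \forall y \near x, abs (f y - f x) < e.
Proof.
split=> [fx e e0|H A /(vf_nbhs V)[e e0 eA]].
  apply: (fx [set y | abs (y - f x) < e]).
  by apply/(vf_nbhs V); exists e.
by apply: filterS (H e e0) => y /eA.
Qed.

Lemma vf_continuousD (X : topologicalType) (f g : X -> F) x :
  continuous_at x f -> continuous_at x g ->
  continuous_at x (fun y => f y + g y).
Proof.
move=> /vf_cont_at cf /vf_cont_at cg; apply/vf_cont_at => e e0.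
have e20 : 0 < e / 2 by rewrite divr_gt0.
apply: filterS2 (cf _ e20) (cg _ e20) => y fy gy.
rewrite opprD addrACA (le_lt_trans (vf_triangle V _ _))//.
by rewrite [e]splitr ltrD.
Qed.

Lemma vf_continuousM (X : topologicalType) (f g : X -> F) x :
  continuous_at x f -> continuous_at x g ->
  continuous_at x (fun y => f y * g y).
Proof.
move=> /vf_cont_at cf /vf_cont_at cg; apply/vf_cont_at => e e0.
pose c := abs (f x) + abs (g x) + 1.
have c0 : 0 < c by rewrite ltr_wpDl// addr_ge0// vf_ge0.
(* The bound [d <= 1] absorbs the product of the two increments. *)
pose d := Num.min 1 (e / (2 * c)).
have d0 : 0 < d by rewrite lt_min ltr01 divr_gt0// mulr_gt0.
have dc : d * c <= e / 2.
  by rewrite -ler_pdivlMr// ge_min -mulrA -invfM lexx orbT.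
apply: filterS2 (cf _ d0) (cg _ d0) => y fy gy.
have -> : f y * g y - f x * g x = (f y - f x) * (g y - g x) +
    (f x * (g y - g x) + g x * (f y - f x)) by ring.
have e2 : e / 2 < e by rewrite ltr_pdivrMr// mulr_natr mulr2n ltrDl.
apply: le_lt_trans (le_lt_trans dc e2).
apply: (le_trans (vf_triangle V _ _)).
apply: (le_trans (lerD (lexx _) (vf_triangle V _ _))).
have d1 : d <= 1 by rewrite ge_min lexx.
rewrite !(vfM V) /c.
have gd1 := ltW (lt_le_trans gy d1).
have -> : d * (abs (f x) + abs (g x) + 1) = d * 1 + (abs (f x) * d + abs (g x) * d) by ring.
by rewrite !lerD ?ler_pM ?ler_wpM2l ?(vf_ge0 V)// ltW.
Qed.

Lemma vf_ball_closed r : closed [set x : F | abs x <= r].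
Proof.
rewrite -openC openE => x /= /negP; rewrite -ltNge => rx.
apply/(vf_nbhs V); exists (abs x - r); first by rewrite subr_gt0.
move=> y yx /= yr.
have := vf_triangle V y (x - y); rewrite addrC subrK vf_distC => h.
by have := le_lt_trans h (ler_ltD yr yx); rewrite addrC subrK ltxx.
Qed.

(** Local compactness gives one compact neighbourhood of [0]. A power of a small element contracts
    any given ball into it, and multiplication by the inverse power is continuous. *)
Lemma vf_compact r : compact [set x : F | abs x <= r].
Proof.
have [K cK /(vf_nbhs V)[e e0 eK]] := vf_locally_compact V.
have [p /andP[p0 p1]] := vf_small V.
have [n pn] : exists n, `|r| * abs p ^+ n < e.
  have : (fun n => `|r| * abs p ^+ n : R^o) @ \oo --> (`|r| * 0 : R^o).
    by apply: cvgMr; apply: cvg_expr; rewrite ger0_norm ?(vf_ge0 V).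
  move=> /cvgrPdist_lt/(_ _ e0) [n _ /(_ n (leqnn _))].
  by rewrite mulr0 sub0r normrN ger0_norm ?mulr_ge0 ?exprn_ge0 ?(vf_ge0 V)//; exists n.
have z0 : p ^+ n != 0 by rewrite expf_neq0// -vf_gt0.
have az : 0 < abs (p ^+ n) by rewrite vf_gt0.
rewrite (_ : mkset _ = [set p ^- n * x | x in [set x | abs x <= r * abs (p ^+ n)]]); last first.
  apply/seteqP; split=> [x /= xr|_ [x /= xr <-]].
    by exists (p ^+ n * x); rewrite ?mulKf//= (vfM V) mulrC ler_wpM2r// ltW.
  by rewrite (vfM V) vfV mulrC ler_pdivrMr.
apply: continuous_compact.
  apply: continuous_subspaceT => x; apply: vf_continuousM => //; exact: cst_continuous.
have sK : [set x : F | abs x <= r * abs (p ^+ n)] `<=` K.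
  move=> x /= xr; apply: eK; rewrite subr0 (le_lt_trans xr)// (le_lt_trans _ pn)//.
  by rewrite vfX ler_wpM2r ?exprn_ge0 ?(vf_ge0 V)// ler_norm.
exact: (subclosed_compact (@vf_ball_closed _) cK sK).
Qed.

Lemma vf_continuous_sum (X : topologicalType) (I : Type) (r : seq I)
  (P : pred I) (f : I -> X -> F) x :
  (forall i, P i -> continuous_at x (f i)) ->
  continuous_at x (fun y => \sum_(i <- r | P i) f i y).
Proof.
move=> cf; elim: r => [|i r IH].
  under eq_fun do rewrite big_nil.
  exact: cst_continuous.
under eq_fun do rewrite big_cons.
by case: ifP => // Pi; apply: vf_continuousD => //; exact: cf.
Qed.

Lemma vf_continuous_prod (X : topologicalType) (I : Type) (r : seq I)
  (P : pred I) (f : I -> X -> F) x :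
  (forall i, P i -> continuous_at x (f i)) ->
  continuous_at x (fun y => \prod_(i <- r | P i) f i y).
Proof.
move=> cf; elim: r => [|i r IH].
  under eq_fun do rewrite big_nil.
  exact: cst_continuous.
under eq_fun do rewrite big_cons.
by case: ifP => // Pi; apply: vf_continuousM => //; exact: cf.
Qed.

Lemma mx_entry_continuous m n (i : 'I_m) (j : 'I_n) :
  continuous (fun x : 'M[F]_(m, n) => x i j).
Proof.
move=> x A xA /=; exists (fun i' j' => if (i' == i) && (j' == j) then A else setT).
  move=> i' j'; case: ifP => [/andP[/eqP-> /eqP->]//|_]; exact: filterT.
by move=> y /(_ i j); rewrite !eqxx.
Qed.

Lemma mx_continuous (X : topologicalType) m n (f : X -> 'M[F]_(m, n)) x :
  (forall i j, continuous_at x (fun y => f y i j)) -> continuous_at x f.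
Proof.
move=> cf A [P Pf PA]; rewrite /= nbhs_simpl.
suff : \forall y \near x, forall i j, P i j (f y i j) by apply: filterS => y; exact: PA.
have h : \forall y \near x, forall ij : 'I_m * 'I_n, P ij.1 ij.2 (f y ij.1 ij.2).
  by apply: filter_forall => -[i j]; exact: cf (Pf i j).
by apply: filterS h => y h i j; exact: h (i, j).
Qed.

Lemma mulmx_continuous (X : topologicalType) m n p (f : X -> 'M[F]_(m, n))
    (g : X -> 'M[F]_(n, p)) x :
  continuous_at x f -> continuous_at x g ->
  continuous_at x (fun y => f y *m g y).
Proof.
move=> cf cg; apply: mx_continuous => i j.
under eq_fun do rewrite mxE.
apply: vf_continuous_sum => l _; apply: vf_continuousM.
- exact: (continuous_comp cf (@mx_entry_continuous _ _ _ _ _)).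
- exact: (continuous_comp cg (@mx_entry_continuous _ _ _ _ _)).
Qed.

Lemma det_continuous n : continuous (fun x : 'M[F]_n => \det x).
Proof.
move=> x; rewrite /determinant; apply: vf_continuous_sum => s _.
apply: vf_continuousM; first exact: cst_continuous.
apply: vf_continuous_prod => i _; exact: mx_entry_continuous.
Qed.

Lemma abs_continuous : continuous (abs : F -> R^o).
Proof.
move=> x; apply/cvgrPdist_lt => e e0; apply/(vf_nbhs V); exists e => // y.
move=> yx.
have h a b : abs a <= abs b + abs (a - b).
  by rewrite -[X in abs X <= _](subrK b) addrC (vf_triangle V).
have h1 := h x y; have h2 := h y x; rewrite vf_distC in h1.
by rewrite /= ltr_norml; apply/andP; split; lra.
Qed.

Lemma vf_open_ball c r : open [set x | abs (x - c) < r].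
Proof.
rewrite openE => x /= xr; apply/(vf_nbhs V); exists (r - abs (x - c)); first by rewrite subr_gt0.
move=> y yx /=; have -> : y - c = (y - x) + (x - c) by ring.
by rewrite (le_lt_trans (vf_triangle V _ _))// -ltrBrDr.
Qed.

Lemma vf_open_neq0 : open [set x : F | x != 0].
Proof.
rewrite openE => x /= x0; apply/(vf_nbhs V); exists (abs x); first by rewrite vf_gt0.
move=> y yx /=; apply: contraTneq yx => ->; by rewrite sub0r vfN ltxx.
Qed.

Lemma GL_open n : open (@GL F n).
Proof.
have -> : @GL F n = (fun x => \det x) @^-1` [set x : F | x != 0].
  by apply/seteqP; split => x; rewrite /GL /= unitmxE unitfE.
apply: open_comp => [x _|]; [exact: det_continuous|exact: vf_open_neq0].
Qed.

(** Second countability with a countable index type. It is what makes open sets of a product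
    measurable for the product sigma-algebra. *)
Definition countable_base (X : topologicalType) (J : countType) (U : J -> set X) :=
  (forall j, open (U j)) /\
  forall x A, nbhs x A -> exists2 j, U j x & U j `<=` A.

(** An index [((n, q), l)] names the ball of radius [1/(q+1)] around the [l]-th point of a finite
    net of the ball of radius [n]; the net exists by compactness. *)
Lemma vf_countable_base : exists U : nat * nat * nat -> set F, countable_base U.
Proof.
have cov (nq : nat * nat) : exists S : {fset F},
    [set x | abs x <= nq.1%:R] `<=` \bigcup_(c in [set` S]) [set x | abs (x - c) < nq.2.+1%:R^-1].
  have : @compact (pointed_field F) [set x | abs x <= nq.1%:R] by exact: (@vf_compact _).
  rewrite compact_cover.
  move=> /(_ F setT (fun c => [set x | abs (x - c) < nq.2.+1%:R^-1])).
  case.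
  - by move=> c _; exact: vf_open_ball.
  - by move=> x _; exists x => //=; rewrite subrr vf0 invr_gt0.
  - by move=> S _ ?; exists S.
have [S HS] := choice cov.
(* Positions beyond the end of a net give the default centre [0]; those balls are open as well. *)
exists (fun n => [set x | abs (x - nth 0 (enum_fset (S n.1)) n.2) < n.1.2.+1%:R^-1]).
split=> [j|x A /(vf_nbhs V)[e e0 eA]]; first exact: vf_open_ball.
(* Both [x] and the points of the chosen ball lie within [1/(q+1)] of its centre, whence the
   requirement [2/(q+1) < e]. *)
pose n := (Num.truncn (abs x)).+1; pose q := Num.truncn (2 / e).
have xn : abs x <= n%:R by rewrite ltW// truncnS_gt.
have qe : 2 * q.+1%:R^-1 < e.
  by rewrite ltr_pdivrMr// mulrC -ltr_pdivrMr// truncnS_gt.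
have [c cS /= xc] := HS (n, q) x xn.
exists (n, q, index c (enum_fset (S (n, q)))) => /=.
  by rewrite nth_index.
rewrite nth_index// => y /= yc; apply: eA.
have -> : y - x = (y - c) + (c - x) by ring.
rewrite (le_lt_trans (vf_triangle V _ _))// (lt_trans _ qe)//.
by rewrite mulrC mulr_natr mulr2n ltrD// vf_distC.
Qed.

Lemma mx_countable_base m n :
  exists (J : countType) (U : J -> set 'M[F]_(m, n)), countable_base U.
Proof.
have [U [oU bU]] := vf_countable_base.
exists {ffun 'I_m * 'I_n -> nat * nat * nat}.
exists (fun (j : {ffun 'I_m * 'I_n -> nat * nat * nat}) =>
  [set x : 'M[F]_(m, n) | forall a b, U (j (a, b)) (x a b)]).
split=> [j|x A [P Px PA]].
  rewrite openE => x /= Ux; exists (fun a b => U (j (a, b))) => // a b.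
  by apply: open_nbhs_nbhs; split.
have /choice[j Hj] : forall ab : 'I_m * 'I_n, exists j, U j (x ab.1 ab.2) /\ U j `<=` P ab.1 ab.2.
  by move=> ab; have [j] := bU _ _ (Px ab.1 ab.2); exists j.
exists [ffun ab => j ab] => /=.
  by move=> a b; rewrite ffunE; exact: (Hj (a, b)).1.
move=> y yU; apply: PA => a b; apply: (Hj (a, b)).2.
by have := yU a b; rewrite ffunE.
Qed.

End ValuedField.

(** * Borel structures on products and on matrices *)

(** An open set is the union of the countably many basic boxes that it contains. The maps [iX] and
    [iY] connect measurable and topological types, because sigma-algebra and topology are carried by
    different types. *)
Lemma open_prod_measurable d1 d2 (X : topologicalType) (Y : topologicalType)
    (X' : measurableType d1) (Y' : measurableType d2)
    (J1 J2 : countType) (U : J1 -> set X) (U' : J2 -> set Y)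
    (iX : X' -> X) (iY : Y' -> Y) :
  countable_base U -> countable_base U' ->
  (forall O, open O -> measurable (iX @^-1` O)) ->
  (forall O, open O -> measurable (iY @^-1` O)) ->
  forall W : set (X * Y), open W ->
    measurable [set z : X' * Y' | W (iX z.1, iY z.2)].
Proof.
move=> [oU bU] [oU' bU'] mX mY W oW.
pose D := [set j : J1 * J2 | U j.1 `*` U' j.2 `<=` W].
have -> : [set z : X' * Y' | W (iX z.1, iY z.2)] =
    \bigcup_(j in D) ((iX @^-1` U j.1) `*` (iY @^-1` U' j.2)).
  apply/seteqP; split=> [[x y] /= Wxy|[x y] [j Dj [/= Ux Uy]]]; last exact: (Dj (_, _)).
  have : nbhs (iX x, iY y) W by apply: open_nbhs_nbhs; split.
  move=> [[P Q] /= [xP yQ] PQ].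
  have [j1 xj1 j1P] := bU _ _ xP; have [j2 yj2 j2Q] := bU' _ _ yQ.
  exists (j1, j2) => //= -[x' y'] [/= Ux' Uy']; apply: PQ; split => /=; [exact: j1P|exact: j2Q].
pose G (n : nat) : set (X' * Y') := if @choice.unpickle (J1 * J2)%type n is Some j then
  [set z | D j /\ ((iX @^-1` U j.1) `*` (iY @^-1` U' j.2)) z] else set0.
have -> : \bigcup_(j in D) ((iX @^-1` U j.1) `*` (iY @^-1` U' j.2)) = \bigcup_n G n.
  apply/seteqP; split=> [z [j Dj zj]|z [n _]]; first by exists (choice.pickle j); rewrite // /G choice.pickleK.
  by rewrite /G; case: choice.unpickle => // j [Dj zj]; exists j.
apply: bigcupT_measurable => n; rewrite /G; case: choice.unpickle => // j.
have [Dj|Dj] := pselect (D j); last first.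
  by rewrite [X in measurable X](_ : _ = set0)//; apply/seteqP; split => // z [].
rewrite [X in measurable X](_ : _ = (iX @^-1` U j.1) `*` (iY @^-1` U' j.2)).
  by apply: measurableX; [exact: mX|exact: mY].
by apply/seteqP; split => // z [].
Qed.

Definition pointed_mx (F : topFieldType) (m n : nat) : Type := 'M[F]_(m, n).
HB.instance Definition _ (F : topFieldType) m n := Choice.on (pointed_mx F m n).
HB.instance Definition _ (F : topFieldType) m n :=
  isPointed.Build (pointed_mx F m n) (0 : 'M[F]_(m, n)).

Definition mxborel (F : topFieldType) (m n : nat) :=
  @g_sigma_algebraType (pointed_mx F m n) (@open 'M[F]_(m, n)).
HB.instance Definition _ (F : topFieldType) m n := Measurable.on (mxborel F m n).

Lemma open_borel (F : topFieldType) (O : set F) : open O ->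
  measurable (O : set (borel F)).
Proof. by move=> oO; exact: sub_sigma_algebra. Qed.

Lemma open_mxborel (F : topFieldType) m n (O : set 'M[F]_(m, n)) : open O ->
  measurable (O : set (mxborel F m n)).
Proof. by move=> oO; exact: sub_sigma_algebra. Qed.

Section Measurability.
Context (R : realType) (F : topFieldType) (abs : F -> R).
Hypothesis V : valued_field abs.

Lemma measurable_continuous_mx d (X : measurableType d) (Y : topologicalType)
    (i : X -> Y) m n (f : Y -> 'M[F]_(m, n)) :
  (forall O, open O -> measurable (i @^-1` O)) ->
  continuous f ->
  measurable_fun setT (fun x => f (i x) : mxborel F m n).
Proof.
move=> mi cf; apply: (@measurability _ _ X (mxborel F m n) setT (fun x => f (i x)) (@open 'M[F]_(m, n))) => //.
move=> _ [B oB <-]; rewrite setTI; apply: (mi (f @^-1` B)).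
by apply: open_comp => // x _; exact: cf.
Qed.

Lemma measurable_continuous_borel d (X : measurableType d) (Y : topologicalType)
    (i : X -> Y) (f : Y -> F) :
  (forall O, open O -> measurable (i @^-1` O)) ->
  continuous f ->
  measurable_fun setT (fun x => f (i x) : borel F).
Proof.
move=> mi cf; apply: (@measurability _ _ X (borel F) setT (fun x => f (i x)) (@open F)) => //.
move=> _ [B oB <-]; rewrite setTI; apply: (mi (f @^-1` B)).
by apply: open_comp => // x _; exact: cf.
Qed.

Lemma open_borel_mx m n (O : set (F * 'M[F]_(m, n))) : open O ->
  measurable (O : set (borel F * mxborel F m n)).
Proof.
move=> oO; have [J [U bU]] := mx_countable_base V m n.
have [U' bU'] := vf_countable_base V.
have := @open_prod_measurable _ _ F 'M[F]_(m, n) (borel F) (mxborel F m n) _ _ U' U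
  id id bU' bU (@open_borel F) (@open_mxborel F m n) O oO.
by congr (measurable _); apply/seteqP; split => -[].
Qed.

Lemma open_borel2 (O : set (F * F)) : open O ->
  measurable (O : set (borel F * borel F)).
Proof.
move=> oO; have [U' bU'] := vf_countable_base V.
have := @open_prod_measurable _ _ F F (borel F) (borel F) _ _ U' U'
  id id bU' bU' (@open_borel F) (@open_borel F) O oO.
by congr (measurable _); apply/seteqP; split => -[].
Qed.

End Measurability.

(** * Haar measure and its modulus *)

Section Haar.
Context (R : realType) (F : topFieldType) (abs : F -> R).
Hypothesis V : valued_field abs.
Context (mu : {sigma_finite_measure set (borel F) -> \bar R}).
Hypothesis mu_haar : haar_measure mu.
Context (nu : F -> R).
Hypothesis nu0 : nu 0 = 0.
Hypothesis nuE : haar_modulus mu nu.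

Let cball r : set F := [set x | abs x <= r].

Lemma measurable_vf_ball r : measurable (cball r : set (borel F)).
Proof. by rewrite -[cball r]setCK; apply: measurableC; apply: open_borel; rewrite openC; exact: (@vf_ball_closed _ _ _ V). Qed.

Lemma measurable_point a : measurable ([set a] : set (borel F)).
Proof.
rewrite -[X in measurable X]setCK; apply: measurableC; apply: open_borel.
rewrite (_ : ~` [set a] = (fun x => x - a) @^-1` [set x | x != 0]).
  apply: open_comp (vf_open_neq0 V) => x _; apply: (vf_continuousD V) => //; exact: cst_continuous.
by apply/seteqP; split => x /=; rewrite subr_eq0 => /eqP.
Qed.

Lemma mu_ball_fin r : (mu (cball r) < +oo)%E.
Proof. exact: (haar_compact mu_haar (@vf_compact _ _ _ V r)). Qed.

Lemma mu_ball_gt0 r : 0 < r -> (0 < mu (cball r))%E.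
Proof.
move=> r0; have oB := vf_open_ball V 0 r.
apply: (@lt_le_trans _ _ (mu [set x | abs (x - 0) < r])).
  by apply: (haar_open mu_haar) => //; exists 0; rewrite /= subrr (vf0 V).
apply: le_measure; rewrite ?inE; [exact: open_borel|exact: measurable_vf_ball|].
by move=> x; rewrite /= subr0 => /ltW.
Qed.

Lemma nu_gt0 x : x != 0 -> 0 < nu x. Proof. by move=> /nuE[]. Qed.

Lemma nu_ge0 x : 0 <= nu x.
Proof. by have [->|/nu_gt0/ltW//] := eqVneq x 0; rewrite nu0. Qed.

Lemma ball_scale z : z != 0 -> [set z * x | x in cball 1] = cball (abs z).
Proof.
move=> z0; have az : 0 < abs z by rewrite (vf_gt0 V).
apply/seteqP; split => [_ [x x1 <-]|x xz]; rewrite /cball/=.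
  by rewrite (vfM V) ler_piMr// ltW.
exists (z^-1 * x); last by rewrite mulrA divff// mul1r.
by rewrite /cball/= (vfM V) (vfV V) mulrC ler_pdivrMr// mul1r.
Qed.

(** Dilation by [z] maps the unit ball onto the ball of radius [abs z], so [nu] is read off from
    masses of balls. As the unit ball has finite positive mass, cancelling it shows that [nu] is
    monotone in [abs] and multiplicative. *)
Lemma mu_ballE z : z != 0 -> (mu (cball (abs z)) = (nu z)%:E * mu (cball 1%R))%E.
Proof.
move=> z0; rewrite -ball_scale//; apply: (nuE z0).2; exact: measurable_vf_ball.
Qed.

Let b1 := fine (mu (cball 1)).
Let b1E : mu (cball 1) = b1%:E.
Proof. by rewrite fineK// ge0_fin_numE// mu_ball_fin. Qed.
Let b1_gt0 : 0 < b1.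
Proof. by rewrite -lte_fin -b1E mu_ball_gt0. Qed.

Lemma nu_le x y : abs x <= abs y -> nu x <= nu y.
Proof.
have [->|x0] := eqVneq x 0; first by rewrite nu0 nu_ge0.
have [->|y0] := eqVneq y 0.
  by rewrite (vf0 V) leNgt (vf_gt0 V) x0.
move=> xy; rewrite -(@ler_pM2r _ b1)// -lee_fin !EFinM -b1E -!mu_ballE//.
apply: le_measure; rewrite ?inE; [exact: measurable_vf_ball..|].
by move=> t /= /le_trans; exact.
Qed.

Lemma nuM x y : nu (x * y) = nu x * nu y.
Proof.
have [->|x0] := eqVneq x 0; first by rewrite mul0r nu0 mul0r.
have [->|y0] := eqVneq y 0; first by rewrite mulr0 nu0 mulr0.
have xy0 : x * y != 0 by rewrite mulf_neq0.
apply: (mulIf (lt0r_neq0 b1_gt0)); apply: EFin_inj.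
rewrite 2!EFinM -b1E EFinM -muleA -[((nu y)%:E * _)%E]mu_ballE//.
rewrite -(nuE x0).2; last exact: measurable_vf_ball.
rewrite -(nuE xy0).2; last exact: measurable_vf_ball.
congr (mu _); rewrite -ball_scale//; apply/seteqP; split=> [_ [t t1 <-]|_ [_ [t t1 <-] <-]].
  by exists (y * t); [exists t|rewrite mulrA].
by exists t => //; rewrite mulrA.
Qed.

Lemma nu1 : nu 1 = 1.
Proof.
have h : nu 1 * nu 1 = nu 1 * 1 by rewrite -nuM !mulr1.
by apply: (mulfI _ h); rewrite gt_eqF// nu_gt0// oner_neq0.
Qed.

Lemma nuV x : nu x^-1 = (nu x)^-1.
Proof.
have [->|x0] := eqVneq x 0; first by rewrite invr0 nu0 invr0.
have a0 : nu x != 0 by rewrite gt_eqF// nu_gt0.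
by apply: (mulfI a0); rewrite -nuM divff// divff// nu1.
Qed.

Lemma nuX x n : nu (x ^+ n) = nu x ^+ n.
Proof. by elim: n => [|n IH]; rewrite ?expr0 ?nu1// !exprS nuM IH. Qed.

Lemma nu_prod (I : Type) (r : seq I) (P : pred I) (f : I -> F) :
  nu (\prod_(i <- r | P i) f i) = \prod_(i <- r | P i) nu (f i).
Proof. by apply: (big_morph nu nuM nu1). Qed.

Lemma nuN1 : nu (-1) = 1.
Proof. by apply/eqP; rewrite -(@eqrXn2 _ 2) ?nu_ge0// -nuX sqrrN expr1n nu1 expr1n. Qed.

Lemma nu_eq0 x : (nu x == 0) = (x == 0).
Proof.
have [->|x0] := eqVneq x 0; first by rewrite nu0 eqxx.
by rewrite gt_eqF// nu_gt0.
Qed.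

(** The ball of radius [abs (z ^- 2)] contains the unit ball and, disjoint from it, an open shell of
    positive mass. The exponent 2 makes the shell non-empty even when the values of [abs] are
    discrete: it contains [z^-1]. *)
Lemma nu_lt1 z : 0 < abs z < 1 -> nu z < 1.
Proof.
move=> /andP[]; rewrite (vf_gt0 V) => z0 z1.
have az : 0 < abs z by rewrite (vf_gt0 V).
suff : 1 < nu (z ^- 2).
  rewrite nuV invf_gt1 ?nu_gt0 ?expf_neq0// nuX.
  by rewrite expr_lt1// nu_ge0.
rewrite -(@ltr_pM2r _ b1)// mul1r -lte_fin EFinM -b1E -mu_ballE ?invr_eq0 ?expf_neq0//.
pose A : set F := [set x | 1 < abs x < abs (z ^- 2)].
have oA : open A.
  have -> : A = (abs : F -> R^o) @^-1` (`]1, abs (z ^- 2)[%classic : set R^o).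
    by apply/seteqP; split=> x; rewrite /= in_itv.
  apply: open_comp; last exact: itv_open.
  by move=> x _; exact: (abs_continuous V).
have A0 : A !=set0.
  exists z^-1; rewrite /A/= !(vfV V) (vfX V) invf_gt1// z1/=.
  by rewrite ltf_pV2 ?posrE ?exprn_gt0// expr2 gtr_pMr.
have muA : (0 < mu A)%E by exact: (haar_open mu_haar).
apply: (@lt_le_trans _ _ (mu (cball 1 `|` A))).
  rewrite measureU; [|exact: measurable_vf_ball|exact: open_borel|].
    change (mu (cball 1%R) < mu (cball 1%R) + mu A)%E.
    by rewrite lteDl ?b1E.
  by apply/seteqP; split => // x [/= x1 /andP[]]; rewrite ltNge x1.
apply: le_measure; rewrite ?inE; [apply: measurableU; [exact: measurable_vf_ball|exact: open_borel]|exact: measurable_vf_ball|].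
move=> x [/= x1|/andP[_ /ltW//]]; rewrite /cball/= (le_trans x1)// (vfV V) (vfX V).
by rewrite invf_ge1 ?exprn_gt0// exprn_ile1 ?(vf_ge0 V)// ltW.
Qed.

Lemma nu_cvg0 e : 0 < e -> exists2 d, 0 < d & forall x, abs x < d -> nu x < e.
Proof.
move=> e0; have [z zz] := vf_small V; have nz := nu_lt1 zz.
have /andP[z0 z1] := zz.
have [n ne] : exists n, nu z ^+ n < e.
  have : (fun n => nu z ^+ n : R^o) @ \oo --> (0 : R^o).
    by apply: cvg_expr; rewrite ger0_norm ?nu_ge0.
  move=> /cvgrPdist_lt/(_ _ e0) [n _ /(_ n (leqnn _))].
  by rewrite sub0r normrN ger0_norm ?exprn_ge0 ?nu_ge0//; exists n.
exists (abs z ^+ n); first by rewrite exprn_gt0.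
move=> x xn; rewrite (le_lt_trans _ ne)// -nuX; apply: nu_le.
by rewrite (vfX V) ltW.
Qed.

(** The point [0] is fixed by dilations, so its finite mass equals [nu z] times itself with
    [nu z < 1]. *)
Lemma mu_point a : mu [set a] = 0%E.
Proof.
suff h : mu [set 0] = 0%E.
  rewrite -h -(haar_translation mu_haar a (measurable_point 0)).
  by congr (mu _); apply/seteqP; split=> [x ->|x [y -> <-]]; [exists 0; rewrite ?addr0|rewrite addr0].
have [z zz] := vf_small V; have nz := nu_lt1 zz.
have z0 : z != 0 by move/andP : zz => [+ _]; rewrite (vf_gt0 V).
have := (nuE z0).2 _ (measurable_point 0).
rewrite (_ : [set z * x | x in [set 0]] = [set 0]); last first.
  by apply/seteqP; split=> [x [y -> <-]|x ->]; [rewrite mulr0|exists 0; rewrite ?mulr0].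
have fin : mu [set 0] \is a fin_num.
  rewrite ge0_fin_numE// (le_lt_trans _ (mu_ball_fin 1))//.
  apply: le_measure; rewrite ?inE; [exact: measurable_point|exact: measurable_vf_ball|].
  by move=> x ->; rewrite /cball/= (vf0 V) ler01.
move=> h; have [c Hc] : exists c, mu [set 0] = c%:E by exists (fine (mu [set 0])); rewrite fineK.
have h2 : (nu z * c)%:E = c%:E by rewrite EFinM -Hc; exact: esym h.
have {}h : nu z * c = c by move: h2 => /eqP; rewrite eqe => /eqP.
rewrite Hc; congr EFin; apply/eqP.
have : (1 - nu z) * c = 0 by rewrite mulrBl mul1r h subrr.
by move/eqP; rewrite mulf_eq0 subr_eq0 gt_eqF.
Qed.

(** As [nu] is monotone in [abs], a non-trivial superlevel set is the complement of a ball about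
    [0], open or closed according to whether the infimum of [abs] on the set is attained. *)
Lemma measurable_nu : measurable_fun setT (nu : borel F -> R).
Proof.
apply: (measurability _ (RGenOInfty.measurableE R)).
move=> _ [_ [c ->] <-]; rewrite setTI.
have -> : nu @^-1` `]c, +oo[%classic = [set x | c < nu x].
  by apply/seteqP; split=> x /=; rewrite in_itv/= andbT.
have [c0|c0] := ltP c 0.
  rewrite (_ : mkset _ = setT)//; apply/seteqP; split=> // x _ /=.
  by rewrite (lt_le_trans c0)// nu_ge0.
pose S := [set x | c < nu x]; change (measurable (S : set (borel F))).
have [->|/set0P[x0 Sx0]] := eqVneq S set0; first exact: measurable0.
have lbS : has_lbound (abs @` S) by exists 0 => _ [x _ <-]; exact: (vf_ge0 V).
have infS : has_inf (abs @` S) by split => //; exists (abs x0); exists x0.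
pose r := inf (abs @` S).
have Sup x : r < abs x -> S x.
  move=> /inf_lt [|_ [y Sy <-] yx]; first by have [] := infS.
  by rewrite /S/= (lt_le_trans Sy)// nu_le// ltW.
have Slo x : S x -> r <= abs x by move=> Sx; apply: ge_inf => //; exists x.
have [[y Sy yr]|nS] := pselect (exists2 y, S y & abs y = r).
  rewrite (_ : S = ~` [set x | abs (x - 0) < r]).
    by apply: measurableC; apply: open_borel; exact: vf_open_ball.
  apply/seteqP; split=> x /=; rewrite subr0.
    by move=> Sx; apply/negP; rewrite -leNgt; exact: Slo.
  by move=> /negP; rewrite -leNgt -yr => yx; rewrite /S/= (lt_le_trans Sy)// nu_le.
rewrite (_ : S = ~` cball r); first by apply: measurableC; exact: measurable_vf_ball.
apply/seteqP; split=> x /=; rewrite /cball/=; last by move=> /negP; rewrite -ltNge; exact: Sup.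
move=> Sx; apply/negP; rewrite -ltNge lt_neqAle Slo// andbT.
by apply/eqP => rx; apply: nS; exists x.
Qed.

End Haar.

(** * Change of variables in one variable *)

Section ChangeOfVariable.
Context (R : realType) (F : topFieldType) (abs : F -> R).
Hypothesis V : valued_field abs.
Context (mu : {sigma_finite_measure set (borel F) -> \bar R}).
Hypothesis mu_haar : haar_measure mu.
Context (nu : F -> R).
Hypothesis nu0 : nu 0 = 0.
Hypothesis nuE : haar_modulus mu nu.
Local Open Scope ereal_scope.

Implicit Types f g : F -> \bar R.

Let mF f := measurable_fun setT (f : borel F -> \bar R).

Lemma measurable_addl (a : F) : measurable_fun setT ((fun t => (a + t)%R) : borel F -> borel F).
Proof.
apply: (@measurable_continuous_borel F _ (borel F) F id (fun t => a + t)%R).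
  exact: open_borel.
by move=> x; apply: (vf_continuousD V) => //; exact: cst_continuous.
Qed.

Lemma measurable_mull (a : F) : measurable_fun setT ((fun t => (a * t)%R) : borel F -> borel F).
Proof.
apply: (@measurable_continuous_borel F _ (borel F) F id (fun t => a * t)%R).
  exact: open_borel.
by move=> x; apply: (vf_continuousM V) => //; exact: cst_continuous.
Qed.

Lemma measurable_mul : measurable_fun setT
  ((fun z => (z.1 * z.2)%R) : borel F * borel F -> borel F).
Proof.
apply: (@measurable_continuous_borel F _ (borel F * borel F)%type (F * F)%type id
  (fun z => z.1 * z.2)%R).
  exact: (open_borel2 V).
by move=> x; apply: (vf_continuousM V); [exact: cvg_fst|exact: cvg_snd].
Qed.

Lemma measurable_mulf d (X : measurableType d) (f g : X -> borel F) :
  measurable_fun setT f -> measurable_fun setT g ->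
  measurable_fun setT ((fun x => ((f x : F) * (g x : F))%R) : X -> borel F).
Proof.
by move=> mf mg; exact: (measurableT_comp measurable_mul (measurable_fun_pair mf mg)).
Qed.

Lemma vf_inv_continuous (x : F) : x != 0%R -> continuous_at x (@GRing.inv F).
Proof.
move=> x0; apply/(vf_cont_at V) => e e0; have ax : (0 < abs x)%R by rewrite (vf_gt0 V).
apply/(vf_nbhs V); exists (Num.min (abs x / 2) (e * abs x ^+ 2 / 2))%R.
  by rewrite lt_min !divr_gt0 ?mulr_gt0 ?exprn_gt0.
move=> y; rewrite lt_min => /andP[y1 y2].
have ay : (abs x / 2 <= abs y)%R.
  have := vf_triangle V (x - y)%R y; rewrite subrK (vf_distC V); lra.
have ay0 : (0 < abs y)%R by rewrite (lt_le_trans _ ay)// divr_gt0.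
have y0 : y != 0%R by rewrite -(vf_gt0 V).
have -> : (y^-1 - x^-1 = (x - y) / (x * y))%R.
  by field; rewrite x0 y0.
rewrite (vfM V) (vfV V) (vfM V) (vf_distC V) ltr_pdivrMr ?mulr_gt0//.
apply: (lt_le_trans y2).
by rewrite expr2 -!mulrA ler_pM2l// ler_pM2l.
Qed.

(** Inversion is continuous off [0]. Because of the convention [0^-1 = 0], a preimage of an open set
    is an open set, possibly with the point [0] added. *)
Lemma measurable_inv : measurable_fun setT (@GRing.inv F : borel F -> borel F).
Proof.
apply: (@measurability _ _ (borel F) (borel F) setT _ (@open F)) => //.
move=> _ [B oB <-]; rewrite setTI.
have m1 : measurable ([set x : F | x != 0%R /\ B x^-1%R] : set (borel F)).
  apply: open_borel; rewrite openE => x [x0 Bx] /=.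
  have h1 : nbhs x [set y : F | y != 0%R].
    by apply: open_nbhs_nbhs; split => //; exact: (vf_open_neq0 V).
  have h2 : nbhs x [set y : F | B y^-1%R].
    by apply: vf_inv_continuous => //; apply: open_nbhs_nbhs; split.
  by apply: filterS2 h1 h2 => y.
have [B0|B0] := pselect (B 0%R).
  rewrite [X in measurable X](_ : _ = [set x : F | x != 0%R /\ B x^-1%R] `|` [set 0%R]).
    by apply: measurableU => //; exact: (measurable_point V).
  apply/seteqP; split=> x /=; last by case=> [[]//|->]; rewrite invr0.
  by have [->|x0] := eqVneq x 0%R => Bx; [right|left].
rewrite [X in measurable X](_ : _ = [set x : F | x != 0%R /\ B x^-1%R])//.
apply/seteqP; split=> x /=; last by case.
move=> Bx; split=> //; apply: contra_notN B0 => /eqP x0; by rewrite x0 invr0 in Bx.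
Qed.

Lemma integral_addl f a : mF f -> (forall t, 0 <= f t) ->
  \int[mu]_t f (a + t)%R = \int[mu]_t f t.
Proof.
move=> mf f0; pose phi : borel F -> borel F := fun t => (a + t)%R.
have mphi : measurable_fun setT phi := measurable_addl a.
have := @ge0_integral_pushforward _ _ _ _ R phi mphi mu setT f measurableT mf (fun y _ => f0 y).
rewrite preimage_setT => <-; apply: eq_measure_integral => A mA _.
rewrite [LHS](_ : _ = mu (phi @^-1` A))//.
rewrite -[RHS](haar_translation mu_haar (- a)%R mA); congr (mu _).
apply/seteqP; split=> [x /= Ax|_ [x Ax <-]].
  by exists (a + x)%R; rewrite ?addKr.
by rewrite /phi /preimage/= addNKr.
Qed.

Lemma integral_mull f z : z != 0%R -> mF f -> (forall t, 0 <= f t) ->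
  \int[mu]_t f (z * t)%R = ((nu z)^-1)%:E * \int[mu]_t f t.
Proof.
move=> z0 mf f0; pose phi : borel F -> borel F := fun t => (z * t)%R.
have mphi : measurable_fun setT phi := measurable_mull z.
have := @ge0_integral_pushforward _ _ _ _ R phi mphi mu setT f measurableT mf (fun y _ => f0 y).
rewrite preimage_setT => <-.
have k0 : (0 <= (nu z)^-1)%R by rewrite invr_ge0 (nu_ge0 nu0 nuE).
have := @ge0_integral_mscale _ _ R mu setT measurableT (NngNum k0) f mf (fun y _ => f0 y).
move=> /= <-; apply: eq_measure_integral => A mA _.
rewrite [LHS](_ : _ = mu (phi @^-1` A))//.
rewrite [RHS](_ : _ = ((nu z)^-1)%:E * mu A)//.
rewrite -(nuV V mu_haar nu0 nuE).
rewrite -[RHS](nuE _).2//; last by rewrite invr_eq0.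
congr (mu _).
apply/seteqP; split=> [x /= Ax|_ [x Ax <-]].
  by exists (z * x)%R; rewrite ?mulKf.
by rewrite /phi /preimage/= mulVKf.
Qed.

(** Points are null, so a substitution may break down at one parameter: [0] for inversion, [- c^-1]
    in the rank one formula. *)
Lemma eq_integral_neq f g a : mF f -> mF g -> (forall t, 0 <= f t) ->
  (forall t, 0 <= g t) -> (forall t, t != a -> f t = g t) ->
  \int[mu]_t f t = \int[mu]_t g t.
Proof.
move=> mf mg f0 g0 fg.
have m0 := measurable_point V a.
have mu0 := mu_point V mu_haar nu0 nuE a.
rewrite (ge0_negligible_integral m0)// [RHS](ge0_negligible_integral m0)//.
by apply: eq_integral => t; rewrite inE => -[_ /= /eqP]; exact: fg.
Qed.

End ChangeOfVariable.

(** * Inversion and homographic substitutions *)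

Section Inversion.
Context (R : realType) (F : topFieldType) (abs : F -> R).
Hypothesis V : valued_field abs.
Context (mu : {sigma_finite_measure set (borel F) -> \bar R}).
Hypothesis mu_haar : haar_measure mu.
Context (nu : F -> R).
Hypothesis nu0 : nu 0 = 0.
Hypothesis nuE : haar_modulus mu nu.
Local Open Scope ereal_scope.

Implicit Types f g : F -> \bar R.

Let mF f := measurable_fun setT (f : borel F -> \bar R).
Let nu_ge0 := nu_ge0 nu0 nuE.
Let nuV := nuV V mu_haar nu0 nuE.
Let nuM := nuM V mu_haar nu0 nuE.

(** Density of the multiplicative Haar measure [dt / nu t]. Its value at [0] is [0], from [nu 0 = 0]
    and [0^-1 = 0]; the point is null. *)
Let w t := ((nu t)^-1)%:E.
Let w_ge0 t : 0 <= w t. Proof. by rewrite lee_fin invr_ge0. Qed.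
Let mw : mF w.
Proof.
apply/measurable_EFinP; rewrite (_ : (fun _ => _) = (fun t : F => nu t^-1)%R); last first.
  by apply/funext => t; rewrite nuV.
by apply: (measurableT_comp (measurable_nu V mu_haar nu0 nuE)); exact: (measurable_inv V).
Qed.

Let I f := \int[mu]_t (w t * f t).

Let mwf f : mF f -> mF (fun t => w t * f t).
Proof. by move=> mf; apply: emeasurable_funM. Qed.

Let wf_ge0 f : (forall t, 0 <= f t) -> forall t, 0 <= w t * f t.
Proof. by move=> f0 t; rewrite mule_ge0. Qed.

Let I_mull f s : s != 0%R -> mF f -> (forall t, 0 <= f t) ->
  I (fun t => f (s * t)%R) = I f.
Proof.
move=> s0 mf f0; have ns : (nu s != 0)%R by rewrite gt_eqF// (nu_gt0 nuE).
have mss : mF (fun t => f (s * t)%R).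
  by apply: (measurableT_comp mf); exact: (measurable_mull V).
transitivity (\int[mu]_t ((nu s)%:E * (w (s * t)%R * f (s * t)%R))).
  apply: eq_integral => t _; rewrite muleA; congr (_ * _).
  by rewrite /w nuM -EFinM invfM mulrA divff// mul1r.
have mws : mF (fun t => w (s * t)%R * f (s * t)%R).
  exact: (measurableT_comp (mwf mf) (measurable_mull V s)).
rewrite ge0_integralZl//; last 2 first.
- by move=> t _; exact: (wf_ge0 f0).
- by rewrite lee_fin.
rewrite (integral_mull V mu_haar nu0 nuE s0 (mwf mf) (wf_ge0 f0)).
by rewrite muleA -EFinM divff// mul1e.
Qed.

Let mmul := measurable_mul V.
Let minv := measurable_inv V.

Let m2 (f : borel F -> \bar R) (h : borel F * borel F -> borel F) :
  mF f -> measurable_fun setT h -> measurable_fun setT (fun z => f (h z)).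
Proof. by move=> mf mh; exact: (measurableT_comp mf). Qed.

Let I_tonelli (h : borel F * borel F -> \bar R) :
  measurable_fun setT h -> (forall z, 0 <= h z) ->
  I (fun t => I (fun s => h (t, s))) = I (fun s => I (fun t => h (t, s))).
Proof.
move=> mh h0.
have mh1 t : mF (fun s => h (t, s)) by apply: (measurableT_comp mh); exact: measurable_pair1.
have mh2 s : mF (fun t => h (t, s)) by apply: (measurableT_comp mh); exact: measurable_pair2.
transitivity (\int[mu]_t \int[mu]_s (w t * (w s * h (t, s)))).
  apply: eq_integral => t _; rewrite -ge0_integralZl//; [exact: mwf|].
  by move=> s _; exact: (wf_ge0 (fun s => h0 (t, s))).
have mk : measurable_fun setT (fun z : borel F * borel F => w z.1 * (w z.2 * h z)).
  apply: emeasurable_funM; first exact: (m2 mw measurable_fst).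
  by apply: emeasurable_funM => //; exact: (m2 mw measurable_snd).
have := @fubini_tonelli _ _ _ _ R mu mu (fun z : borel F * borel F => w z.1 * (w z.2 * h z)) mk.
rewrite /= => ->; last by move=> z; rewrite !mule_ge0.
apply: eq_integral => s _; rewrite -ge0_integralZl//; [|exact: mwf|].
- by apply: eq_integral => t _; rewrite muleCA.
- by move=> t _; exact: (wf_ge0 (fun t => h0 (t, s))).
Qed.

Let IZl f c : mF f -> (forall t, 0 <= f t) -> 0 <= c -> I (fun t => c * f t) = c * I f.
Proof.
move=> mf f0 c0; rewrite /I -ge0_integralZl//; [|exact: mwf|by move=> t _; exact: wf_ge0].
by apply: eq_integral => t _; rewrite muleCA.
Qed.

Let eqI f g : (forall t, t != 0%R -> f t = g t) -> I f = I g.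
Proof.
move=> fg; apply: eq_integral => t _; have [->|/fg->//] := eqVneq t 0%R.
by rewrite /w nu0 invr0 !mul0e.
Qed.

(* Uniqueness of the Haar measure dt/nu(t) of the multiplicative group: by
   Tonelli, both sides multiplied by I K are the same double integral. *)
Let I_inv f : mF f -> (forall t, 0 <= f t) -> I (fun t => f t^-1%R) = I f.
Proof.
move=> mf f0.
pose C : set F := [set x | (abs x <= 1)%R].
have mC : measurable (C : set (borel F)) by exact: (@measurable_vf_ball _ _ _ V 1%R).
(* The factor [nu] cancels the weight, so [I K] is the mass of the unit ball: finite and positive,
   hence cancellable. *)
pose K t := (nu t * \1_C t)%:E.
have K0 t : 0 <= K t by rewrite lee_fin mulr_ge0// indicE.
have mK : mF K.
  apply/measurable_EFinP/measurable_funM; first exact: (measurable_nu V mu_haar nu0 nuE).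
  exact: measurable_indic.
have IK : I K = mu C.
  transitivity (mu (C `&` setT)); last by rewrite setIT.
  rewrite -integral_indic//.
  apply: (eq_integral_neq V mu_haar nu0 nuE (a := 0%R)) => [|||t|t t0].
  - exact: mwf.
  - by apply/measurable_EFinP; exact: measurable_indic.
  - exact: wf_ge0.
  - by rewrite lee_fin indicE.
  - by rewrite /w /K -EFinM mulrA mulVf ?mul1r// gt_eqF// (nu_gt0 nuE).
have IK_fin : I K \is a fin_num.
  by rewrite ge0_fin_numE; rewrite IK ?measure_ge0//; exact: (mu_ball_fin V mu_haar).
have IK_gt0 : 0 < I K by rewrite IK; exact: (mu_ball_gt0 V mu_haar ltr01).
have mfi : mF (fun t => f t^-1%R) by exact: (measurableT_comp mf minv).
suff : I K * I (fun t => f t^-1%R) = I K * I f.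
  case: (I K) IK_fin IK_gt0 => // k _; rewrite lte_fin => k0.
  move=> /(congr1 (mule (k^-1)%:E)); rewrite !muleA -!EFinM mulVf ?gt_eqF//.
  by rewrite !mul1e.
have swap1 : measurable_fun setT (fun z : borel F * borel F => f z.1^-1%R * K (z.1 * z.2)%R).
  apply: emeasurable_funM; last exact: (m2 mK mmul).
  exact: (m2 mfi measurable_fst).
have swap2 : measurable_fun setT (fun z : borel F * borel F => f (z.1 * z.2^-1)%R * K z.2).
  apply: emeasurable_funM; last exact: (m2 mK measurable_snd).
  apply: (m2 mf); apply: (measurable_mulf V); first exact: measurable_fst.
  exact: (measurableT_comp minv measurable_snd).
have mKs s : mF (fun t => K (s * t)%R) by apply: (measurableT_comp mK); exact: (measurable_mull V).
have fK1 (t s : F) : 0 <= f t^-1%R * K s by rewrite mule_ge0.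
transitivity (I (fun t => I (fun s => f t^-1%R * K (t * s)%R))).
  transitivity (I (fun t => I K * f t^-1%R)); first by rewrite IZl// ltW.
  apply: eqI => t t0; rewrite IZl// muleC; congr (_ * _).
  by rewrite (I_mull t0).
rewrite (I_tonelli swap1); last by move=> z; exact: fK1.
transitivity (I (fun s => I (fun t => f (s * t^-1)%R * K t))).
  apply: eqI => s s0 /=.
  rewrite -[RHS](I_mull s0); last 2 first.
  - exact: (measurableT_comp swap2 (measurable_pair1 (s : borel F))).
  - by move=> t; rewrite mule_ge0.
  apply: eq_integral => t _; congr (_ * (f _ * _)); last by rewrite mulrC.
  have [->|t0] := eqVneq t 0%R; first by rewrite mulr0 invr0 mulr0.
  by field; rewrite s0 t0.
etransitivity; first by apply: (I_tonelli swap2) => z; rewrite /= mule_ge0.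
transitivity (I (fun t => I f * K t)).
  apply: eqI => t t0 /=.
  transitivity (I (fun s => K t * f (t^-1 * s)%R)).
    by apply: eq_integral => s _; rewrite (mulrC t^-1%R) [K t * _]muleC.
  rewrite IZl//; last by apply: (measurableT_comp mf); exact: (measurable_mull V).
  by rewrite muleC (@I_mull f) ?invr_eq0.
rewrite IZl//; first by rewrite muleC.
by apply: integral_ge0 => t _; exact: wf_ge0.
Qed.

(** The invariance of the multiplicative measure is applied to [nu t * f t]: the weight and the
    factor [nu], evaluated at [t^-1], combine to [nu t ^- 2]. *)
Lemma integral_inv f : mF f -> (forall t, 0 <= f t) ->
  \int[mu]_t ((nu t ^- 2)%:E * f t^-1%R) = \int[mu]_t f t.
Proof.
move=> mf f0.
have mnu : mF (fun t => (nu t)%:E) by apply/measurable_EFinP; exact: (measurable_nu V mu_haar nu0 nuE).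
pose g t := (nu t)%:E * f t.
have mg : mF g by apply: emeasurable_funM.
have g0 t : 0 <= g t by rewrite mule_ge0// lee_fin.
transitivity (I (fun t => g t^-1%R)).
  apply: eq_integral => t _; rewrite /w /g muleA -EFinM nuV.
  by congr (_%:E * _); rewrite expr2 invfM.
rewrite I_inv//; apply: (eq_integral_neq V mu_haar nu0 nuE (a := 0%R)) => //.
- exact: mwf.
- by move=> t; exact: wf_ge0.
- move=> t t0; rewrite /w /g muleA -EFinM mulVf ?mul1e//.
  by rewrite gt_eqF// (nu_gt0 nuE).
Qed.

(** [t / (1 + c t)] is the inverse of [c + t^-1]: the substitution is a translation between two
    inversions, and the Jacobians of the inversions account for the weight. *)
Lemma integral_moebius f c : mF f -> (forall t, 0 <= f t) ->
  \int[mu]_t ((nu (1 + c * t) ^- 2)%:E * f (t / (1 + c * t))%R) = \int[mu]_t f t.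
Proof.
move=> mf f0.
have mnu2 : mF (fun t => (nu t ^- 2)%:E).
  apply/measurable_EFinP; rewrite (_ : (fun _ => _) = (fun t => (nu t^-1 ^+ 2)%R)); last first.
    by apply/funext => t; rewrite nuV exprVn.
  apply: measurable_funX; apply: (measurableT_comp (measurable_nu V mu_haar nu0 nuE)).
  exact: (measurable_inv V).
have maff : measurable_fun setT (fun t : borel F => (1 + c * t)%R : borel F).
  exact: (measurableT_comp (measurable_addl V 1%R) (measurable_mull V c)).
pose g t := (nu (1 + c * t) ^- 2)%:E * f (t / (1 + c * t))%R.
have nu2_ge0 t : 0 <= (nu t ^- 2)%:E by rewrite lee_fin invr_ge0 exprn_ge0.
have mg : mF g.
  apply: emeasurable_funM; first exact: (measurableT_comp mnu2 maff).
  apply: (measurableT_comp mf); apply: (measurable_mulf V) => //.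
  exact: (measurableT_comp minv maff).
have g_ge0 t : 0 <= g t by rewrite mule_ge0.
pose h t := (nu t ^- 2)%:E * f t^-1%R.
have mh : mF h by apply: emeasurable_funM => //; exact: (measurableT_comp mf minv).
have h_ge0 t : 0 <= h t by rewrite mule_ge0.
rewrite -[LHS](integral_inv mg g_ge0).
transitivity (\int[mu]_t h (c + t)%R); last first.
  by rewrite (integral_addl V mu_haar c mh h_ge0) integral_inv.
apply: (eq_integral_neq V mu_haar nu0 nuE (a := 0%R)) => //.
- apply: emeasurable_funM => //; exact: (measurableT_comp mg minv).
- exact: (measurableT_comp mh (measurable_addl V c)).
- by move=> t; rewrite mule_ge0.
move=> t t0; rewrite /g /h muleA -EFinM -invfM -exprMn -nuM.
have e1 : (t * (1 + c * t^-1) = c + t)%R by field.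
rewrite e1; congr (_ * f _).
(* At [t = - c] both arguments of [f] are [0] by the convention [0^-1 = 0]. *)
have [z|nz] := eqVneq (c + t)%R 0%R.
  have -> : (1 + c / t = 0)%R by apply: (mulfI t0); rewrite e1 z mulr0.
  by rewrite z invr0 mulr0.
have nz' : (1 + c / t != 0)%R by apply: contra_neq nz => z; rewrite -e1 z mulr0.
by rewrite -e1 invfM.
Qed.
End Inversion.

(** * Transvections *)

Section Transvection.
Context (F : topFieldType) (N : nat).
Implicit Types (p q r s : 'I_N) (t u c : F) (x : 'M[F]_N).

Definition transv p q t : 'M[F]_N := 1%:M + t *: delta_mx p q.

Lemma mul_delta_mx_scale p q r s t u :
  (t *: delta_mx p q) *m (u *: delta_mx r s) =
  (if q == r then (t * u) *: delta_mx p s else 0) :> 'M[F]_N.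
Proof.
rewrite -scalemxAl -scalemxAr scalerA mul_delta_mx_cond.
by case: eqP => _; rewrite ?mulr1n ?mulr0n ?scaler0.
Qed.

Lemma transvM p q r s t u : transv p q t *m transv r s u =
  1%:M + t *: delta_mx p q + u *: delta_mx r s +
  (if q == r then (t * u) *: delta_mx p s else 0).
Proof.
rewrite /transv mulmxDl mul1mx mulmxDr mulmx1 mul_delta_mx_scale.
by rewrite -!addrA; congr (_ + _); rewrite addrCA.
Qed.

Lemma transv0 p q : transv p q 0 = 1%:M.
Proof. by rewrite /transv scale0r addr0. Qed.

Lemma transvD p q t u : p != q -> transv p q t *m transv p q u = transv p q (t + u).
Proof.
by move=> pq; rewrite transvM eq_sym (negbTE pq) addr0 /transv scalerDl addrA.
Qed.

Lemma transvC p q r s t u : q != r -> s != p ->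
  transv p q t *m transv r s u = transv r s u *m transv p q t.
Proof.
by move=> qr sp; rewrite !transvM (negbTE qr) (negbTE sp) !addr0 addrAC.
Qed.

(** Steinberg relation, arranged, like [transv_comml], so that the integration variable [t] ends up
    next to the argument; the factors moved to its left are then absorbed by invariance. *)
Lemma transv_commr a b q t u : a != b -> b != q -> a != q ->
  transv a b t *m transv b q u =
  transv b q u *m (transv a q (t * u) *m transv a b t).
Proof.
move=> ab bq aq; rewrite transvM eqxx transvM (eq_sym q a) (negbTE aq) addr0.
rewrite /transv !mulmxDl !mulmxDr !mul1mx !mulmx1 !mul_delta_mx_scale.
rewrite (eq_sym q a) (negbTE aq) !addr0.
by apply/matrixP => i j; rewrite !mxE; ring.
Qed.

Lemma transv_comml a b p t u : a != b -> b != p -> a != p ->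
  transv a b t *m transv p a u =
  transv p b (- (u * t)) *m (transv p a u *m transv a b t).
Proof.
move=> ab bp ap; rewrite !transvM (negbTE bp) eqxx addr0.
rewrite /transv !mulmxDl !mulmxDr !mul1mx !mulmx1 !mul_delta_mx_scale.
rewrite (eq_sym b a) (negbTE ab) (negbTE bp) !addr0.
by apply/matrixP => i j; rewrite !mxE; ring.
Qed.

Lemma transv_unit p q t : p != q -> transv p q t \in unitmx.
Proof.
move=> pq; have : transv p q t *m transv p q (- t) = 1%:M.
  by rewrite transvD// subrr transv0.
by move/mulmx1_unit => [].
Qed.

Lemma diag_transv (d : 'rV[F]_N) p q t : d 0 p != 0 ->
  transv p q t *m diag_mx d =
  diag_mx d *m transv p q ((d 0 q / d 0 p) * t).
Proof.
move=> dp; apply/matrixP => i j.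
rewrite /transv mulmxDl mulmxDr mul1mx mulmx1 !mxE; congr (_ + _).
rewrite (bigD1 j)//= !mxE eqxx mulr1n big1 ?addr0; last first.
  by move=> l lj; rewrite !mxE (negbTE lj) mulr0n mulr0.
rewrite (bigD1 i)//= !mxE eqxx mulr1n big1 ?addr0; last first.
  by move=> l lj; rewrite !mxE eq_sym (negbTE lj) mulr0n mul0r.
case: (eqVneq i p) => [->|]; last by rewrite !mulr0 mul0r.
case: (eqVneq j q) => [->|]; last by rewrite !mulr0 mul0r.
by rewrite /= !mulr1 mulrCA mulrA -(mulrA _ _^-1); field.
Qed.

(* Matrix form of t |-> t / (1 + c t): the rank one Bruhat identity. *)
Lemma transv_bruhat a b t c : a != b -> 1 + c * t != 0 ->
  transv a b t *m transv b a c =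
  transv b a (c / (1 + c * t)) *m
  (diag_mx (\row_i (if i == a then 1 + c * t else if i == b then (1 + c * t)^-1 else 1)) *m
   transv a b (t / (1 + c * t))).
Proof.
move=> ab ct.
have ba : b != a by rewrite eq_sym.
have -> : diag_mx (\row_i (if i == a then 1 + c * t else if i == b then (1 + c * t)^-1 else 1)) =
    1%:M + (c * t) *: delta_mx a a + ((1 + c * t)^-1 - 1) *: delta_mx b b :> 'M[F]_N.
  apply/matrixP => i j; rewrite !mxE; case: (eqVneq i j) => [<-|ij].
    have [ia|ia] := eqVneq i a.
      by rewrite ia (negbTE ab) /= mulr1 mulr0 addr0 mulr1n.
    have [ib|ib] := eqVneq i b; rewrite /= mulr1n.
      by rewrite mulr0 addr0 mulr1 addrC subrK.
    by rewrite !mulr0 !addr0.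
  rewrite mulr0n add0r.
  have -> : (i == a) && (j == a) = false.
    by apply/negbTE/negP => /andP[/eqP ia /eqP ja]; rewrite ia ja eqxx in ij.
  have -> : (i == b) && (j == b) = false.
    by apply/negbTE/negP => /andP[/eqP ia /eqP ja]; rewrite ia ja eqxx in ij.
  by rewrite !mulr0 addr0.
rewrite transvM eqxx /transv !mulmxDl !mulmxDr !mul1mx !mulmx1 !mul_delta_mx_scale.
rewrite !eqxx (negbTE ab) (negbTE ba).
rewrite !mul_delta_mx_scale !eqxx ?(negbTE ab) ?(negbTE ba) ?mulmx0 ?addr0.
by apply/matrixP => i j; rewrite !mxE; field.
Qed.

End Transvection.

(** * Integration along a transvection subgroup *)

Section TransvectionIntegral.
Context (R : realType) (F : topFieldType) (abs : F -> R).
Hypothesis V : valued_field abs.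
Context (mu : {sigma_finite_measure set (borel F) -> \bar R}).
Hypothesis mu_haar : haar_measure mu.
Context (nu : F -> R).
Hypothesis nu0 : nu 0 = 0.
Hypothesis nuE : haar_modulus mu nu.
Context (N : nat).
Local Open Scope ereal_scope.
Implicit Types (p q r s : 'I_N) (t u c : F) (x : 'M[F]_N) (g : 'M[F]_N -> \bar R).

Definition tint p q g x := \int[mu]_t g (transv p q t *m x).

Definition nonneg_borel g :=
  measurable_fun setT (g : mxborel F N N -> \bar R) /\ forall x, 0 <= g x.

Let mF (f : F -> \bar R) := measurable_fun setT (f : borel F -> \bar R).

Lemma transv_continuous p q : continuous (transv p q : F -> 'M[F]_N).
Proof.
move=> t; apply: mx_continuous => i j.
rewrite (_ : (fun _ => _) = (fun y => 1%:M i j + y * delta_mx p q i j)%R); last first.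
  by apply/funext => y; rewrite !mxE.
apply: (vf_continuousD V); first exact: cst_continuous.
by apply: (vf_continuousM V) => //; exact: cst_continuous.
Qed.

Lemma measurable_transv_mul p q : measurable_fun setT
  ((fun z => transv p q z.1 *m z.2) : borel F * mxborel F N N -> mxborel F N N).
Proof.
apply: (@measurable_continuous_mx F _ (borel F * mxborel F N N)%type
  (F * 'M[F]_N)%type id N N (fun z => transv p q z.1 *m z.2)).
  exact: (open_borel_mx V).
move=> z; apply: (mulmx_continuous V); last exact: cvg_snd.
exact: (continuous_comp (@cvg_fst _ _ _ _ _) (@transv_continuous p q _)).
Qed.

Lemma measurable_mulmxl y : measurable_fun setT
  ((fun x => y *m x) : mxborel F N N -> mxborel F N N).
Proof.
apply: (@measurable_continuous_mx F _ (mxborel F N N)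
  'M[F]_N id N N (fun x => y *m x)); first exact: open_mxborel.
by move=> x; apply: (mulmx_continuous V) => //; exact: cst_continuous.
Qed.

Lemma measurable_mulmxr y : measurable_fun setT
  ((fun x => x *m y) : mxborel F N N -> mxborel F N N).
Proof.
apply: (@measurable_continuous_mx F _ (mxborel F N N)
  'M[F]_N id N N (fun x => x *m y)); first exact: open_mxborel.
by move=> x; apply: (mulmx_continuous V) => //; exact: cst_continuous.
Qed.

Lemma measurable_transv p q x g : nonneg_borel g -> mF (fun t => g (transv p q t *m x)).
Proof.
move=> [mg _].
exact: (measurableT_comp mg (measurableT_comp (measurable_transv_mul p q)
  (measurable_pair2 (x : mxborel F N N)))).
Qed.

Lemma tint_ge0 p q g x : nonneg_borel g -> 0 <= tint p q g x.
Proof. by move=> [_ g0]; apply: integral_ge0. Qed.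

Lemma nonneg_borel_tint p q g : nonneg_borel g -> nonneg_borel (tint p q g).
Proof.
move=> ng; split=> [|x]; last exact: tint_ge0.
have mh := measurableT_comp ng.1 (measurable_transv_mul p q).
exact: (@measurable_fun_fubini_tonelli_G _ _ _ _ R mu _ mh (fun z => ng.2 _)).
Qed.

Lemma nonneg_borel_mull y g : nonneg_borel g -> nonneg_borel (fun x => g (y *m x)).
Proof. by move=> [mg g0]; split => //; exact: (measurableT_comp mg (measurable_mulmxl y)). Qed.

Lemma nonneg_borel_mulr y g : nonneg_borel g -> nonneg_borel (fun x => g (x *m y)).
Proof. by move=> [mg g0]; split => //; exact: (measurableT_comp mg (measurable_mulmxr y)). Qed.

Lemma tintC p q r s g : q != r -> s != p -> nonneg_borel g ->
  tint p q (tint r s g) = tint r s (tint p q g).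
Proof.
move=> qr sp ng; apply/funext => x; rewrite /tint.
have mh : measurable_fun setT
    (fun z : borel F * borel F => g (transv r s z.2 *m (transv p q z.1 *m x))).
  have m1 : measurable_fun setT (fun z : borel F * borel F => transv p q z.1 *m x : mxborel F N N).
    exact: (measurableT_comp (measurable_transv_mul p q)
      (measurable_fun_pair measurable_fst (measurable_cst (x : mxborel F N N)))).
  exact: (measurableT_comp ng.1 (measurableT_comp (measurable_transv_mul r s)
      (measurable_fun_pair measurable_snd m1))).
have /= -> := @fubini_tonelli _ _ _ _ R mu mu _ mh (fun z => ng.2 _).
apply: eq_integral => u _; apply: eq_integral => t _.
by rewrite mulmxA -transvC// mulmxA.
Qed.

Definition linv p q g := forall c x, g (transv p q c *m x) = g x.

Lemma tint_linv p q g : p != q -> nonneg_borel g -> linv p q (tint p q g).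
Proof.
move=> pq ng c x; rewrite /tint.
rewrite -[RHS](integral_addl V mu_haar c)//.
- by apply: eq_integral => t _; rewrite mulmxA transvD// addrC.
- exact: measurable_transv.
- by move=> t; exact: ng.2.
Qed.

Lemma linv_tintC p q r s g : q != r -> s != p -> linv p q g -> linv p q (tint r s g).
Proof.
move=> qr sp ig c x; apply: eq_integral => t _.
by rewrite mulmxA transvC// -mulmxA ig.
Qed.

(** Moving the integration variable past [transv b q] leaves a factor [transv a q], which is why
    both invariances are assumed. *)
Lemma linv_tintr a b q g : a != b -> b != q -> a != q ->
  linv b q g -> linv a q g -> linv b q (tint a b g).
Proof.
move=> ab bq aq i1 i2 c x; apply: eq_integral => t _.
by rewrite mulmxA transv_commr// -!mulmxA i1 i2.
Qed.

Lemma linv_tintl a b p g : a != b -> b != p -> a != p ->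
  linv p a g -> linv p b g -> linv p a (tint a b g).
Proof.
move=> ab bq aq i1 i2 c x; apply: eq_integral => t _.
by rewrite mulmxA transv_comml// -!mulmxA i2 i1.
Qed.

Lemma tint_diag (d : 'rV[F]_N) p q g x : (forall i, d 0%R i != 0%R) ->
  nonneg_borel g ->
  tint p q g (diag_mx d *m x) =
  (nu (d 0%R p / d 0%R q))%:E * tint p q (fun y => g (diag_mx d *m y)) x.
Proof.
move=> d0 ng; have dpq : (d 0 q / d 0 p != 0)%R by rewrite mulf_neq0// invr_eq0.
rewrite /tint.
under eq_integral do rewrite mulmxA diag_transv// -mulmxA.
have := integral_mull V mu_haar nu0 nuE dpq
  (measurable_transv p q x (nonneg_borel_mull (diag_mx d) ng)) (fun t => ng.2 _).
by move=> ->; rewrite -(nuV V mu_haar nu0 nuE) invf_div.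
Qed.

(* Integrating a density over the projective line. *)
Lemma tint_rank1 a b g : a != b -> nonneg_borel g -> linv b a g ->
  (forall (e : F) x, e != 0%R ->
    g (diag_mx (\row_i (if i == a then e else if i == b then e^-1 else 1))%R *m x) =
    (nu e ^- 2)%:E * g x) ->
  linv b a (tint a b g).
Proof.
move=> ab ng ig dg c x; rewrite /tint.
have [->|c0] := eqVneq c 0%R; first by rewrite transv0 mul1mx.
have mg y := measurable_transv a b y ng.
rewrite -[RHS](integral_moebius V mu_haar nu0 nuE c (mg x) (fun t => ng.2 _)).
apply: (eq_integral_neq V mu_haar nu0 nuE (a := (- c^-1)%R)).
- exact: mg.
- apply: emeasurable_funM.
  apply/measurable_EFinP; rewrite (_ : (fun _ => _) = (fun t => (nu (1 + c * t)^-1 ^+ 2)%R)); last first.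
    by apply/funext => t; rewrite (nuV V mu_haar nu0 nuE) exprVn.
  apply: measurable_funX; apply: (measurableT_comp (measurable_nu V mu_haar nu0 nuE)).
  apply: (measurableT_comp (measurable_inv V)).
  exact: (measurableT_comp (measurable_addl V 1%R) (measurable_mull V c)).
  apply: (measurableT_comp (mg x)); apply: (measurable_mulf V) => //.
  apply: (measurableT_comp (measurable_inv V)).
  exact: (measurableT_comp (measurable_addl V 1%R) (measurable_mull V c)).
- by move=> t; exact: ng.2.
- by move=> t; rewrite mule_ge0 ?ng.2// lee_fin invr_ge0 exprn_ge0// (nu_ge0 nu0 nuE).
move=> t tc.
have ct : (1 + c * t != 0)%R.
  apply: contra_neq tc => h; apply: (mulfI c0).
  by rewrite mulrN divff//; apply/eqP; rewrite -subr_eq0 opprK addrC h.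
by rewrite mulmxA transv_bruhat// -!mulmxA ig dg.
Qed.

Lemma tintD p q g h x : nonneg_borel g -> nonneg_borel h ->
  tint p q (fun y => g y + h y) x = tint p q g x + tint p q h x.
Proof.
move=> ng nh; rewrite /tint ge0_integralD//.
- by move=> t _; exact: ng.2.
- exact: measurable_transv.
- by move=> t _; exact: nh.2.
- exact: measurable_transv.
Qed.

Lemma tintZ p q g (c : R) x : (0 <= c)%R -> nonneg_borel g ->
  tint p q (fun y => c%:E * g y) x = c%:E * tint p q g x.
Proof.
move=> c0 ng; rewrite /tint ge0_integralZl//.
- exact: measurable_transv.
- by move=> t _; exact: ng.2.
Qed.

Lemma tint_le p q g h x : nonneg_borel g -> nonneg_borel h ->
  (forall y, g y <= h y) -> tint p q g x <= tint p q h x.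
Proof.
move=> ng nh gh; apply: ge0_le_integral => //.
- by move=> t _; exact: ng.2.
- exact: measurable_transv.
- exact: measurable_transv.
Qed.

Lemma nonneg_borelD g h : nonneg_borel g -> nonneg_borel h -> nonneg_borel (fun x => g x + h x).
Proof.
move=> [mg g0] [mh h0]; split=> [|x]; last by rewrite adde_ge0.
exact: (emeasurable_funD mg mh).
Qed.

Lemma nonneg_borelZ (c : R) g : (0 <= c)%R -> nonneg_borel g -> nonneg_borel (fun x => c%:E * g x).
Proof.
move=> c0 [mg g0]; split=> [|x]; last by rewrite mule_ge0// lee_fin.
exact: (measurable_funeM _ mg).
Qed.

End TransvectionIntegral.

(** * Generation of GL by transvections and diagonal matrices *)

Section GLGeneration.
Context (F : topFieldType) (N : nat).
Implicit Types (A B E : 'M[F]_N).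

Lemma transv_mulE (p q : 'I_N) t E i j :
  (transv p q t *m E) i j = E i j + (i == p)%:R * t * E q j.
Proof.
rewrite /transv mulmxDl mul1mx -scalemxAl !mxE; congr (_ + _).
rewrite (bigD1 q)//= !mxE eqxx andbT big1 ?addr0; last first.
  by move=> l lq; rewrite !mxE (negbTE lq) andbF mul0r.
by rewrite mulrA (mulrC t).
Qed.

(** Gaussian elimination by row operations, clearing one column after the other. The set [S] is
    assumed closed under products but not under inverses. *)
Lemma unitmx_gen (S : 'M[F]_N -> Prop) :
  (forall p q t, p != q -> S (transv p q t)) ->
  (forall d : 'rV[F]_N, (forall i, d 0 i != 0) -> S (diag_mx d)) ->
  (forall A B, S A -> S B -> S (A *m B)) ->
  forall A, A \in unitmx -> S A.
Proof.
move=> St Sd SM.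
have S1 : S 1%:M.
  rewrite -diag_const_mx; apply: Sd => i; by rewrite mxE oner_neq0.
(* The left inverse of [invmx A] is [A], so finding left inverses in [S] puts every invertible
   matrix into [S]. *)
suff elim A : A \in unitmx -> exists2 B, S B & B *m A = 1%:M.
  move=> A uA; have [|B SB BA] := elim (invmx A); first by rewrite unitmx_inv.
  by rewrite -[A]mul1mx -BA mulmxKV.
move=> uA; suff main r : (r <= N)%N -> exists2 B, S B & B \in unitmx /\
    forall i j : 'I_N, (j < r)%N -> (B *m A) i j = (i == j)%:R.
  have [B SB [uB BA]] := main N (leqnn N).
  by exists B => //; apply/matrixP => i j; rewrite BA// mxE.
elim: r => [_|r IH rN]; first by exists 1%:M => //; split => //; exact: unitmx1.
have [B SB [uB BA]] := IH (ltnW rN) => {IH}.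
pose c := Ordinal rN.
(* Multiples of row [c] are subtracted from the rows listed in [s]. Row [c] is zero in the columns
   before [r], which therefore stay reduced. *)
have clear (s : seq 'I_N) E : c \notin s -> uniq s -> E \in unitmx -> E c c = 1 ->
    (forall i j : 'I_N, (j < r)%N -> E i j = (i == j)%:R) ->
    exists2 M, S M & M \in unitmx /\
      [/\ forall i j : 'I_N, (j < r)%N -> (M *m E) i j = (i == j)%:R,
       (M *m E) c c = 1,
       forall i, i \in s -> (M *m E) i c = 0 &
       forall i, i \notin s -> (M *m E) i c = E i c].
  elim: s => [|i s IH] cs us uE Ec Er.
    by exists 1%:M => //; split; [exact: unitmx1|rewrite mul1mx].
  move: cs us; rewrite in_cons negb_or => /andP[ci cs] /= /andP[si us].
  have [M SM' [uM [Mr Mc Ms Mns]]] := IH cs us uE Ec Er.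
  have ic : i != c by rewrite eq_sym.
  exists (transv i c (- E i c) *m M); first by apply: SM => //; exact: St.
  split; first by rewrite unitmx_mul transv_unit.
  rewrite -mulmxA; split.
  - move=> a j jr; rewrite transv_mulE !Mr// (_ : c == j = false) ?mulr0 ?addr0//.
    by apply/negbTE; rewrite -val_eqE /= neq_ltn jr orbT.
  - by rewrite transv_mulE (negbTE ci) !mul0r addr0.
  - move=> a; rewrite in_cons transv_mulE Mc mulr1 => /predU1P[->|aS].
      by rewrite eqxx mul1r Mns// subrr.
    rewrite (_ : a == i = false) ?mul0r ?addr0 ?Ms//.
    by apply/negbTE; apply: contraNneq si => <-.
  - move=> a; rewrite in_cons negb_or transv_mulE => /andP[/negbTE-> aS].
    by rewrite !mul0r addr0 Mns.
have finish M E : S M -> M \in unitmx -> E = M *m (B *m A) -> E c c != 0 ->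
    (forall i j : 'I_N, (j < r)%N -> E i j = (i == j)%:R) ->
    exists2 B, S B & B \in unitmx /\
      forall i j : 'I_N, (j < r.+1)%N -> (B *m A) i j = (i == j)%:R.
  move=> SM' uM EE Ec Er.
  pose d : 'rV[F]_N := \row_i (if i == c then (E c c)^-1 else 1).
  have d0 i : d 0 i != 0.
    by rewrite mxE; case: ifP => _; [rewrite invr_eq0|exact: oner_neq0].
  have uD : diag_mx d \in unitmx.
    by rewrite unitmxE det_diag unitfE; apply/prodf_neq0 => i _.
  have uE : E \in unitmx by rewrite EE !unitmx_mul uM uB.
  have [|||||L SL [uL [Lr Lc Ls _]]] := clear (rem c (enum 'I_N)) (diag_mx d *m E).
  - by rewrite mem_rem_uniq ?enum_uniq// !inE eqxx.
  - by rewrite rem_uniq// enum_uniq.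
  - by rewrite unitmx_mul uD.
  - by rewrite mul_diag_mx !mxE eqxx mulVf.
  - move=> i j jr; rewrite mul_diag_mx !mxE (Er i j)//.
    case: (eqVneq i j) => [->|_]; last by rewrite mulr0.
    rewrite (_ : j == c = false) ?mulr1//.
    by apply/negbTE; rewrite -val_eqE /= neq_ltn jr.
  exists (L *m (diag_mx d *m (M *m B))).
    by apply: (SM _ _ SL); apply: (SM _ _ (Sd _ d0)); exact: SM.
  split; first by rewrite !unitmx_mul uL uD uM uB.
  have -> : L *m (diag_mx d *m (M *m B)) *m A = L *m (diag_mx d *m E).
    by rewrite EE !mulmxA.
  move=> i j; rewrite ltnS leq_eqVlt => /orP[/eqP jr|]; last exact: Lr.
  have -> : j = c by exact: val_inj.
  have [->|ic] := eqVneq i c; first by rewrite Lc.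
  by rewrite Ls// mem_rem_uniq ?enum_uniq// !inE ic mem_enum.
have uE : B *m A \in unitmx by rewrite unitmx_mul uB.
move: (B *m A) BA finish uE => E BA finish uE.
have [p [pr Ep]] : exists p : 'I_N, (r <= p)%N /\ E p c != 0.
  apply: contrapT => H.
  have {}H (p : 'I_N) : (r <= p)%N -> E p c = 0.
    by move=> rp; apply/eqP/negPn/negP => Ep; apply: H; exists p.
  (* Without a pivot, column [c] is a combination of the first [r] columns, which are unit vectors,
     and [v] is a non-zero kernel vector. *)
  pose v : 'cV[F]_N := \col_i (if (i < r)%N then - E i c else (i == c)%:R).
  have Ev : E *m v = 0.
    apply/matrixP => i j; rewrite !mxE (bigID (fun l : 'I_N => (l < r)%N))/=.
    rewrite [X in _ + X](bigD1 c) ?ltnn//= [X in _ + (_ + X)]big1 ?addr0; last first.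
      by move=> l /andP[lr lc]; rewrite mxE (negbTE lr) (negbTE lc) mulr0.
    rewrite mxE ltnn eqxx mulr1.
    have [ir|ir] := ltnP i r.
      rewrite (bigD1 i)//= big1 ?addr0; last first.
        by move=> l /andP[lr li]; rewrite BA// eq_sym (negbTE li) mul0r.
      by rewrite BA// eqxx mul1r mxE ir addNr.
    rewrite big1 ?add0r ?H// => l lr; rewrite BA// (_ : i == l = false) ?mul0r//.
    by apply/negbTE; rewrite -val_eqE /= neq_ltn (leq_trans lr ir) orbT.
  have : v = 0 by rewrite -[v](mulKmx uE) Ev mulmx0.
  by move/matrixP/(_ c 0); rewrite !mxE ltnn eqxx => /eqP; rewrite oner_eq0.
have [Ec|Ec] := eqVneq (E c c) 0; last first.
  by apply: (finish 1%:M E) => //; [exact: unitmx1|rewrite mul1mx].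
have cp : c != p by apply: contraNneq Ep => <-; rewrite Ec.
(* Row [p] is added to row [c] rather than swapped with it, so that a transvection suffices to
   create the pivot. *)
apply: (finish (transv c p 1) (transv c p 1 *m E)) => //.
- exact: St.
- exact: transv_unit.
- by rewrite transv_mulE eqxx Ec add0r !mul1r.
move=> i j jr; rewrite transv_mulE !BA// (_ : p == j = false) ?mulr0 ?addr0//.
by apply/negbTE; rewrite -val_eqE /= neq_ltn (leq_trans jr pr) orbT.
Qed.

End GLGeneration.

(** * Invariant integration over the block parabolic quotient *)

Section BlockIntegral.
Context (R : realType) (F : topFieldType) (abs : F -> R).
Hypothesis V : valued_field abs.
Context (mu : {sigma_finite_measure set (borel F) -> \bar R}).
Hypothesis mu_haar : haar_measure mu.
Context (nu : F -> R).
Hypothesis nu0 : nu 0 = 0.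
Hypothesis nuE : haar_modulus mu nu.
Context (m n : nat).
Local Open Scope ereal_scope.
Implicit Types (g : 'M[F]_(m + n) -> \bar R) (l : seq ('I_n * 'I_m)).

Local Notation lo a := (rshift m (a : 'I_n)).
Local Notation up b := (lshift n (b : 'I_m)).

Let lo_up a b : lo a != up b. Proof. by rewrite eq_rlshift. Qed.
Let up_lo a b : up b != lo a. Proof. by rewrite eq_lrshift. Qed.
Hint Resolve lo_up up_lo : core.

Definition tint_at (ab : 'I_n * 'I_m) g := tint mu (lo ab.1) (up ab.2) g.

Definition tints l g := foldr tint_at g l.

Lemma nonneg_borel_tints l g : nonneg_borel g -> nonneg_borel (tints l g).
Proof. by move=> ng; elim: l => //= ab l IH; exact: (nonneg_borel_tint V). Qed.

Lemma tint_atC ab cd g : nonneg_borel g -> tint_at ab (tint_at cd g) = tint_at cd (tint_at ab g).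
Proof. by move=> ng; rewrite /tint_at (tintC V). Qed.

Lemma tint_at_tints ab l g : nonneg_borel g -> tint_at ab (tints l g) = tints l (tint_at ab g).
Proof.
move=> ng; elim: l => //= cd l <-; apply: tint_atC; exact: nonneg_borel_tints.
Qed.

(** Transvections of the lower left block commute, so by Tonelli any chosen pair can be made the
    outermost integral. *)
Lemma tints_rem ab l g : nonneg_borel g -> ab \in l ->
  tints l g = tint_at ab (tints (rem ab l) g).
Proof.
move=> ng; elim: l => //= cd l IH; rewrite in_cons eq_sym; have [->//|_/= abl] := eqVneq cd ab.
by rewrite (IH abl) (tint_atC cd ab (nonneg_borel_tints (rem ab l) ng)).
Qed.

Lemma tints_filter (P : pred ('I_n * 'I_m)) l g : nonneg_borel g ->
  tints l g = tints (seq.filter P l) (tints (seq.filter (predC P) l) g).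
Proof.
move=> ng; elim: l => //= cd l IH; case: ifP => Pcd /=; rewrite IH//.
by rewrite tint_at_tints//; exact: nonneg_borel_tints.
Qed.

Lemma linv_tints a b l g : nonneg_borel g -> (a, b) \in l -> linv (lo a) (up b) (tints l g).
Proof.
move=> ng abl; rewrite (tints_rem ng abl).
by apply: (tint_linv V mu_haar) => //; exact: nonneg_borel_tints.
Qed.

Lemma tints_diag (d : 'rV[F]_(m + n)) (c : R) l g x : (forall i, d 0%R i != 0%R) ->
  (0 <= c)%R -> nonneg_borel g ->
  (forall y, g (diag_mx d *m y) = c%:E * g y) ->
  tints l g (diag_mx d *m x) =
  ((\prod_(ab <- l) nu (d 0 (lo ab.1) / d 0 (up ab.2))) * c)%:E * tints l g x.
Proof.
move=> d0 c0 ng dg; elim: l x => [|ab l IH] x /=; first by rewrite big_nil mul1r dg.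
have nl := nonneg_borel_tints l ng.
rewrite /tint_at (tint_diag V mu_haar nu0 nuE)// big_cons -mulrA EFinM -muleA; congr (_ * _).
rewrite -(tintZ V mu)//; last first.
  by rewrite mulr_ge0// prodr_ge0// => *; exact: (nu_ge0 nu0 nuE).
by congr (tint _ _ _ _ _); apply/funext => y; rewrite IH.
Qed.

Lemma tintsD l g h x : nonneg_borel g -> nonneg_borel h ->
  tints l (fun y => g y + h y) x = tints l g x + tints l h x.
Proof.
move=> ng nh; elim: l x => //= ab l IH x.
rewrite /tint_at -(tintD V mu _ _ _ (nonneg_borel_tints l ng) (nonneg_borel_tints l nh)).
by congr (tint _ _ _ _ _); apply/funext => y; rewrite IH.
Qed.

Lemma tintsZ l g (c : R) x : (0 <= c)%R -> nonneg_borel g ->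
  tints l (fun y => c%:E * g y) x = c%:E * tints l g x.
Proof.
move=> c0 ng; elim: l x => //= ab l IH x.
rewrite /tint_at -(tintZ V mu _ _ _ c0 (nonneg_borel_tints l ng)).
by congr (tint _ _ _ _ _); apply/funext => y; rewrite IH.
Qed.

Lemma tints_le l g h x : nonneg_borel g -> nonneg_borel h ->
  (forall y, g y <= h y) -> tints l g x <= tints l h x.
Proof.
move=> ng nh gh; elim: l x => //= ab l IH x.
by apply: (tint_le V) => //; exact: nonneg_borel_tints.
Qed.

Lemma tints_mulr l g y x : tints l (fun z => g (z *m y)) x = tints l g (x *m y).
Proof.
elim: l x => //= ab l IH x; apply: eq_integral => t _.
by rewrite IH mulmxA.
Qed.

Definition block_pairs := enum {: 'I_n * 'I_m}.

Let in_pairs ab : ab \in block_pairs. Proof. by rewrite mem_enum. Qed.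
Let uniq_pairs : uniq block_pairs. Proof. exact: enum_uniq. Qed.

(* The law of a density on P\GL, imposed only on the transvections and diagonal
   matrices of P. *)
Record density g : Prop := {
  density_borel : nonneg_borel g;
  density_ul : forall a b, linv (up b) (lo a) g;
  density_ll : forall a a', a != a' -> linv (lo a) (lo a') g;
  density_uu : forall b b', b != b' -> linv (up b) (up b') g;
  density_diag : forall (d : 'rV[F]_(m + n)) x, (forall i, d 0%R i != 0%R) ->
    g (diag_mx d *m x) =
    (\prod_(ab <- block_pairs) nu (d 0 (up ab.2) / d 0 (lo ab.1)))%:E * g x
}.

Section LeftInvariance.
Context (g : 'M[F]_(m + n) -> \bar R).
Hypothesis dg : density g.
Let ng := density_borel dg.

Section Rank1.
Context (a0 : 'I_n) (b0 : 'I_m).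

(** The package of invariances that survives integration along pairs sharing exactly one index with
    [(a0, b0)]. Commutators with [transv (up b0) (lo a0)] fall into the second and third families,
    and commutators with those fall into the fourth. *)
Let invariant (h : 'M[F]_(m + n) -> \bar R) := [/\ linv (up b0) (lo a0) h,
  forall a, a != a0 -> linv (lo a) (lo a0) h,
  forall b, b != b0 -> linv (up b0) (up b) h &
  forall a b, a != a0 -> b != b0 -> linv (lo a) (up b) h].

Let invariant_row h a : a != a0 -> invariant h -> invariant (tint_at (a, b0) h).
Proof.
move=> aa0 [h1 h2 h3 h4]; split => [|a' aa'|b bb|a' b aa' bb].
- by apply: linv_tintr => //; [rewrite eq_rshift|exact: h2].
- by apply: linv_tintC => //; [rewrite eq_rshift eq_sym|exact: h2].
- by apply: linv_tintr => //; [rewrite eq_lshift eq_sym|exact: h3|exact: h4].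
- by apply: linv_tintC => //; exact: h4.
Qed.

Let invariant_col h b : b != b0 -> invariant h -> invariant (tint_at (a0, b) h).
Proof.
move=> bb0 [h1 h2 h3 h4]; split => [|a aa|b' bb|a b' aa bb].
- by apply: linv_tintl => //; exact: h3.
- by apply: linv_tintl => //; [rewrite eq_rshift eq_sym|exact: h2|exact: h4].
- by apply: linv_tintC => //; exact: h3.
- by apply: linv_tintC => //; exact: h4.
Qed.

(** Pairs sharing an index with [(a0, b0)]. They are integrated after the others, whose integration
    first supplies the fourth family of [invariant]. *)
Let P (ab : 'I_n * 'I_m) := (ab.1 == a0) || (ab.2 == b0).

Let invariant_base : invariant (tints (seq.filter (predC P) (rem (a0, b0) block_pairs)) g).
Proof.
set l := seq.filter _ _.
have lP ab : ab \in l -> ab.1 != a0 /\ ab.2 != b0.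
  by rewrite mem_filter /= negb_or => /andP[/andP[]].
have stable p q : linv p q g ->
    (forall a b, a != a0 -> b != b0 -> q != lo a /\ up b != p) -> linv p q (tints l g).
  move=> ig; elim: l lP => //= ab l IH lP H.
  have [h1 h2] := H _ _ (lP ab (mem_head _ _)).1 (lP ab (mem_head _ _)).2.
  apply: linv_tintC => //; apply: IH => // cd cdl; apply: lP.
  by rewrite in_cons cdl orbT.
split=> [|a aa0|b bb0|a b aa bb].
- apply: stable; first exact: (density_ul dg).
  by move=> a b aa bb; rewrite eq_rshift eq_lshift eq_sym.
- apply: stable; first exact: (density_ll dg).
  by move=> a' b aa bb; rewrite eq_rshift eq_sym.
- apply: stable; first by apply: (density_uu dg); rewrite eq_sym.
  by move=> a b' aa bb; rewrite eq_lshift.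
apply: linv_tints => //.
rewrite mem_filter /= negb_or aa bb /= mem_rem_uniq// !inE mem_enum andbT.
by apply: contraNneq aa => -[->].
Qed.

Let H := tints (rem (a0, b0) block_pairs) g.

Let invariant_H : invariant H.
Proof.
rewrite /H (tints_filter P)//.
have : all P (seq.filter P (rem (a0, b0) block_pairs)) by exact: filter_all.
have : (a0, b0) \notin seq.filter P (rem (a0, b0) block_pairs).
  by rewrite mem_filter mem_rem_uniq// !inE eqxx andbF.
elim: (seq.filter P _) => [_ _|[a b] l IH]; first exact: invariant_base.
rewrite in_cons negb_or /= => /andP[ab abl] /andP[Pab Pl].
have {}IH := IH abl Pl.
have [e|aa] := eqVneq a a0.
  rewrite e; apply: invariant_col => //.
  by apply: contraNneq ab => bb; rewrite e bb.
have [e|bb] := eqVneq b b0; first by rewrite e; exact: invariant_row.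
by move: Pab; rewrite /P/= (negbTE aa) (negbTE bb).
Qed.

(** What remains along [(a0, b0)] is an integral over a projective line: [invariant_H] supplies its
    unipotent invariance, and the diagonal weight is the factor [nu e ^- 2]. *)
Lemma linv_tints_upper : linv (up b0) (lo a0) (tints block_pairs g).
Proof.
rewrite (tints_rem ng (in_pairs (a0, b0))).
apply: (tint_rank1 V mu_haar nu0 nuE) => //.
- exact: nonneg_borel_tints.
- by have [] := invariant_H.
move=> e x e0; set d := (\row_i _)%R.
have d0 i : d 0%R i != 0%R.
  rewrite mxE; case: ifP => // _; case: ifP => _; first by rewrite invr_eq0.
  exact: oner_neq0.
rewrite (tints_diag _ _ d0 _ ng (fun y => density_diag dg y d0)); last first.
  by rewrite prodr_ge0// => *; exact: (nu_ge0 nu0 nuE).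
congr (_%:E * _).
(* The Jacobian of each pair already integrated cancels its factor in the character of [g]; only the
   factor of [(a0, b0)] survives. *)
rewrite (perm_big _ (perm_to_rem (in_pairs (a0, b0)))) big_cons /= mulrCA -big_split /=.
rewrite big1 ?mulr1; last first.
  move=> ab _; rewrite -(nuM V mu_haar nu0 nuE) -[RHS](nu1 V mu_haar nu0 nuE).
  by congr nu; field; rewrite !d0.
rewrite !mxE !eqxx (negbTE (up_lo _ _)) !(nuM V mu_haar nu0 nuE) !(nuV V mu_haar nu0 nuE).
by rewrite -invfM expr2.
Qed.

End Rank1.

(** Transvections inside a diagonal block are commutators of a lower and an upper one, and the
    character of a diagonal matrix is cancelled by the Jacobians of all pairs. *)
Theorem tints_left_invariant A x : A \in unitmx ->
  tints block_pairs g (A *m x) = tints block_pairs g x.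
Proof.
set G := tints block_pairs g => uA.
have lG a b : linv (lo a) (up b) G by exact: linv_tints.
have uG a b : linv (up b) (lo a) G by exact: linv_tints_upper.
have commutator p q r : p != q -> q != r -> p != r ->
    linv p q G -> linv q r G -> linv p r G.
  move=> pq qr pr h1 h2 c y.
  have -> : y = transv p q 1%R *m (transv p q (-1)%R *m y).
    by rewrite mulmxA transvD// subrr transv0 mul1mx.
  set z := transv p q (-1)%R *m y.
  have := h1 1%R (transv q r c *m z).
  by rewrite mulmxA transv_commr// mul1r -!mulmxA !h2 h1.
apply: (unitmx_gen _ _ _ uA (S := fun B => forall y, G (B *m y) = G y)) => [p q t pq y|d d0 y|B C GB GC y].
(* With an empty block no such commutator exists, but then nothing is integrated and the invariances
   of [g] itself apply. *)
- have empty : ('I_n -> False) \/ ('I_m -> False) -> G = g.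
    move=> e; rewrite /G (_ : block_pairs = [::])//.
    by case E : block_pairs => [//|[a b] l]; case: e => e; case: (e _).
  case: (split_ordP p) pq => b ->; case: (split_ordP q) => a -> ne.
  + have [a0 _|n0] := pickP 'I_n.
      by apply: (commutator _ (lo a0) _ _ _ ne (uG a0 b) (lG a0 a)).
    rewrite empty; last by left=> a0; have := n0 a0.
    by apply: (density_uu dg); move: ne; rewrite eq_lshift.
  + exact: uG.
  + exact: lG.
  + have [b0 _|m0] := pickP 'I_m.
      by apply: (commutator _ (up b0) _ _ _ ne (lG b b0) (uG a b0)).
    rewrite empty; last by right=> b0; have := m0 b0.
    by apply: (density_ll dg); move: ne; rewrite eq_rshift.
- rewrite /G (tints_diag _ _ d0 _ ng (fun y => density_diag dg y d0)); last first.
    by rewrite prodr_ge0// => *; exact: (nu_ge0 nu0 nuE).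
  rewrite -big_split /= big1 ?mul1e// => ab _.
  rewrite -(nuM V mu_haar nu0 nuE) -[RHS](nu1 V mu_haar nu0 nuE).
  by congr nu; field; rewrite !d0.
- by rewrite -mulmxA GB GC.
Qed.

End LeftInvariance.
End BlockIntegral.

(** * Densities and the big cell *)

Section MaximalMinor.
Context (F : fieldType) (m n : nat).
Implicit Types (x : 'M[F]_(m + n)) (w : 'S_(m + n)).

Lemma perm_extension (f : 'I_n -> 'I_(m + n)) : injective f ->
  exists w : 'S_(m + n), forall a, w (rshift m a) = f a.
Proof.
move=> fi; pose C : {pred 'I_(m + n)} := [predC codom f].
have cC : #|C| = m.
  have := cardC (mem (codom f)); rewrite card_codom// !card_ord addnC.
  by move/addIn.
pose g (j : 'I_(m + n)) := match fintype.split j with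
  | inl b => enum_val (cast_ord (esym cC) b) | inr a => f a end.
have gC b : enum_val (cast_ord (esym cC) b) \in C := enum_valP _.
have gi : injective g.
  move=> j j'; rewrite /g; case: (split_ordP j) => b ->; case: (split_ordP j') => b' -> e.
  - by move/enum_val_inj/cast_ord_inj : e => ->.
  - by have := gC b; rewrite e inE codom_f.
  - by have := gC b'; rewrite -e inE codom_f.
  - by rewrite (fi _ _ e).
exists (perm gi) => a; rewrite permE /g.
by case: (split_ordP (rshift m a)) => b /eqP; rewrite ?eq_rlshift// eq_rshift => /eqP ->.
Qed.

Lemma mulmx_perm_mxE x w i j : (x *m perm_mx w) i j = x i ((w^-1)%g j).
Proof. by rewrite -[w]invgK -col_permE mxE invgK. Qed.

(** The last [n] rows of an invertible matrix are independent, so [n] of their columns form a basis;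
    the permutation moves these columns to the end. *)
Lemma exists_unit_minor x : x \in unitmx -> exists w, drsubmx (x *m perm_mx w) \in unitmx.
Proof.
move=> ux; have dfree : row_free (dsubmx x).
  apply/row_freeP; exists (rsubmx (invmx x)).
  have := mulmxV ux => /matrixP h; apply/matrixP => i j.
  have := h (rshift m i) (rshift m j); rewrite !mxE eq_rshift => <-.
  by apply: eq_bigr => l _; rewrite !mxE.
have dfull : row_full (dsubmx x)^T by rewrite /row_full mxrank_tr.
have [w wf] := perm_extension (@fullrankfun_inj _ _ _ _ dfull).
exists (w^-1)%g; rewrite -unitmx_tr.
rewrite (_ : _^T = rowsub (fullrankfun dfull) (dsubmx x)^T); first exact: fullrowsub_unit.
by apply/matrixP => i j; rewrite mxE [LHS]mxE [LHS]mxE mulmx_perm_mxE invgK wf !mxE.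
Qed.

(** Cramer's rule in a form suited to comparing minors: one column of [A] is exchanged for a column
    of [B]. *)
Lemma adj_mul_det (A : 'M[F]_n) p (B : 'M[F]_(n, p)) a b :
  (\adj A *m B) a b = \det (\matrix_(i, j) (if j == a then B i b else A i j)).
Proof.
rewrite (expand_det_col _ a) !mxE; apply: eq_bigr => i _; rewrite !mxE eqxx mulrC; congr (_ * _).
rewrite /cofactor; congr (_ * \det _); apply/matrixP => i' j'; rewrite !mxE.
by rewrite (negbTE (neq_lift _ _)) || rewrite eq_sym (negbTE (neq_lift _ _)).
Qed.

Definition lower_block (X : 'M[F]_(n, m)) : 'M[F]_(m + n) := block_mx 1%:M 0 X 1%:M.

Lemma lower_blockM X Y : lower_block X *m lower_block Y = lower_block (X + Y).
Proof.
by rewrite /lower_block mulmx_block !mul1mx !mulmx1 !mul0mx !mulmx0 !addr0 add0r.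
Qed.

Lemma lower_block0 : lower_block 0 = 1%:M.
Proof. by rewrite /lower_block -scalar_mx_block. Qed.

Lemma lower_block_unit X : lower_block X \in unitmx.
Proof.
have : lower_block X *m lower_block (- X) = 1%:M by rewrite lower_blockM subrr lower_block0.
by move/mulmx1_unit => [].
Qed.

Lemma det_lower_block X : \det (lower_block X) = 1.
Proof. by rewrite /lower_block det_lblock !det1 mulr1. Qed.

End MaximalMinor.

Lemma det_transv (F : topFieldType) N (p q : 'I_N) (t : F) : p != q -> \det (transv p q t) = 1.
Proof.
wlog qp : p q / (q < p)%N => [H pq|_].
  have [qp|pq'|/val_inj e] := ltngtP q p; [exact: H| |by rewrite e eqxx in pq].
  rewrite -det_tr (_ : _^T = transv q p t); first by apply: H; rewrite // eq_sym.
  by rewrite /transv linearD linearZ /= trmx1 trmx_delta.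
rewrite det_trig; last first.
  apply/is_trig_mxP => i j ij; rewrite !mxE (_ : i == j = false); last by apply/negbTE; rewrite -val_eqE ltn_eqF.
  rewrite (_ : (i == p) && (j == q) = false) ?mulr0 ?addr0//.
  by apply/negbTE/negP => /andP[/eqP ip /eqP jq]; move: ij; rewrite ip jq ltnNge ltnW.
rewrite big1// => i _; rewrite !mxE eqxx (_ : (i == p) && (i == q) = false) ?mulr0 ?addr0//.
by apply/negbTE/negP => /andP[/eqP -> /eqP e]; rewrite e ltnn in qp.
Qed.

(* Cramer: after moving a minor of maximal absolute value into the lower right
   corner, the lower rows become small multiples of that minor. *)
Lemma maximal_minor (R : realType) (F : topFieldType) (abs : F -> R)
    (V : valued_field abs) m n (x : 'M[F]_(m + n)) : x \in unitmx ->
  exists w : 'S_(m + n), drsubmx (x *m perm_mx w) \in unitmx /\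
    forall a b, abs ((invmx (drsubmx (x *m perm_mx w)) *m dlsubmx (x *m perm_mx w)) a b) <= 1.
Proof.
move=> ux; have [w0 uw0] := exists_unit_minor ux.
pose M w := abs (\det (drsubmx (x *m perm_mx w))).
have [w _ wmax] := @arg_maxP _ _ _ w0 xpredT M isT.
have Mw : 0 < M w.
  apply: lt_le_trans (wmax w0 isT); rewrite /M (vf_gt0 V).
  by rewrite -unitfE -unitmxE.
have uw : drsubmx (x *m perm_mx w) \in unitmx.
  by rewrite unitmxE unitfE -(vf_gt0 V).
exists w; split => // a b.
rewrite /invmx uw -scalemxAl mxE (vfM V) (vfV V) mulrC ler_pdivrMr// mul1r.
(* Exchanging a column amounts to composing [w] with a transposition, so the maximality of [w]
   bounds the numerator. *)
rewrite adj_mul_det (le_trans _ (wmax (w * tperm (lshift n b) (rshift m a))%g isT))//.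
rewrite /M le_eqVlt; apply/orP; left; apply/eqP; congr (abs (\det _)).
apply/matrixP => i j; rewrite !mxE.
transitivity (x (rshift m i) ((w^-1)%g (if j == a then lshift n b else rshift m j))).
  by case: ifP => _; rewrite -mulmx_perm_mxE mxE.
have := mulmx_perm_mxE x (w * tperm (lshift n b) (rshift m a))%g (rshift m i) (rshift m j).
rewrite mxE => ->; rewrite invMg permM tpermV; congr (x _ ((w^-1)%g _)).
have [->|ja] := eqVneq j a; first by rewrite tpermR.
by rewrite tpermD// ?eq_lrshift// eq_rshift eq_sym.
Qed.

Lemma continuous_fun_comp (X Y Z : topologicalType) (f : X -> Y) (g : Y -> Z) :
  continuous f -> continuous g -> continuous (fun x => g (f x)).
Proof. by move=> cf cg x; exact: (continuous_comp (cf x) (cg _)). Qed.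

Lemma adj_continuous (R : realType) (F : topFieldType) (abs : F -> R)
    (V : valued_field abs) n : continuous (fun x : 'M[F]_n => \adj x).
Proof.
move=> x; apply: mx_continuous => i j.
rewrite (_ : (fun _ => _) = (fun y : 'M[F]_n => (-1) ^+ (j + i) * \det (row' j (col' i y)))); last first.
  by apply/funext => y; rewrite mxE.
apply: (vf_continuousM V); first exact: cst_continuous.
apply: (continuous_fun_comp (f := fun y : 'M[F]_n => row' j (col' i y))); last exact: (det_continuous V).
move=> y; apply: mx_continuous => a b.
rewrite (_ : (fun _ => _) = (fun y : 'M[F]_n => y (lift j a) (lift i b))); first exact: mx_entry_continuous.
by apply/funext => z; rewrite !mxE.
Qed.

Section Density.
Context (R : realType) (F : topFieldType) (abs : F -> R).
Hypothesis V : valued_field abs.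
Context (mu : {sigma_finite_measure set (borel F) -> \bar R}).
Hypothesis mu_haar : haar_measure mu.
Context (nu : F -> R).
Hypothesis nu0 : nu 0 = 0.
Hypothesis nuE : haar_modulus mu nu.
Context (m n : nat).
Implicit Types (u : 'M[F]_(m + n) -> R) (x p : 'M[F]_(m + n)).

Let nuM := nuM V mu_haar nu0 nuE.
Let nuV := nuV V mu_haar nu0 nuE.
Let nu1 := nu1 V mu_haar nu0 nuE.
Let nu_ge0 := nu_ge0 nu0 nuE.
Let nu_prod := nu_prod V mu_haar nu0 nuE.

(* u is a section of the density bundle of the homogeneous space P\GL. *)
Record block_density u : Prop := {
  bd_measurable : measurable_fun setT (u : mxborel F (m + n) (m + n) -> R);
  bd_out : forall x, x \notin unitmx -> u x = 0;
  bdE : forall p x, p \in unitmx -> dlsubmx p = 0 -> x \in unitmx ->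
    u (p *m x) = nu (\det (ulsubmx p)) ^+ n * nu (\det (drsubmx p)) ^- m * u x
}.

Lemma block_density_density u : block_density u -> (forall x, 0 <= u x) ->
  density nu (fun x => (u x)%:E).
Proof.
move=> bu u0.
have E p x : p \in unitmx -> dlsubmx p = 0 ->
    u (p *m x) = nu (\det (ulsubmx p)) ^+ n * nu (\det (drsubmx p)) ^- m * u x.
  move=> up dp; have [ux|nx] := boolP (x \in unitmx); first exact: bdE.
  by rewrite (bd_out bu nx) mulr0 (bd_out bu)// unitmx_mul up.
have ET p x : p \in unitmx -> dlsubmx p = 0 -> \det (ulsubmx p) = 1 ->
    \det (drsubmx p) = 1 -> (u (p *m x))%:E = (u x)%:E.
  by move=> up dp h1 h2; rewrite E// h1 h2 nu1 !expr1n invr1 !mul1r.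
split.
- split=> [|x]; last by rewrite lee_fin.
  by apply/measurable_EFinP; exact: bd_measurable.
- move=> a b c x; apply: ET; rewrite ?transv_unit ?eq_lrshift//.
  + by apply/matrixP => i j; rewrite !mxE eq_rlshift (negbTE (_ : rshift m i != lshift n b)) ?eq_rlshift//= mulr0 addr0.
  + rewrite (_ : ulsubmx _ = 1%:M) ?det1//.
    by apply/matrixP => i j; rewrite !mxE eq_lshift (_ : lshift n j == rshift m a = false) ?eq_lrshift// andbF mulr0 addr0.
  + rewrite (_ : drsubmx _ = 1%:M) ?det1//.
    by apply/matrixP => i j; rewrite !mxE eq_rshift (_ : rshift m i == lshift n b = false) ?eq_rlshift//= mulr0 addr0.
- move=> a a' aa c x; apply: ET; rewrite ?transv_unit ?eq_rshift//.
  + by apply/matrixP => i j; rewrite !mxE eq_rlshift eq_lrshift andbF mulr0 addr0.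
  + rewrite (_ : ulsubmx _ = 1%:M) ?det1//.
    by apply/matrixP => i j; rewrite !mxE eq_lshift eq_lrshift /= mulr0 addr0.
  + rewrite (_ : drsubmx _ = transv a a' c); last first.
      by apply/matrixP => i j; rewrite !mxE !eq_rshift.
    exact: det_transv.
- move=> b b' bb c x; apply: ET; rewrite ?transv_unit ?eq_lshift//.
  + by apply/matrixP => i j; rewrite !mxE !eq_rlshift /= mulr0 addr0.
  + rewrite (_ : ulsubmx _ = transv b b' c); last first.
      by apply/matrixP => i j; rewrite !mxE !eq_lshift.
    exact: det_transv.
  + rewrite (_ : drsubmx _ = 1%:M) ?det1//.
    by apply/matrixP => i j; rewrite !mxE eq_rshift eq_rlshift /= mulr0 addr0.
- move=> d x d0; rewrite -EFinM E; last 2 first.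
  + by rewrite unitmxE det_diag unitfE; apply/prodf_neq0 => i _.
  + by apply/matrixP => i j; rewrite !mxE eq_rlshift.
  have -> : ulsubmx (diag_mx d) = diag_mx (lsubmx d).
    by apply/matrixP => i j; rewrite !mxE eq_lshift.
  have -> : drsubmx (diag_mx d) = diag_mx (rsubmx d).
    by apply/matrixP => i j; rewrite !mxE eq_rshift.
  rewrite !det_diag !nu_prod; congr (_ * _)%:E.
  rewrite -[block_pairs _ _]/(enum _) big_enum /=.
  rewrite -(pair_bigA _ (fun a b => nu (d 0 (lshift n b) / d 0 (rshift m a)))) /=.
  under [RHS]eq_bigr => a _.
    under eq_bigr => b _ do rewrite nuM nuV.
    rewrite big_split /= prodr_const card_ord.
  over.
  rewrite big_split /= prodr_const card_ord.
  congr (_ ^+ _ * _); first by apply: eq_bigr => b _; rewrite mxE.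
  rewrite -prodrXl -prodfV; apply: eq_bigr => a _; by rewrite !mxE exprVn.
Qed.

(** In the coordinates [x = p *m lower_block X] this is the character of [p] times the indicator of
    [X] having entries of absolute value at most 1. The exponents arise because [\det x] is the
    product of the determinants of the two diagonal blocks of [p], the lower of which is
    [drsubmx x]. *)
Definition unit_density x : R :=
  if [&& x \in unitmx, drsubmx x \in unitmx &
      [forall a, forall b, abs ((invmx (drsubmx x) *m dlsubmx x) a b) <= 1]]
  then nu (\det x) ^+ n / nu (\det (drsubmx x)) ^+ (m + n) else 0.

Lemma unit_density_ge0 x : 0 <= unit_density x.
Proof. by rewrite /unit_density; case: ifP => // _; rewrite divr_ge0// exprn_ge0. Qed.

Let drsubmx_mul p x : dlsubmx p = 0 -> drsubmx (p *m x) = drsubmx p *m drsubmx x.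
Proof.
move=> dp; rewrite -{1}[p]submxK -{1}[x]submxK mulmx_block dp block_mxKdr.
by rewrite mul0mx add0r.
Qed.

Let dlsubmx_mul p x : dlsubmx p = 0 -> dlsubmx (p *m x) = drsubmx p *m dlsubmx x.
Proof.
move=> dp; rewrite -{1}[p]submxK -{1}[x]submxK mulmx_block dp block_mxKdl.
by rewrite mul0mx add0r.
Qed.

Let det_parabolic p : dlsubmx p = 0 -> \det p = \det (ulsubmx p) * \det (drsubmx p).
Proof. by move=> dp; rewrite -{1}[p]submxK dp det_ublock. Qed.

Lemma measurable_cont_mx (f : 'M[F]_(m + n) -> F) : continuous f ->
  measurable_fun setT (f : mxborel F (m + n) (m + n) -> borel F).
Proof.
move=> cf; apply: (@measurable_continuous_borel F _ (mxborel F (m + n) (m + n)) 'M[F]_(m + n) id f) => //.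
exact: open_mxborel.
Qed.

Lemma submx_continuous m1 n1 (i : 'I_m1 -> 'I_(m + n)) (j : 'I_n1 -> 'I_(m + n)) :
  continuous (fun x : 'M[F]_(m + n) => \matrix_(a, b) x (i a) (j b)).
Proof.
move=> x; apply: mx_continuous => a b.
rewrite (_ : (fun _ => _) = (fun y : 'M[F]_(m + n) => y (i a) (j b))); first exact: mx_entry_continuous.
by apply/funext => y; rewrite mxE.
Qed.

Lemma drsubmx_continuous : continuous (fun x : 'M[F]_(m + n) => drsubmx x).
Proof.
rewrite (_ : (fun _ => _) = (fun x => \matrix_(a, b) x (rshift m a) (rshift m b))); first exact: submx_continuous.
by apply/funext => x; apply/matrixP => i j; rewrite !mxE.
Qed.

Lemma dlsubmx_continuous : continuous (fun x : 'M[F]_(m + n) => dlsubmx x).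
Proof.
rewrite (_ : (fun _ => _) = (fun x => \matrix_(a, b) x (rshift m a) (lshift n b))); first exact: submx_continuous.
by apply/funext => x; apply/matrixP => i j; rewrite !mxE.
Qed.

Let det_dr_continuous : continuous (fun x : 'M[F]_(m + n) => \det (drsubmx x)).
Proof. exact: (continuous_fun_comp drsubmx_continuous (@det_continuous _ _ _ V _)). Qed.

Lemma measurable_le_abs (f g : 'M[F]_(m + n) -> F) : continuous f -> continuous g ->
  measurable ([set x | abs (f x) <= abs (g x)] : set (mxborel F (m + n) (m + n))).
Proof.
move=> cf cg; rewrite (_ : mkset _ = ~` [set x | 0 < abs (f x) - abs (g x)]); last first.
  by apply/seteqP; split=> x /=; rewrite subr_gt0 leNgt => /negP.
apply: measurableC; apply: open_mxborel.
have ca (h : 'M[F]_(m + n) -> F) : continuous h -> continuous (fun x => abs (h x) : R^o).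
  by move=> ch; exact: (continuous_fun_comp ch (@abs_continuous _ _ _ V)).
rewrite (_ : mkset _ = (fun x => abs (f x) - abs (g x) : R^o) @^-1` [set r : R^o | 0 < r]); last by [].
apply: open_comp; last exact: open_gt.
by move=> x _; apply: continuousB; [exact: ca|exact: ca].
Qed.

Lemma unit_density_bd : block_density unit_density.
Proof.
split.
(* Multiplying by the determinant replaces the inverse by the adjugate, so the condition compares
   absolute values of continuous functions. *)
- rewrite (_ : unit_density = (fun x => nu (\det x) ^+ n * (nu (\det (drsubmx x))^-1) ^+ (m + n)) \*
    \1_([set x | x \in unitmx] `&` [set x | drsubmx x \in unitmx] `&`
     \bigcap_(ab in [set: 'I_n * 'I_m]) [set x | abs ((\adj (drsubmx x) *m dlsubmx x) ab.1 ab.2) <= abs (\det (drsubmx x))])); last first.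
    apply/funext => x /=; rewrite indicE /unit_density.
    have [ux|nux] /= := boolP (x \in unitmx); last first.
      by rewrite memNset ?mulr0// => -[[]] /=; rewrite (negbTE nux).
    have [udx|nudx] /= := boolP (drsubmx x \in unitmx); last first.
      by rewrite memNset ?mulr0// => -[[]] /=; rewrite (negbTE nudx).
    have E a b : (abs ((invmx (drsubmx x) *m dlsubmx x) a b) <= 1) =
        (abs ((\adj (drsubmx x) *m dlsubmx x) a b) <= abs (\det (drsubmx x))).
      rewrite /invmx udx -scalemxAl mxE (vfM V) (vfV V) mulrC ler_pdivrMr ?mul1r//.
      by rewrite (vf_gt0 V) -unitfE -unitmxE.
    case: ifP => H.
      rewrite mem_set ?mulr1 ?nuV ?exprVn//; split=> // -[a b] _ /=.
      by move/forallP: H => /(_ a) /forallP/(_ b); rewrite E.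
    rewrite memNset ?mulr0// => -[_ h]; move/negbT: H => /negP; apply.
    by apply/forallP => a; apply/forallP => b; rewrite E; exact: (h (a, b)).
  apply: measurable_funM.
    apply: measurable_funM; apply: measurable_funX.
      apply: (measurableT_comp (measurable_nu V mu_haar nu0 nuE)).
      by apply: measurable_cont_mx; exact: (det_continuous V).
    apply: (measurableT_comp (measurable_nu V mu_haar nu0 nuE)).
    apply: (measurableT_comp (measurable_inv V)).
    exact: measurable_cont_mx.
  apply: measurable_indic; apply: measurableI.
    apply: measurableI; first by apply: open_mxborel; exact: (@GL_open _ _ _ V).
    apply: open_mxborel.
    rewrite (_ : mkset _ = (fun x => \det (drsubmx x)) @^-1` [set x : F | x != 0]).
      by apply: open_comp (vf_open_neq0 V) => x _; exact: det_dr_continuous.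
    by apply/seteqP; split => x; rewrite /= unitmxE unitfE.
  apply: fin_bigcap_measurable => [|ab _]; first exact: finite_finset.
  apply: measurable_le_abs => //.
  apply: (continuous_fun_comp (f := fun x => \adj (drsubmx x) *m dlsubmx x) (g := fun y => y ab.1 ab.2)); last exact: mx_entry_continuous.
  move=> x; apply: (mulmx_continuous V); last exact: dlsubmx_continuous.
  exact: (continuous_fun_comp drsubmx_continuous (@adj_continuous _ _ _ V _)).
- by move=> x nx; rewrite /unit_density (negbTE nx).
- move=> p x up dp ux; rewrite /unit_density unitmx_mul up ux /= drsubmx_mul// dlsubmx_mul//.
  have udp : drsubmx p \in unitmx.
    by move: up; rewrite !unitmxE det_parabolic// unitrM => /andP[].
  rewrite unitmx_mul udp /=; case: (boolP (drsubmx x \in unitmx)) => [udx|_] /=; last by rewrite mulr0.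
  rewrite (_ : invmx _ *m _ = invmx (drsubmx x) *m dlsubmx x); last first.
    have uAB : drsubmx p *m drsubmx x \in unitmx by rewrite unitmx_mul udp.
    by apply: (can_inj (mulKmx uAB)); rewrite mulKVmx// -mulmxA mulKVmx.
  case: ifP => _; last by rewrite mulr0.
  rewrite !det_mulmx !nuM (det_parabolic dp) nuM.
  have n1 : nu (\det (drsubmx p)) != 0 by rewrite (nu_eq0 nu0 nuE) -unitfE -unitmxE.
  have n2 : nu (\det (drsubmx x)) != 0 by rewrite (nu_eq0 nu0 nuE) -unitfE -unitmxE.
  rewrite !exprMn exprD; field.
  by rewrite !expf_neq0.
Qed.

End Density.

Lemma mx_box_compact (F : topFieldType) (m n : nat) (D : set F) : compact D ->
  compact [set X : 'M[F]_(m, n) | forall i j, D (X i j)].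
Proof.
move=> cD; have cT := @tychonoff ('I_m * 'I_n)%type (fun=> F) (fun=> D) (fun=> cD).
pose g (f : prod_topology (fun _ : 'I_m * 'I_n => F : topologicalType)) : 'M[F]_(m, n) :=
  \matrix_(i, j) f (i, j).
rewrite (_ : mkset _ = g @` [set f | forall ij, D (f ij)]).
  apply: continuous_compact cT; apply: continuous_subspaceT => f.
  apply: mx_continuous => i j.
  rewrite (_ : (fun _ => _) = proj (i, j)); first exact: proj_continuous.
  by apply/funext => h; rewrite mxE.
apply/seteqP; split=> [X DX|_ [f Df <-] i j]; last by rewrite mxE.
exists (fun ij => X ij.1 ij.2); first by move=> ij; exact: DX.
by apply/matrixP => i j; rewrite mxE.
Qed.

(** * Finiteness, linearity and invariance of the integral of a density *)

Section DensityIntegral.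
Context (R : realType) (F : topFieldType) (abs : F -> R).
Hypothesis V : valued_field abs.
Context (mu : {sigma_finite_measure set (borel F) -> \bar R}).
Hypothesis mu_haar : haar_measure mu.
Context (nu : F -> R).
Hypothesis nu0 : nu 0 = 0.
Hypothesis nuE : haar_modulus mu nu.
Context (m n : nat).
Implicit Types (u v : 'M[F]_(m + n) -> R) (x p : 'M[F]_(m + n)).

Let nuM := nuM V mu_haar nu0 nuE.
Let nu1 := nu1 V mu_haar nu0 nuE.
Let nu_ge0 := nu_ge0 nu0 nuE.
Let pairs := @block_pairs m n.
Let D : set F := [set t | abs t <= 1].
Let b := fine (mu D).

Let mD : measurable (D : set (borel F)).
Proof. by exact: (@measurable_vf_ball _ _ _ V). Qed.

Let bE : mu D = b%:E.
Proof. by rewrite fineK// ge0_fin_numE//; exact: (mu_ball_fin V mu_haar). Qed.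

Let b_ge0 : 0 <= b. Proof. by apply: fine_ge0. Qed.

Let lower_block_transv (ab : 'I_n * 'I_m) t (X : 'M[F]_(n, m)) :
  transv (rshift m ab.1) (lshift n ab.2) t *m lower_block X =
  lower_block (X + t *: delta_mx ab.1 ab.2).
Proof.
rewrite (_ : transv _ _ _ = lower_block (t *: delta_mx ab.1 ab.2)); last first.
  by rewrite -[LHS]submxK /lower_block; congr block_mx; apply/matrixP => i j; rewrite !mxE
    !(eq_rlshift, eq_lrshift, eq_rshift, eq_lshift) ?andbF /= ?mulr0 ?addr0 ?add0r.
by rewrite lower_blockM addrC.
Qed.

Let small (l : seq ('I_n * 'I_m)) (X : 'M[F]_(n, m)) :=
  [forall ab, (ab \in l) || (abs (X ab.1 ab.2) <= 1)].

Let unit_density_lower (X : 'M[F]_(n, m)) :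
  unit_density abs nu (lower_block X) = (small [::] X)%:R.
Proof.
rewrite /unit_density lower_block_unit det_lower_block /lower_block block_mxKdr block_mxKdl.
rewrite unitmx1 /= (_ : invmx _ = 1%:M) ?mul1mx ?det1; last first.
  by apply: (can_inj (mulKmx (unitmx1 F n))); rewrite mulmxV ?unitmx1// mul1mx.
rewrite !nu1 !expr1n divr1.
have -> : small [::] X = [forall i, forall j, abs (X i j) <= 1].
  apply/forallP/forallP => [h i|h [i j] /=]; last by have /forallP := h i; apply.
  by apply/forallP => j; have := h (i, j).
by case: ifP.
Qed.

(** Each pair of [l] that is integrated out contributes the mass [b] of the unit ball, while the
    other entries of [X] stay constrained; the induction therefore runs over all [X]. *)
Lemma tints_unit_density (l : seq ('I_n * 'I_m)) (X : 'M[F]_(n, m)) : uniq l ->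
  tints mu l (fun x => (unit_density abs nu x)%:E) (lower_block X) =
  (b ^+ size l * (small l X)%:R)%:E.
Proof.
elim: l X => [|ab l IH] X /=; first by rewrite mul1r unit_density_lower.
move=> /andP[abl ul]; rewrite /tint_at /tint.
under eq_integral do rewrite lower_block_transv IH//.
pose k := b ^+ size l * (small (ab :: l) X)%:R.
have k0 : 0 <= k by rewrite mulr_ge0// exprn_ge0.
transitivity (\int[mu]_t (k%:E * (\1_D (X ab.1 ab.2 + t)%R)%:E))%E.
  apply: eq_integral => t _; rewrite -EFinM /k -mulrA; congr (_ * _)%:E.
  rewrite indicE -natrM mulnb; congr (nat_of_bool _)%:R.
  apply/forallP/andP => [h|[/forallP h1 h2] cd].
    split; last first.
      have := h ab; rewrite (negbTE abl) /= !mxE !eqxx mulr1 => h'.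
      by rewrite mem_set.
    apply/forallP => cd; rewrite in_cons; have [->//|ne] /= := eqVneq cd ab.
    have := h cd; rewrite !mxE; case: (eqVneq cd.1 ab.1) => e1; case: (eqVneq cd.2 ab.2) => e2 /=; rewrite ?mulr0 ?addr0//.
    by move: ne; rewrite [cd]surjective_pairing [ab]surjective_pairing e1 e2 eqxx.
  have [->|ne] := eqVneq cd ab.
    rewrite (negbTE abl) /= !mxE !eqxx mulr1.
    by move: h2; rewrite inE.
  have := h1 cd; rewrite in_cons (negbTE ne) /= !mxE.
  case: (eqVneq cd.1 ab.1) => e1; case: (eqVneq cd.2 ab.2) => e2 /=; rewrite ?mulr0 ?addr0//.
  by move: ne; rewrite [cd]surjective_pairing [ab]surjective_pairing e1 e2 eqxx.
have mi : measurable_fun setT (fun t : borel F => (\1_D t)%:E : \bar R).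
  by apply/measurable_EFinP; exact: measurable_indic.
have i0 t : (0 <= (\1_D t)%:E :> \bar R)%E by rewrite lee_fin indicE.
rewrite ge0_integralZl//; last exact: (measurableT_comp mi (measurable_addl V _)).
have Ib : (\int[mu]_t (\1_D t)%:E = b%:E)%E by rewrite integral_indic// setIT -bE.
rewrite (integral_addl V mu_haar _ mi i0) Ib -EFinM /k exprS.
by congr EFin; ring.
Qed.

(** By [maximal_minor] every coset of the parabolic subgroup in GL meets this set: it is a compact
    stand-in for the quotient. *)
Definition big_cell_compact : set 'M[F]_(m + n) :=
  [set lower_block X *m perm_mx w | X in [set X : 'M[F]_(n, m) | forall i j, abs (X i j) <= 1] & w in [set: 'S_(m + n)]].

Let dens u := (fun x => (u x)%:E).
Let L u := tints mu pairs (dens u) 1%:M.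
Let C0 : R := #|'S_(m + n)|%:R * b ^+ size pairs.
Let C0_ge0 : 0 <= C0. Proof. by rewrite mulr_ge0// exprn_ge0. Qed.

Let bd_density := block_density_density V mu_haar nu0 nuE.

Lemma lower_block_decomposition x : x \in unitmx -> drsubmx x \in unitmx ->
  exists p, [/\ p \in unitmx, dlsubmx p = 0,
    x = p *m lower_block (invmx (drsubmx x) *m dlsubmx x) &
    nu (\det x) ^+ n / nu (\det (drsubmx x)) ^+ (m + n) =
    nu (\det (ulsubmx p)) ^+ n * nu (\det (drsubmx p)) ^- m].
Proof.
move=> ux udx; set X := invmx _ *m _; pose p := x *m lower_block (- X).
have xp : x = p *m lower_block X.
  by rewrite -mulmxA lower_blockM addNr lower_block0 mulmx1.
have pE : p = block_mx (ulsubmx x - ursubmx x *m X) (ursubmx x) 0 (drsubmx x).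
  rewrite /p -{1}[x]submxK /lower_block mulmx_block !mulmx1 !mulmx0 !add0r !mulmxN.
  by rewrite mulKVmx// subrr.
have drp : drsubmx p = drsubmx x by rewrite pE block_mxKdr.
exists p; split=> //; first by rewrite unitmx_mul ux lower_block_unit.
  by rewrite pE block_mxKdl.
have -> : \det x = \det (ulsubmx p) * \det (drsubmx x).
  rewrite {1}xp det_mulmx det_lower_block mulr1 -drp -{1}[p]submxK (_ : dlsubmx p = 0) ?det_ublock//.
  by rewrite pE block_mxKdl.
have n1 : nu (\det (drsubmx x)) != 0 by rewrite (nu_eq0 nu0 nuE) -unitfE -unitmxE.
by rewrite drp nuM exprMn exprD; field; rewrite !expf_neq0.
Qed.

(** Right translation by the permutation from [maximal_minor] brings [x] into the support of
    [unit_density], whose value there is the character of [p], while [u x] is at most [c] times that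
    character. The other summands are non-negative. *)
Lemma block_density_le u c x : block_density nu u -> (forall y, 0 <= u y) ->
  (forall y, big_cell_compact y -> u y <= c) ->
  u x <= c * \sum_(w : 'S_(m + n)) unit_density abs nu (x *m perm_mx w).
Proof.
move=> bu u0 uc.
have c0 : 0 <= c.
  apply: le_trans (u0 (lower_block 0 *m perm_mx 1%g)) (uc _ _).
  by exists 0; [move=> i j; rewrite mxE (vf0 V)|exists 1%g].
have S0 : 0 <= \sum_(w : 'S_(m + n)) unit_density abs nu (x *m perm_mx w).
  by apply: sumr_ge0 => w _; exact: (unit_density_ge0 abs nu0 nuE).
have [ux|nx] := boolP (x \in unitmx); last by rewrite (bd_out bu nx) mulr_ge0.
have [w [uw Xw]] := maximal_minor V ux.
apply: (@le_trans _ _ (c * unit_density abs nu (x *m perm_mx w))); last first.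
  rewrite ler_wpM2l// (bigD1 w)//= lerDl; apply: sumr_ge0 => w' _.
  exact: (unit_density_ge0 abs nu0 nuE).
have uz : x *m perm_mx w \in unitmx by rewrite unitmx_mul ux unitmx_perm.
have [p [up dp xp E]] := lower_block_decomposition uz uw.
have -> : x = p *m (lower_block (invmx (drsubmx (x *m perm_mx w)) *m dlsubmx (x *m perm_mx w)) *m perm_mx (w^-1)%g).
  by rewrite mulmxA -xp -mulmxA -perm_mxM mulgV perm_mx1 mulmx1.
rewrite (bdE bu)// ?unitmx_mul ?lower_block_unit ?unitmx_perm//.
rewrite mulmxA -xp -[X in unit_density _ _ (X *m _)]mulmx1.
have -> : (x *m perm_mx w *m perm_mx (w^-1)%g *m 1%:M *m perm_mx w) = x *m perm_mx w.
  by rewrite mulmx1 -(mulmxA _ (perm_mx (w^-1)%g)) -perm_mxM mulVg perm_mx1 mulmx1.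
rewrite /unit_density uz uw /= (_ : [forall a, _]); last first.
  by apply/forallP => i; apply/forallP => j; exact: Xw.
rewrite E mulrC ler_wpM2r//; first by rewrite mulr_ge0 ?invr_ge0 ?exprn_ge0.
by apply: uc; exists (invmx (drsubmx (x *m perm_mx w)) *m dlsubmx (x *m perm_mx w)) => //; exists (w^-1)%g.
Qed.

Let nb u : block_density nu u -> (forall x, 0 <= u x) -> nonneg_borel (dens u).
Proof. by move=> bu u0; exact: (density_borel (bd_density bu u0)). Qed.

(** Integrate the preceding bound: by left invariance all translates of [unit_density] have the same
    integral [b ^+ size pairs], and [C0] is the number of permutations times this value. *)
Lemma tints_block_density_le u c : block_density nu u -> (forall x, 0 <= u x) ->
  (forall y, big_cell_compact y -> u y <= c) -> (L u <= (c * C0)%:E)%E.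
Proof.
move=> bu u0 uc.
have c0 : 0 <= c.
  apply: le_trans (u0 (lower_block 0 *m perm_mx 1%g)) (uc _ _).
  by exists 0; [move=> i j; rewrite mxE (vf0 V)|exists 1%g].
have nd : nonneg_borel (dens (unit_density abs nu (m := m) (n := n))).
  apply: nb; first exact: (unit_density_bd V mu_haar nu0 nuE).
  exact: (unit_density_ge0 abs nu0 nuE).
have nS (r : seq 'S_(m + n)) : nonneg_borel (fun x => \sum_(w <- r) dens (unit_density abs nu (m := m) (n := n)) (x *m perm_mx w))%E.
  elim: r => [|w r IH].
    split=> [|x]; last by rewrite big_nil.
    rewrite (_ : (fun _ => _) = cst 0%E); first exact: measurable_cst.
    by apply/funext => x; rewrite big_nil.
  rewrite (_ : (fun _ => _) = (fun x => dens (unit_density abs nu (m := m) (n := n)) (x *m perm_mx w) + \sum_(w <- r) dens (unit_density abs nu (m := m) (n := n)) (x *m perm_mx w))%E); last first.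
    by apply/funext => x; rewrite big_cons.
  apply: nonneg_borelD => //; exact: (nonneg_borel_mulr V).
have Lud w : tints mu pairs (fun x => dens (unit_density abs nu (m := m) (n := n)) (x *m perm_mx w)) 1%:M = (b ^+ size pairs)%:E.
  rewrite tints_mulr mul1mx -[perm_mx w]mulmx1.
  rewrite (tints_left_invariant V mu_haar nu0 nuE)//; last 2 first.
  - apply: bd_density; first exact: (unit_density_bd V mu_haar nu0 nuE).
    exact: (unit_density_ge0 abs nu0 nuE).
  - exact: unitmx_perm.
  rewrite -(lower_block0 F m n) tints_unit_density ?enum_uniq//.
  rewrite (_ : small _ _ = true) ?mulr1//.
  by apply/forallP => ab; rewrite mem_enum.
have LS (r : seq 'S_(m + n)) : tints mu pairs (fun x => \sum_(w <- r) dens (unit_density abs nu (m := m) (n := n)) (x *m perm_mx w))%E 1%:M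
    = ((size r)%:R * b ^+ size pairs)%:E.
  elim: r => [|w r IH].
    rewrite mul0r (_ : (fun _ => _) = (fun x => 0%:E * dens (unit_density abs nu (m := m) (n := n)) x)%E); last first.
      by apply/funext => x; rewrite big_nil mul0e.
    by rewrite (tintsZ V)// mul0e.
  rewrite (_ : (fun _ => _) = (fun x => dens (unit_density abs nu (m := m) (n := n)) (x *m perm_mx w) + \sum_(w <- r) dens (unit_density abs nu (m := m) (n := n)) (x *m perm_mx w))%E); last first.
    by apply/funext => x; rewrite big_cons.
  rewrite (tintsD V)//; last exact: (nonneg_borel_mulr V).
  by rewrite Lud IH -EFinD /= -natr1; congr EFin; ring.
rewrite (_ : (c * C0)%:E = c%:E * tints mu pairs (fun x => \sum_(w <- enum 'S_(m + n)) dens (unit_density abs nu (m := m) (n := n)) (x *m perm_mx w)) 1%:M)%E; last first.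
  by rewrite LS -EFinM /C0 cardE.
rewrite -(tintsZ V)//; apply: (tints_le V) => //.
- exact: nb.
- by apply: nonneg_borelZ.
move=> y; apply: (@le_trans _ _ (c * \sum_(w : 'S_(m + n)) unit_density abs nu (y *m perm_mx w))%:E).
  by rewrite lee_fin; exact: block_density_le.
by rewrite EFinM sumEFin big_enum.
Qed.

Definition bounded_on_big_cell u := exists c, forall y, big_cell_compact y -> `|u y| <= c.

Definition pos_integral u := fine (L u).

Definition block_integral u := pos_integral u^\+ - pos_integral u^\-.

Let good u := [/\ block_density nu u, forall x, 0 <= u x & bounded_on_big_cell u].

Let L_ge0 u : good u -> (0 <= L u)%E.
Proof. by move=> [bu u0 _]; exact: (nonneg_borel_tints V mu _ (nb bu u0)).2. Qed.

Let LE u : good u -> L u = (pos_integral u)%:E.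
Proof.
move=> gu; rewrite fineK// ge0_fin_numE ?L_ge0//.
have [bu u0 [c uc]] := gu.
apply: le_lt_trans (ltry (c * C0)); apply: tints_block_density_le => // y /uc.
exact: le_trans (ler_norm _).
Qed.

Let pos_integralD u v : good u -> good v ->
  pos_integral (fun x => u x + v x) = pos_integral u + pos_integral v.
Proof.
move=> gu gv; rewrite /pos_integral -fineD; last 2 first.
- by rewrite LE.
- by rewrite LE.
have [bu u0 _] := gu; have [bv v0 _] := gv.
by rewrite -(tintsD V)//; exact: nb.
Qed.

Let pos_integralZ c u : 0 <= c -> good u -> pos_integral (fun x => c * u x) = c * pos_integral u.
Proof.
move=> c0 gu; have [bu u0 _] := gu; rewrite /pos_integral.
rewrite (_ : L (fun x => c * u x)%R = c%:E * L u)%E; first by rewrite LE.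
by rewrite -(tintsZ V)//; exact: nb.
Qed.

Lemma block_densityZ c u : block_density nu u -> block_density nu (fun x => c * u x).
Proof.
move=> bu; split.
- exact: (measurable_funM (measurable_cst c) (bd_measurable bu)).
- by move=> x nx; rewrite (bd_out bu)// mulr0.
- by move=> p x up dp ux; rewrite (bdE bu)// mulrCA.
Qed.

Lemma block_densityD u v : block_density nu u -> block_density nu v ->
  block_density nu (fun x => u x + v x).
Proof.
move=> bu bv; split.
- exact: (measurable_funD (bd_measurable bu) (bd_measurable bv)).
- by move=> x nx; rewrite (bd_out bu)// (bd_out bv)// addr0.
- by move=> p x up dp ux; rewrite (bdE bu)// (bdE bv)// mulrDr.
Qed.

Let goodD u v : good u -> good v -> good (fun x => u x + v x).
Proof.
move=> [bu u0 [c uc]] [bv v0 [d vd]]; split.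
- exact: block_densityD.
- by move=> x; rewrite addr_ge0.
- by exists (c + d) => y Ky; rewrite (le_trans (ler_normD _ _))// lerD ?uc ?vd.
Qed.

Let goodZ c u : 0 <= c -> good u -> good (fun x => c * u x).
Proof.
move=> c0 [bu u0 [d uc]]; split.
- exact: block_densityZ.
- by move=> x; rewrite mulr_ge0.
- by exists (c * d) => y Ky; rewrite normrM ger0_norm// ler_wpM2l// uc.
Qed.

Let funrposE u : u^\+ = fun x => Num.max (u x) 0. Proof. by []. Qed.

Let good_pos u : block_density nu u -> bounded_on_big_cell u -> good u^\+.
Proof.
move=> bu [c uc]; split.
- split.
  + exact: (measurable_funrpos (bd_measurable bu)).
  + by move=> x nx; rewrite funrposE (bd_out bu)// maxxx.
  + move=> p x up dp ux; rewrite funrposE (bdE bu)// maxr_pMr ?mulr0//.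
    by rewrite mulr_ge0 ?invr_ge0 ?exprn_ge0.
- exact: funrpos_ge0.
- exists c => y Ky; rewrite ger0_norm ?funrpos_ge0// ge_max.
  by have := uc y Ky => h; rewrite (le_trans (ler_norm _) h) (le_trans (normr_ge0 _) h).
Qed.

Let oppE u : (fun x => -1 * u x) = \- u.
Proof. by apply/funext => x; rewrite mulN1r. Qed.

Let good_neg u : block_density nu u -> bounded_on_big_cell u -> good u^\-.
Proof.
move=> bu [c uc]; rewrite -funrposN -oppE; apply: good_pos; first exact: block_densityZ.
by exists c => y Ky; rewrite mulN1r normrN uc.
Qed.

(** The value does not depend on how a density is written as a difference of non-negative ones:
    moving the subtracted terms across leaves an equality of sums, where additivity is known.
    Linearity reduces to this. *)
Lemma block_integral_sub u v : good u -> good v ->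
  block_integral (fun x => u x - v x) = pos_integral u - pos_integral v.
Proof.
move=> gu gv; set w := fun x => u x - v x.
have [bu u0 [c uc]] := gu; have [bv v0 [d vd]] := gv.
have bw : block_density nu w.
  rewrite (_ : w = fun x => u x + -1 * v x); last by apply/funext => x; rewrite mulN1r.
  by apply: block_densityD => //; exact: block_densityZ.
have bbw : bounded_on_big_cell w.
  by exists (c + d) => y Ky; rewrite (le_trans (ler_normB _ _))// lerD ?uc ?vd.
have gp := good_pos bw bbw; have gn := good_neg bw bbw.
have : pos_integral (fun x => w^\+ x + v x) = pos_integral (fun x => u x + w^\- x).
  congr pos_integral; apply/funext => x.
  have /(congr1 (fun f => f x)) := funrposBneg w; rewrite !fctE => /eqP.
  by rewrite subr_eq => /eqP ->; rewrite /w addrAC subrK.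
rewrite !pos_integralD// /block_integral; lra.
Qed.

Lemma block_integralD u v : block_density nu u -> bounded_on_big_cell u ->
  block_density nu v -> bounded_on_big_cell v ->
  block_integral (fun x => u x + v x) = block_integral u + block_integral v.
Proof.
move=> bu cu bv cv.
have gup := good_pos bu cu; have gun := good_neg bu cu.
have gvp := good_pos bv cv; have gvn := good_neg bv cv.
rewrite (_ : (fun x => u x + v x) = (fun x => (u^\+ x + v^\+ x) - (u^\- x + v^\- x))); last first.
  apply/funext => x.
  have /(congr1 (fun f => f x)) := funrposBneg u; have /(congr1 (fun f => f x)) := funrposBneg v.
  by rewrite !fctE => {1}<- {1}<-; ring.
rewrite block_integral_sub; [|exact: goodD|exact: goodD].
by rewrite !pos_integralD// /block_integral; ring.
Qed.

Lemma block_integralZ c u : block_density nu u -> bounded_on_big_cell u ->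
  block_integral (fun x => c * u x) = c * block_integral u.
Proof.
move=> bu cu; have gup := good_pos bu cu; have gun := good_neg bu cu.
have [c0|/ltW c0] := leP 0 c.
  rewrite (_ : (fun x => c * u x) = (fun x => c * u^\+ x - c * u^\- x)); last first.
    apply/funext => x.
    have /(congr1 (fun f => f x)) := funrposBneg u.
    by rewrite !fctE => {1}<-; ring.
  rewrite block_integral_sub; [|exact: goodZ|exact: goodZ].
  by rewrite !pos_integralZ// /block_integral; ring.
have c0' : 0 <= - c by rewrite oppr_ge0.
rewrite (_ : (fun x => c * u x) = (fun x => (- c) * u^\- x - (- c) * u^\+ x)); last first.
  apply/funext => x.
  have /(congr1 (fun f => f x)) := funrposBneg u.
  by rewrite !fctE => {1}<-; ring.
rewrite block_integral_sub; [|exact: goodZ|exact: goodZ].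
by rewrite !pos_integralZ// /block_integral; ring.
Qed.

(** The factor 2 accounts for the positive and the negative part. *)
Definition block_integral_bound := 2 * C0.

Lemma block_integral_bound_ge0 : 0 <= block_integral_bound.
Proof. exact: mulr_ge0. Qed.

Lemma block_integral_le u c : block_density nu u ->
  (forall y, big_cell_compact y -> `|u y| <= c) ->
  `|block_integral u| <= c * block_integral_bound.
Proof.
move=> bu uc; have cu : bounded_on_big_cell u by exists c.
have gp := good_pos bu cu; have gn := good_neg bu cu.
have h v : good v -> (forall y, big_cell_compact y -> v y <= c) -> 0 <= pos_integral v <= c * C0.
  move=> gv vc; have [bv v0 _] := gv.
  have := L_ge0 gv; have := tints_block_density_le bv v0 vc.
  by rewrite LE// !lee_fin => -> ->.
have /andP[p0 pc] : 0 <= pos_integral u^\+ <= c * C0.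
  apply: h => // y Ky; have := uc y Ky => h.
  by rewrite ge_max (le_trans (ler_norm _) h) (le_trans (normr_ge0 _) h).
have /andP[n0 nc] : 0 <= pos_integral u^\- <= c * C0.
  apply: h => // y Ky; have := uc y Ky => h; rewrite -normrN in h.
  by rewrite ge_max (le_trans (ler_norm _) h) (le_trans (normr_ge0 _) h).
rewrite /block_integral /block_integral_bound (le_trans (ler_normB _ _))// !ger0_norm//.
by rewrite mulrCA mulr_natl mulr2n lerD.
Qed.

Lemma block_integral_mulr u g : g \in unitmx -> block_density nu u ->
  bounded_on_big_cell u -> block_integral (fun x => u (x *m g)) = block_integral u.
Proof.
move=> ug bu cu.
have h v : good v -> pos_integral (fun x => v (x *m g)) = pos_integral v.
  move=> [bv v0 _]; rewrite /pos_integral /L; congr fine.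
  (* The base point has become [g]; read as [g *m 1], it is removed by left invariance. *)
  rewrite (tints_mulr _ _ (dens v)) mul1mx -[g]mulmx1.
  by rewrite (tints_left_invariant V mu_haar nu0 nuE (bd_density bv v0)).
rewrite /block_integral; congr (_ - _).
  by rewrite -(h u^\+)//; exact: good_pos.
by rewrite -(h u^\-)//; exact: good_neg.
Qed.

(** The character law carries the lower bound from the unit box of the big cell to the whole support
    of [unit_density], so [u] dominates [e] times a density whose integral is known and positive. *)
Lemma block_integral_gt0 u e : block_density nu u -> bounded_on_big_cell u ->
  (forall x, 0 <= u x) -> 0 < e ->
  (forall X : 'M[F]_(n, m), (forall i j, abs (X i j) <= 1) -> e <= u (lower_block X)) ->
  0 < block_integral u.
Proof.
move=> bu cu u0 e0 eu.
have gu : good u by [].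
have bo : block_density nu (unit_density abs nu (m := m) (n := n)) := unit_density_bd V mu_haar nu0 nuE m n.
have o0 := unit_density_ge0 abs nu0 nuE (m := m) (n := n).
have ou x : e * unit_density abs nu x <= u x.
  have [|] := boolP [&& x \in unitmx, drsubmx x \in unitmx &
      [forall a, forall b, abs ((invmx (drsubmx x) *m dlsubmx x) a b) <= 1]]; last first.
    by move=> /negbTE h; rewrite /unit_density h mulr0.
  move=> /and3P[ux udx h].
  have [p [up dp xp E]] := lower_block_decomposition ux udx.
  rewrite /unit_density ux udx h E [in leRHS]xp (bdE bu)// ?lower_block_unit// mulrC.
  rewrite ler_wpM2l//; first by rewrite mulr_ge0 ?invr_ge0 ?exprn_ge0.
  by apply: eu => i j; move/forallP : h => /(_ i)/forallP/(_ j).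
have -> : block_integral u = pos_integral u.
  rewrite /block_integral (_ : u^\+ = u); last first.
    by apply/funext => x; rewrite funrposE max_l.
  rewrite (_ : u^\- = fun x => 0 * u x); last first.
    by apply/funext => x; rewrite mul0r /funrneg max_r// oppr_le0.
  by rewrite pos_integralZ// mul0r subr0.
apply: (@lt_le_trans _ _ (e * b ^+ size pairs)).
  rewrite mulr_gt0// exprn_gt0// -lte_fin -bE.
  exact: (mu_ball_gt0 V mu_haar ltr01).
rewrite -lee_fin -LE// EFinM.
have <- : tints mu pairs (dens (unit_density abs nu (m := m) (n := n))) 1%:M = (b ^+ size pairs)%:E.
  rewrite -(lower_block0 F m n) tints_unit_density ?enum_uniq//.
  rewrite (_ : small _ _ = true) ?mulr1//.
  by apply/forallP => ab; rewrite mem_enum.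
rewrite -(tintsZ V)//; [|exact: ltW|exact: nb].
apply: (tints_le V).
- by apply: nonneg_borelZ; [exact: ltW|exact: nb].
- exact: nb.
- by move=> x; rewrite -EFinM lee_fin.
Qed.

Lemma compact_big_cell : compact big_cell_compact.
Proof.
rewrite (_ : big_cell_compact = \big[setU/set0]_(w <- enum 'S_(m + n))
   [set X *m perm_mx w | X in [set @lower_block F m n X | X in
      [set X : 'M[F]_(n, m) | forall i j, D (X i j)]]]); last first.
  rewrite -bigcup_seq; apply/seteqP; split=> [_ [X Xb [w _ <-]]|_ [w _ [_ [X Xb <-] <-]]].
    by exists w; [rewrite /= mem_enum|exists (lower_block X) => //; exists X].
  by exists X => //; exists w.
apply: bigsetU_compact => w _; apply: continuous_compact.
  apply: continuous_subspaceT => x; apply: (mulmx_continuous V) => //; exact: cst_continuous.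
apply: continuous_compact; last by apply: mx_box_compact; exact: (@vf_compact _ _ _ V).
apply: continuous_subspaceT => X; apply: mx_continuous => i j.
rewrite /lower_block; case: (split_ordP i) => a ->; case: (split_ordP j) => c ->.
- rewrite (_ : (fun _ => _) = cst ((1%:M : 'M[F]_m) a c)); first exact: cst_continuous.
  by apply/funext => Y; rewrite block_mxEul.
- rewrite (_ : (fun _ => _) = cst 0); first exact: cst_continuous.
  by apply/funext => Y; rewrite block_mxEur mxE.
- rewrite (_ : (fun _ => _) = (fun Y : 'M[F]_(n, m) => Y a c)); first exact: mx_entry_continuous.
  by apply/funext => Y; rewrite block_mxEdl.
- rewrite (_ : (fun _ => _) = cst ((1%:M : 'M[F]_n) a c)); first exact: cst_continuous.
  by apply/funext => Y; rewrite block_mxEdr.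
Qed.

Lemma big_cell_unit y : big_cell_compact y -> y \in unitmx.
Proof. by move=> [X _ [w _ <-]]; rewrite unitmx_mul lower_block_unit unitmx_perm. Qed.

Lemma continuous_bounded_on_big_cell u :
  (forall x, x \in unitmx -> continuous_at x (u : _ -> R^o)) -> bounded_on_big_cell u.
Proof.
move=> cu; have : compact [set (u x : R^o) | x in big_cell_compact].
  apply: continuous_compact compact_big_cell.
  by apply: continuous_in_subspaceT => x; rewrite inE => /big_cell_unit; exact: cu.
move=> /compact_bounded [M [_ HM]]; exists (M + 1) => y Ky.
by apply: (HM (M + 1)); [rewrite ltrDl|exists y].
Qed.

End DensityIntegral.

(** * Smooth functions on GL over archimedean fields *)

Section ArchimedeanCalculus.
Context (R : realType) (F : topFieldType) (abs : F -> R).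
Hypothesis V : valued_field abs.
Context (Psi : {rmorphism F -> R[i]}) (iota : R -> F) (N : nat).
Hypothesis Psi_iota : forall t, Psi (iota t) = t%:C%C.
Hypothesis iota_cont : continuous (iota : R^o -> F).
Hypothesis Re_cont : continuous (fun z => complex.Re (Psi z) : R^o).
Hypothesis Im_cont : continuous (fun z => complex.Im (Psi z) : R^o).
Implicit Types (f g h : 'M[F]_N -> R) (x v : 'M[F]_N) (vs : seq 'M[F]_N).

Lemma iota0 : iota 0 = 0.
Proof. by apply: (fmorph_inj Psi); rewrite Psi_iota !rmorph0. Qed.

Inductive smooth_expr : ('M[F]_N -> R) -> Prop :=
| smooth_cst c : smooth_expr (fun=> c)
| smooth_Re a b : smooth_expr (fun x => complex.Re (Psi (x a b)))
| smooth_Im a b : smooth_expr (fun x => complex.Im (Psi (x a b)))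
| smooth_add f g : smooth_expr f -> smooth_expr g -> smooth_expr (fun x => f x + g x)
| smooth_mul f g : smooth_expr f -> smooth_expr g -> smooth_expr (fun x => f x * g x)
| smooth_pow f s : smooth_expr f -> (forall x, GL x -> 0 < f x) ->
    smooth_expr (fun x => f x `^ s).

Lemma smooth_expr_continuous f : smooth_expr f ->
  forall x, GL x -> continuous_at x (f : _ -> R^o).
Proof.
elim=> {f} [c|a b|a b|f g _ IHf _ IHg|f g _ IHf _ IHg|f s _ IHf f0] x xG.
- exact: cst_continuous.
- exact: (continuous_comp (@mx_entry_continuous _ _ _ a b x) (@Re_cont _)).
- exact: (continuous_comp (@mx_entry_continuous _ _ _ a b x) (@Im_cont _)).
- by apply: continuousD; [exact: IHf|exact: IHg].
- by apply: (@continuousM R); [exact: IHf|exact: IHg].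
- have df : derivable ((@powR R)^~ s) (f x : R^o) 1.
    by have [] := is_derive1_powR s (f0 x xG).
  have c : continuous_at (f x : R^o) ((@powR R)^~ s : R^o -> R^o).
    exact/differentiable_continuous/derivable1_diffP.
  exact: (continuous_comp (IHf x xG) c).
Qed.

Lemma smooth_expr_derive f : smooth_expr f -> forall v, exists2 g, smooth_expr g &
  forall x, GL x -> is_derive (0 : R^o) 1 (fun t => f (x + iota t *: v)) (g x).
Proof.
have lin (L : {additive R[i] -> R}) (a b : 'I_N) v x : (forall t z, L (t%:C%C * z) = t * L z) ->
    is_derive (0 : R^o) 1 (fun t => L (Psi ((x + iota t *: v) a b))) (L (Psi (v a b))).
  move=> LZ.
  rewrite (_ : (fun _ => _) = (fun t : R => L (Psi (x a b)) + t * L (Psi (v a b)))); last first.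
    by apply/funext => t; rewrite !mxE rmorphD rmorphM Psi_iota raddfD LZ.
  rewrite -[X in is_derive _ _ _ X]add0r; apply: is_deriveD.
  rewrite (_ : (fun _ => _) = (fun t : R => L (Psi (v a b)) *: t)); last first.
    by apply/funext => t; rewrite [RHS]mulrC.
  rewrite -[X in is_derive _ _ _ X]mulr1; exact: is_deriveZ.
elim=> {f} [c|a b|a b|f g sf IHf sg IHg|f g sf IHf sg IHg|f s sf IHf f0] v.
- by exists (fun=> 0) => [|x _]; [exact: smooth_cst|exact: is_derive_cst].
- exists (fun=> complex.Re (Psi (v a b))) => [|x _]; first exact: smooth_cst.
  by apply: lin => t [u w] /=; rewrite mul0r subr0.
- exists (fun=> complex.Im (Psi (v a b))) => [|x _]; first exact: smooth_cst.
  by apply: lin => t [u w] /=; rewrite mul0r addr0.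
- have [f' sf' df] := IHf v; have [g' sg' dg] := IHg v.
  exists (fun x => f' x + g' x) => [|x xG]; first exact: smooth_add.
  by apply: is_deriveD; [exact: df|exact: dg].
- have [f' sf' df] := IHf v; have [g' sg' dg] := IHg v.
  exists (fun x => f x * g' x + g x * f' x) => [|x xG].
    by apply: smooth_add; exact: smooth_mul.
  have := is_deriveM (df x xG) (dg x xG).
  by rewrite iota0 scale0r addr0.
- have [f' sf' df] := IHf v.
  exists (fun x => (s * f x `^ (s - 1)) * f' x) => [|x xG].
    by apply: smooth_mul => //; apply: smooth_mul; [exact: smooth_cst|exact: smooth_pow].
  have xx : x + iota 0 *: v = x by rewrite iota0 scale0r addr0.
  apply: (is_derive1_comp (f := (@powR R)^~ s) (g := fun t => f (x + iota t *: v))); last exact: df.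
  by rewrite xx; apply: is_derive1_powR; exact: f0.
Qed.

Lemma line_near_GL x v : GL x -> \forall t \near (0 : R^o), GL (x + iota t *: v).
Proof.
move=> xG; have c : continuous (fun t : R^o => x + iota t *: v : 'M[F]_N).
  move=> t; apply: mx_continuous => i j.
  rewrite (_ : (fun _ => _) = (fun t : R^o => x i j + iota t * v i j)); last first.
    by apply/funext => u; rewrite !mxE.
  apply: (vf_continuousD V); first exact: cst_continuous.
  by apply: (vf_continuousM V); [exact: iota_cont|exact: cst_continuous].
have := c 0; apply; rewrite iota0 scale0r addr0.
by apply: open_nbhs_nbhs; split=> //; exact: (@GL_open _ _ _ V).
Qed.

(** Agreement of [h] and [f] on GL is enough, since GL is open and a derivative sees only nearby
    points of a line. *)
Lemma smooth_expr_dderivs f h vs : smooth_expr f -> (forall x, GL x -> h x = f x) ->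
  exists2 g, smooth_expr g & forall x, GL x -> dderivs iota vs h x = g x.
Proof.
move=> sf hf; elim: vs => [|v vs [g sg hg]]; first by exists f.
have [g' sg' dg] := smooth_expr_derive sg v.
exists g' => // x xG; rewrite /= /dderiv derive1E.
rewrite (@near_eq_derive R R^o R^o _ (fun t => g (x + iota t *: v))); last first.
  by apply: filterS (line_near_GL v xG) => t; exact: hg.
by have /(@derive_val _ _ _ _ _ _ _) := dg x xG.
Qed.

Lemma smooth_expr_Cinfty f h : smooth_expr f -> (forall x, GL x -> h x = f x) ->
  real_Cinfty iota h.
Proof.
move=> sf hf vs x xG; have [g sg hg] := smooth_expr_dderivs vs sf hf.
split=> [|v].
  have gx := smooth_expr_continuous sg xG.
  have e : \forall y \near x, g y = dderivs iota vs h y.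
    apply: filterS (_ : nbhs x (@GL F N)) => [y yG|]; first by rewrite hg.
    by apply: open_nbhs_nbhs; split=> //; exact: (@GL_open _ _ _ V).
  change (dderivs iota vs h @ x --> dderivs iota vs h x); rewrite (hg x xG).
  exact: (cvg_trans (near_eq_cvg e) gx).
have [g' _ dg] := smooth_expr_derive sg v.
have [dgx _] := dg x xG.
apply: near_eq_derivable dgx.
by apply: filterS (line_near_GL v xG) => t tG; rewrite hg.
Qed.

Lemma dderivsZ (c : R) h vs x : real_Cinfty iota h -> GL x ->
  dderivs iota vs (fun y => c * h y) x = c * dderivs iota vs h x.
Proof.
move=> hC; elim: vs x => // v vs IH x xG; rewrite /= /dderiv !derive1E.
rewrite (@near_eq_derive R R^o R^o _ (fun t => c *: dderivs iota vs h (x + iota t *: v))); last first.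
  by apply: filterS (line_near_GL v xG) => t; exact: IH.
by rewrite deriveZ//; have [_] := hC vs x xG; exact.
Qed.

Lemma real_CinftyZ (c : R) h : real_Cinfty iota h -> real_Cinfty iota (fun x => c * h x).
Proof.
move=> hC vs x xG; have [ch dh] := hC vs x xG.
have E y : GL y -> dderivs iota vs (fun y => c * h y) y = c * dderivs iota vs h y by exact: dderivsZ.
split=> [|v].
  change (dderivs iota vs (fun y => c * h y) @ x --> dderivs iota vs (fun y => c * h y) x).
  rewrite E//.
  have e : \forall y \near x, c * dderivs iota vs h y = dderivs iota vs (fun y => c * h y) y.
    apply: filterS (_ : nbhs x (@GL F N)) => [y yG|]; first by rewrite E.
    by apply: open_nbhs_nbhs; split=> //; exact: (@GL_open _ _ _ V).
  apply: (cvg_trans (near_eq_cvg e)).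
  by apply: (@cvgMr R); exact: ch.
have := derivableZ (k := c) (dh v).
apply: near_eq_derivable.
by apply: filterS (line_near_GL v xG) => t tG; rewrite E.
Qed.

Definition csmooth_expr (f : 'M[F]_N -> R[i]) :=
  smooth_expr (fun x => complex.Re (f x)) /\ smooth_expr (fun x => complex.Im (f x)).

Lemma csmooth_cst c : csmooth_expr (fun=> c).
Proof. by split; exact: smooth_cst. Qed.

Lemma csmooth_entry a b : csmooth_expr (fun x => Psi (x a b)).
Proof. by split; [exact: smooth_Re|exact: smooth_Im]. Qed.

Lemma csmoothD (f g : 'M[F]_N -> R[i]) : csmooth_expr f -> csmooth_expr g -> csmooth_expr (fun x => f x + g x).
Proof.
move=> [f1 f2] [g1 g2]; split.
  rewrite (_ : (fun _ => _) = (fun x => complex.Re (f x) + complex.Re (g x))); first exact: smooth_add.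
  by apply/funext => x; rewrite raddfD.
rewrite (_ : (fun _ => _) = (fun x => complex.Im (f x) + complex.Im (g x))); first exact: smooth_add.
by apply/funext => x; rewrite raddfD.
Qed.

Lemma csmoothM (f g : 'M[F]_N -> R[i]) : csmooth_expr f -> csmooth_expr g -> csmooth_expr (fun x => f x * g x).
Proof.
move=> [f1 f2] [g1 g2]; split.
  rewrite (_ : (fun _ => _) = (fun x => complex.Re (f x) * complex.Re (g x) +
     (-1) * (complex.Im (f x) * complex.Im (g x)))).
    apply: smooth_add; first exact: smooth_mul.
    by apply: smooth_mul; [exact: smooth_cst|exact: smooth_mul].
  by apply/funext => x; case: (f x) (g x) => [a b] [c d] /=; rewrite mulN1r.
rewrite (_ : (fun _ => _) = (fun x => complex.Re (f x) * complex.Im (g x) +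
     complex.Im (f x) * complex.Re (g x))).
  by apply: smooth_add; exact: smooth_mul.
by apply/funext => x; case: (f x) (g x) => [a b] [c d] /=.
Qed.

Lemma csmooth_sum (I : Type) (r : seq I) (f : I -> 'M[F]_N -> R[i]) :
  (forall i, csmooth_expr (f i)) -> csmooth_expr (fun x => \sum_(i <- r) f i x).
Proof.
move=> sf; elim: r => [|i r IH].
  by under eq_fun do rewrite big_nil; exact: csmooth_cst.
by under eq_fun do rewrite big_cons; exact: csmoothD.
Qed.

Lemma csmooth_prod (I : Type) (r : seq I) (f : I -> 'M[F]_N -> R[i]) :
  (forall i, csmooth_expr (f i)) -> csmooth_expr (fun x => \prod_(i <- r) f i x).
Proof.
move=> sf; elim: r => [|i r IH].
  by under eq_fun do rewrite big_nil; exact: csmooth_cst.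
by under eq_fun do rewrite big_cons; exact: csmoothM.
Qed.

Lemma csmooth_minor k (p q : 'I_k -> 'I_N) :
  csmooth_expr (fun x => Psi (\det (\matrix_(a, b) x (p a) (q b)))).
Proof.
rewrite (_ : (fun _ => _) = (fun x => \sum_(s : 'S_k) ((-1) ^+ s * \prod_i Psi (x (p i) (q (s i)))))); last first.
  apply/funext => x; rewrite /determinant rmorph_sum; apply: eq_bigr => s _.
  rewrite rmorphM rmorph_sign rmorph_prod; congr (_ * _).
  by apply: eq_bigr => i _; rewrite mxE.
apply: csmooth_sum => s; apply: csmoothM; first exact: csmooth_cst.
by apply: csmooth_prod => i; exact: csmooth_entry.
Qed.

Definition normsq (z : R[i]) : R := complex.Re z ^+ 2 + complex.Im z ^+ 2.

Lemma smooth_normsq (f : 'M[F]_N -> R[i]) : csmooth_expr f -> smooth_expr (fun x => normsq (f x)).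
Proof.
move=> [f1 f2]; rewrite /normsq.
rewrite (_ : (fun _ => _) = (fun x => complex.Re (f x) * complex.Re (f x) +
   complex.Im (f x) * complex.Im (f x))); last by apply/funext => x; rewrite !expr2.
by apply: smooth_add; exact: smooth_mul.
Qed.

Lemma smooth_sum (I : Type) (r : seq I) (f : I -> 'M[F]_N -> R) :
  (forall i, smooth_expr (f i)) -> smooth_expr (fun x => \sum_(i <- r) f i x).
Proof.
move=> sf; elim: r => [|i r IH].
  by under eq_fun do rewrite big_nil; exact: smooth_cst.
by under eq_fun do rewrite big_cons; exact: smooth_add.
Qed.

End ArchimedeanCalculus.

(** * Archimedean local fields *)

(** Placing [n s] between consecutive integers bounds [n |u s - s u 1|] by [u 1] for every [n]; the
    Archimedean property then forces equality. *)
Lemma additive_nondecreasing_linear (R : realType) (u : R -> R) :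
  (forall s t, u (s + t) = u s + u t) -> {homo u : s t / s <= t} ->
  forall s, u s = s * u 1.
Proof.
move=> uD uh s.
have u0 : u 0 = 0 by apply: (addrI (u 0)); rewrite -uD !addr0.
have uN t : u (- t) = - u t.
  by apply/eqP; rewrite -subr_eq0 opprK -uD addNr u0.
have un (n : nat) t : u (n%:R * t) = n%:R * u t.
  elim: n => [|n IH]; first by rewrite !mul0r u0.
  by rewrite -natr1 !mulrDl !mul1r uD IH.
have uz (k : int) : u k%:~R = k%:~R * u 1.
  case: k => n; first by rewrite -pmulrn -[in LHS](mulr1 n%:R) un.
  by rewrite NegzE !mulrNz uN -pmulrn -[in LHS](mulr1 n.+1%:R) un mulNr.
have u1 : 0 <= u 1 by rewrite -u0; exact: uh.
have bound (n : nat) : `|n%:R * (u s - s * u 1)| <= u 1.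
  have /andP[k1 k2] := floor_itv (n%:R * s).
  set k := Num.floor _ in k1 k2.
  have h1 := uh _ _ k1; have h2 := uh _ _ (ltW k2).
  rewrite uz un in h1; rewrite uz un intrD1 in h2 || rewrite uz un in h2.
  have h3 : k%:~R * u 1 <= n%:R * s * u 1 by rewrite ler_wpM2r.
  have h4 : n%:R * s * u 1 <= (k + 1)%:~R * u 1 by rewrite ler_wpM2r// ltW.
  rewrite intrD mulrDl mul1r in h2 h4.
  by rewrite ler_norml mulrBr mulrA; apply/andP; split; lra.
apply/eqP; rewrite -subr_eq0; apply: contraT => d0.
have dp : 0 < `|u s - s * u 1| by rewrite normr_gt0.
pose n := (Num.truncn (u 1 / `|u s - s * u 1|)).+1.
have := bound n; rewrite normrM ger0_norm// leNgt -ltr_pdivrMr//.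
by rewrite truncnS_gt.
Qed.

Section ArchimedeanValuation.
Context (R : realType) (F : topFieldType) (C : numFieldType).
Context (phi : {rmorphism C -> F}) (psi : {rmorphism F -> C}) (j : {rmorphism R -> C}).
Hypothesis psiK : cancel psi phi.
Hypothesis phi_cont : continuous (phi : C^o -> F).
Hypothesis psi_cont : continuous (psi : F -> C^o).
Hypothesis j_le : forall r s, (j r <= j s) = (r <= s).
Hypothesis j_pos : forall e, 0 < e -> exists r, e = j r.
Context (abs : F -> R).
Hypothesis absE : forall z, j (abs z) = `|psi z|.
Hypothesis lc : exists2 K : set C^o, compact K & nbhs 0 K.

Let j_lt r s : (j r < j s) = (r < s).
Proof. by rewrite !lt_neqAle j_le (inj_eq (fmorph_inj j)). Qed.

(** [C] stands for the real or the complex numbers and [j] for the inclusion of the reals, so that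
    one argument covers both archimedean clauses. *)
Lemma archimedean_valued_field : valued_field abs.
Proof.
split.
- by move=> x; rewrite -j_le rmorph0 absE.
- move=> x; split=> [h|->].
    apply: (fmorph_inj psi); apply/eqP; rewrite rmorph0 -normr_eq0 -absE h rmorph0.
    by rewrite eqxx.
  by apply: (fmorph_inj j); rewrite absE !rmorph0 normr0.
- by move=> x y; apply: (fmorph_inj j); rewrite rmorphM !absE rmorphM normrM.
- by move=> x y; rewrite -j_le rmorphD !absE rmorphD ler_normD.
- move=> x A; split=> [xA|[e e0 eA]].
    have : nbhs (psi x : C^o) (phi @^-1` A).
      by apply: phi_cont; rewrite psiK.
    move=> /nbhs_ballP [e /= e0 eA]; have [r er] := j_pos e0.
    exists r; first by rewrite -j_lt rmorph0 -er.
    move=> y yr; rewrite -[y]psiK; apply: eA.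
    by rewrite /ball /= distrC -rmorphB -absE er j_lt.
  have : nbhs x (psi @^-1` (ball (psi x : C^o) (j e))).
    apply: psi_cont; apply: nbhsx_ballx; by rewrite -(rmorph0 j) j_lt.
  apply: filterS => y /=; rewrite /ball /= distrC -rmorphB -absE j_lt; exact: eA.
- have [K cK K0] := lc; exists (phi @` K).
    by apply: continuous_compact cK; exact: continuous_subspaceT.
  have : nbhs 0 (psi @^-1` K) by apply: psi_cont; rewrite rmorph0.
  by apply: filterS => y Ky; exists (psi y) => //; exact: psiK.
- have a2 : abs (2^-1) = 2^-1.
    apply: (fmorph_inj j); rewrite absE !fmorphV !rmorph_nat normfV.
    by rewrite normr_nat.
  by exists 2^-1; rewrite a2 invr_gt0 ltr0n /= invf_lt1 ?ltr1n.
Qed.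

End ArchimedeanValuation.

(** [Psi] embeds [F] into the complex numbers; for a real field its values are real. Both
    archimedean cases thus share one calculus. *)
Record archimedean_field (R : realType) (F : topFieldType) (abs : F -> R)
    (Psi : {rmorphism F -> R[i]}) (iota : R -> F) : Prop := {
  af_iota : forall t, Psi (iota t) = t%:C%C;
  af_iota_continuous : continuous (iota : R^o -> F);
  af_Re_continuous : continuous (fun z => complex.Re (Psi z) : R^o);
  af_Im_continuous : continuous (fun z => complex.Im (Psi z) : R^o);
  af_abs : forall z, abs z = Num.sqrt (normsq (Psi z))
}.

Lemma cancel_rmorphism (C F : fieldType) (phi : {rmorphism C -> F}) (psi : F -> C) :
  cancel phi psi -> cancel psi phi -> exists psi' : {rmorphism F -> C}, psi' =1 psi.
Proof.
move=> pK Kp.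
pose mA := GRing.isZmodMorphism.Build F C psi (can2_zmod_morphism pK Kp).
pose mM := GRing.isMonoidMorphism.Build F C psi (can2_monoid_morphism pK Kp).
pose psi' : {rmorphism F -> C} := HB.pack psi mA mM.
by exists psi'.
Qed.

Lemma Re_continuous (R : realType) : continuous (fun z : R[i]^o => complex.Re z : R^o).
Proof.
move=> z A /nbhs_ballP [e /= e0 eA]; apply/nbhs_ballP.
exists e%:C%C; first by rewrite /= ltcR.
move=> y; rewrite /ball /= => yz; apply: eA; rewrite /ball /= -raddfB -ltcR.
exact: le_lt_trans (normc_ge_Re _) yz.
Qed.

Lemma normc_ge_Im (R : realType) (z : R[i]) : `|complex.Im z|%:C%C <= `|z|.
Proof. by rewrite normc_def lecR -sqrtr_sqr ler_wsqrtr// lerDr sqr_ge0. Qed.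

Lemma Im_continuous (R : realType) : continuous (fun z : R[i]^o => complex.Im z : R^o).
Proof.
move=> z A /nbhs_ballP [e /= e0 eA]; apply/nbhs_ballP.
exists e%:C%C; first by rewrite /= ltcR.
move=> y; rewrite /ball /= => yz; apply: eA; rewrite /ball /= -raddfB -ltcR.
exact: le_lt_trans (normc_ge_Im _) yz.
Qed.

Lemma gt0_real_complex (R : realType) (e : R[i]) : 0 < e -> exists2 r, 0 < r & e = r%:C%C.
Proof.
by case: e => a b; rewrite ltcE /= => /andP[/eqP -> a0]; exists a.
Qed.

Lemma complex_continuous (R : realType) : continuous (fun z : R^o * R^o => (z.1 +i* z.2)%C : R[i]^o).
Proof.
move=> z A /nbhs_ballP [_ /= /gt0_real_complex [r r0 ->] eA].
have r2 : 0 < r / 2 by rewrite divr_gt0.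
exists (ball z.1 (r / 2), ball z.2 (r / 2)) => /=; first by split; exact: nbhsx_ballx.
move=> y [/= y1 y2]; apply: eA; rewrite /ball /= normc_def ltcR /=.
rewrite -[X in _ < X]ger0_norm ?ltW// -sqrtr_sqr.
rewrite ltr_sqrt; last by rewrite exprn_gt0.
have h (a : R) : `|a| < r / 2 -> a ^+ 2 < (r / 2) ^+ 2.
  by move=> ha; rewrite -real_normK ?num_real// ltr_pXn2r ?nnegrE// ltW.
apply: lt_le_trans (ltrD (h _ y1) (h _ y2)) _; rewrite !expr2; nra.
Qed.

Lemma local_field_archimedean (R : realType) (F : topFieldType) (LF : local_field R F) iota :
  real_line LF = Some iota -> exists abs Psi,
    valued_field abs /\ archimedean_field abs Psi iota.
Proof.
case: LF => [phi psi pK Kp cphi cpsi|phi psi pK Kp cphi cpsi|//] [<-].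
- have [psi' psiE] := cancel_rmorphism pK Kp.
  have eqp : psi = psi' by apply/funext => x; rewrite psiE.
  pose Psi : {rmorphism F -> R[i]} := real_complex R \o psi'.
  exists (fun z => Num.sqrt (normsq (Psi z))), Psi.
  have aE z : Num.sqrt (normsq (Psi z)) = `|psi' z|.
    by rewrite /normsq /Psi /= expr0n /= addr0 sqrtr_sqr.
  rewrite eqp in pK Kp cpsi; split.
    apply: (@archimedean_valued_field R F R phi psi' idfun Kp cphi cpsi) => //.
      by move=> e _; exists e.
    exists (`[-1, 1]%classic : set R^o); first exact: segment_compact.
    apply/nbhs_ballP; exists 1 => //= y; rewrite /ball /= sub0r normrN => /ltW.
    by rewrite ler_norml in_itv.
  split=> //.
  + by move=> t; rewrite /Psi /= pK.
  + by move=> z; exact: cst_continuous.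
- have [psi' psiE] := cancel_rmorphism pK Kp.
  have eqp : psi = psi' by apply/funext => x; rewrite psiE.
  exists (fun z => Num.sqrt (normsq (psi' z))), psi'.
  have aE z : (Num.sqrt (normsq (psi' z)))%:C%C = `|psi' z| by rewrite normc_def.
  rewrite eqp in pK Kp cpsi; split.
    apply: (@archimedean_valued_field R F R[i] phi psi' (real_complex R) Kp cphi cpsi) => //.
    + by move=> r s; rewrite lecR.
    + by move=> e /gt0_real_complex [r _ ->]; exists r.
    exists ((fun z : R^o * R^o => (z.1 +i* z.2)%C : R[i]^o) @` (`[-1, 1]%classic `*` `[-1, 1]%classic)).
      apply: continuous_compact; last by apply: compact_setX; exact: segment_compact.
      by apply: continuous_subspaceT; exact: complex_continuous.
    apply/nbhs_ballP; exists 1 => //= y; rewrite /ball /= sub0r normrN => y1.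
    exists (complex.Re y, complex.Im y); last by case: (y).
    split; rewrite /= in_itv /= -ler_norml -lecR; apply: le_trans (ltW y1).
      exact: normc_ge_Re.
    exact: normc_ge_Im.
  split=> //.
  + apply: (continuous_fun_comp (f := fun t : R^o => t%:C%C : R[i]^o) _ cphi).
    move=> t A /nbhs_ballP [_ /= /gt0_real_complex [r r0 ->] eA].
    apply/nbhs_ballP; exists r => // y; rewrite /ball /= => yr; apply: eA.
    by rewrite /ball /= -rmorphB normc_def /= expr0n /= addr0 sqrtr_sqr ltcR.
  + exact: (continuous_fun_comp cpsi (@Re_continuous R)).
  + exact: (continuous_fun_comp cpsi (@Im_continuous R)).
Qed.

(** * Smooth powers of a block norm *)

Lemma nonarchimedean_valued_field (R : realType) (F : topFieldType) (abs : F -> R) :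
  nonarchimedean_abs abs -> locally_compact [set: F] -> valued_field abs.
Proof.
move=> H lc.
have abs1 : abs 1 = 1.
  have h : abs 1 * abs 1 = abs 1 * 1 by rewrite -(nabsM H) !mulr1.
  apply: (mulfI _ h); apply/eqP => /(nabs_eq0 H)/eqP; by rewrite oner_eq0.
split.
- exact: nabs_ge0.
- exact: nabs_eq0.
- exact: nabsM.
- move=> x y; apply: (le_trans (nabs_ultrametric H x y)).
  by rewrite ge_max lerDl lerDr !(nabs_ge0 H).
- exact: nabs_nbhs.
- have [K] := lc 0 I; rewrite /within /= => K0 [cK _]; exists K => //.
  by apply: filterS K0 => x; exact.
- have [x [x0 x1]] := nabs_nontrivial H.
  have ax : 0 < abs x.
    by rewrite lt_def (nabs_ge0 H) andbT; apply: contra_neq x0 => /(nabs_eq0 H).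
  (* Either the non-trivial element or its inverse is small. *)
  have [lt1|ge1] := ltP (abs x) 1; first by exists x; rewrite ax.
  have axV : abs x^-1 = (abs x)^-1.
    by apply: (mulfI (lt0r_neq0 ax)); rewrite -(nabsM H) !divff ?lt0r_neq0.
  by exists x^-1; rewrite axV invr_gt0 ax invf_lt1// lt_neqAle eq_sym x1.
Qed.

Lemma local_field_valued (R : realType) (F : topFieldType) (LF : local_field R F) :
  exists2 abs : F -> R, valued_field abs &
    (exists Psi iota, real_line LF = Some iota /\ archimedean_field abs Psi iota) \/
    (real_line LF = None /\ forall x y, abs (x + y) <= Num.max (abs x) (abs y)).
Proof.
case E : (real_line LF) => [iota|].
  have [abs [Psi [V af]]] := local_field_archimedean E.
  by exists abs => //; left; exists Psi, iota.
case: LF E => // abs H lc _; exists abs; first exact: nonarchimedean_valued_field.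
by right; split=> //; exact: nabs_ultrametric.
Qed.

Section SmoothFunctions.
Context (R : realType) (F : topFieldType) (LF : local_field R F) (abs : F -> R).
Hypothesis V : valued_field abs.
Context (mu : {sigma_finite_measure set (borel F) -> \bar R}).
Hypothesis mu_haar : haar_measure mu.
Context (nu : F -> R).
Hypothesis nu0 : nu 0 = 0.
Hypothesis nuE : haar_modulus mu nu.

Let nuM := nuM V mu_haar nu0 nuE.
Let nu_gt0 := nu_gt0 nuE.
Let nu_ge0 := nu_ge0 nu0 nuE.
Let nu_le := nu_le V mu_haar nu0 nuE.

Lemma normsq_gt0 (z : R[i]) : z != 0 -> 0 < normsq z.
Proof.
move=> z0; rewrite /normsq lt_def addr_ge0 ?sqr_ge0// andbT.
apply: contra_neq z0 => /eqP; rewrite paddr_eq0 ?sqr_ge0// !sqrf_eq0.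
by case: z => a b /= /andP[/eqP -> /eqP ->].
Qed.

Lemma normsqM (z w : R[i]) : normsq (z * w) = normsq z * normsq w.
Proof. by case: z w => a b [c d]; rewrite /normsq /=; ring. Qed.

(** In logarithmic coordinates [nu] is additive and monotone on the positive reals, hence linear,
    and by monotonicity [nu z] depends on [abs z] only. The exponent is halved because [normsq] is
    the square of [abs]. This makes powers of [nu (\det x)] smooth. *)
Lemma nu_archimedean_power Psi iota : archimedean_field abs Psi iota ->
  exists c, forall z, z != 0 -> nu z = normsq (Psi z) `^ c.
Proof.
move=> af.
have absI r : 0 <= r -> abs (iota r) = r.
  move=> r0; rewrite (af_abs af) (af_iota af) /normsq /= expr0n /= addr0.
  by rewrite sqrtr_sqr ger0_norm.
have iotaM r s : iota (r * s) = iota r * iota s.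
  by apply: (fmorph_inj Psi); rewrite rmorphM !(af_iota af) rmorphM.
have iN r : 0 < r -> 0 < nu (iota r).
  by move=> r0; apply: nu_gt0; rewrite -(vf_gt0 V) absI// ltW.
pose u s := ln (nu (iota (expR s))).
have uD s t : u (s + t) = u s + u t.
  rewrite /u expRD iotaM nuM lnM// posrE iN//; exact: expR_gt0.
have uh : {homo u : s t / s <= t}.
  move=> s t st; rewrite /u ler_ln ?posrE ?iN ?expR_gt0//.
  by apply: nu_le; rewrite !absI ?expR_ge0// ler_expR.
have uE := additive_nondecreasing_linear uD uh.
exists (u 1 / 2) => z z0.
have az : 0 < abs z by rewrite (vf_gt0 V).
have -> : nu z = nu (iota (abs z)).
  by apply/eqP; rewrite eq_le !nu_le// absI// ltW.
have nz : 0 < normsq (Psi z) by apply: normsq_gt0; rewrite fmorph_eq0.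
have <- : expR (u (ln (abs z))) = nu (iota (abs z)).
  have h : expR (ln (abs z)) = abs z by rewrite lnK ?posrE.
  by rewrite /u h lnK ?posrE ?iN.
rewrite uE /powR gt_eqF//; congr expR.
have -> : normsq (Psi z) = abs z ^+ 2.
  by rewrite (af_abs af) sqr_sqrtr// ltW.
by rewrite lnXn// -mulr_natr; field.
Qed.

Section BlockNorm.
Context (m n : nat).
Implicit Types (x p : 'M[F]_(m + n)) (S : {ffun 'I_n -> 'I_(m + n)}).

(** The determinants of these matrices are the Pluecker coordinates of the lower rows; an element of
    the parabolic subgroup multiplies all of them by one determinant. [S] may be any function, as a
    repeated column merely contributes a zero. *)
Definition lower_minor S x := \matrix_(a, b) x (rshift m a) (S b).

Lemma lower_minor_mul S p x : dlsubmx p = 0 ->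
  lower_minor S (p *m x) = drsubmx p *m lower_minor S x.
Proof.
move=> dp; apply/matrixP => a b; rewrite !mxE big_split_ord /= big1 ?add0r.
  by apply: eq_bigr => l _; rewrite !mxE.
by move=> l _; move/matrixP/(_ a l) : dp; rewrite !mxE => ->; rewrite mul0r.
Qed.

Lemma lower_minor_unit x : x \in unitmx -> exists S, lower_minor S x \in unitmx.
Proof.
move=> /exists_unit_minor [w uw]; exists [ffun b => (w^-1)%g (rshift m b)].
rewrite (_ : lower_minor _ _ = drsubmx (x *m perm_mx w))//.
by apply/matrixP => a b; rewrite [RHS]mxE [RHS]mxE mulmx_perm_mxE mxE ffunE.
Qed.

Lemma lower_minor_continuous S : continuous (fun x => \det (lower_minor S x)).
Proof.
apply: (continuous_fun_comp (f := lower_minor S)); last exact: (det_continuous V).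
move=> x; apply: mx_continuous => a b.
rewrite (_ : (fun _ => _) = (fun y : 'M[F]_(m + n) => y (rshift m a) (S b))); first exact: mx_entry_continuous.
by apply/funext => y; rewrite mxE.
Qed.

End BlockNorm.

(** Smoothness is asked for all exponents at once in order to cover a positive density, its
    reciprocal on GL and, for [t = 0], the power of [nu (\det x)] spanning the image. *)
Definition block_norm_spec m n (Nrm : 'M[F]_(m + n) -> R) :=
  [/\ forall x, x \in unitmx -> 0 < Nrm x,
    forall p x, p \in unitmx -> dlsubmx p = 0 -> x \in unitmx ->
      Nrm (p *m x) = nu (\det (drsubmx p)) * Nrm x &
    forall s t, smooth LF (fun x =>
      (if x \in unitmx then nu (\det x) `^ s * Nrm x `^ t else 0)%:C%C)].

(** A sum of squared moduli is smooth and positive on GL; the outer exponent [c] converts [normsq]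
    into [nu]. *)
Lemma archimedean_block_norm Psi iota m n : real_line LF = Some iota ->
  archimedean_field abs Psi iota -> exists Nrm, @block_norm_spec m n Nrm.
Proof.
move=> E af; have [c nc] := nu_archimedean_power af.
pose q x := \sum_(S : {ffun 'I_n -> 'I_(m + n)}) normsq (Psi (\det (lower_minor S x))).
have q_gt0 x : x \in unitmx -> 0 < q x.
  move=> /lower_minor_unit [S uS]; rewrite /q (bigD1 S)//= ltr_wpDr//.
    by apply: sumr_ge0 => S' _; rewrite addr_ge0 ?sqr_ge0.
  by apply: normsq_gt0; rewrite fmorph_eq0 -unitfE -unitmxE.
exists (fun x => q x `^ c); split.
- by move=> x ux; rewrite powR_gt0 ?q_gt0.
- move=> p x up dp ux.
  have udp : \det (drsubmx p) != 0.
    move: up; rewrite unitmxE -{1}[p]submxK dp det_ublock unitrM => /andP[_].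
    by rewrite unitfE.
  have -> : q (p *m x) = normsq (Psi (\det (drsubmx p))) * q x.
    rewrite /q mulr_sumr; apply: eq_bigr => S _.
    by rewrite lower_minor_mul// det_mulmx rmorphM normsqM.
  by rewrite powRM ?nc// ?(ltW (q_gt0 _ ux))// ltW// normsq_gt0// fmorph_eq0.
move=> s t; rewrite /smooth E.
have sm (h : 'M[F]_(m + n) -> R) f : smooth_expr Psi f -> (forall x, GL x -> h x = f x) ->
    real_Cinfty iota h.
  exact: (smooth_expr_Cinfty V (af_iota af) (af_iota_continuous af)
    (af_Re_continuous af) (af_Im_continuous af)).
split; last by apply: (sm _ (fun=> 0)) => //; exact: smooth_cst.
apply: (sm _ (fun x => (normsq (Psi (\det x)) `^ c) `^ s * (q x `^ c) `^ t)); last first.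
  by move=> x ux; rewrite /= (_ : x \in unitmx)// nc// -unitfE -unitmxE.
have dp (x : 'M[F]_(m + n)) : GL x -> 0 < normsq (Psi (\det x)).
  by move=> ux; apply: normsq_gt0; rewrite fmorph_eq0 -unitfE -unitmxE.
have sd : csmooth_expr Psi (fun x : 'M[F]_(m + n) => Psi (\det x)).
  have := @csmooth_minor R F Psi (m + n) (m + n) id id.
  congr csmooth_expr; apply/funext => x; congr (Psi (\det _)).
  by apply/matrixP => a b; rewrite mxE.
apply: smooth_mul; apply: smooth_pow.
- exact: (smooth_pow c (smooth_normsq sd) dp).
- by move=> x xG; rewrite powR_gt0 ?dp.
- apply: (smooth_pow c (smooth_sum _ (fun S => smooth_normsq (csmooth_minor Psi _ _)))).
  exact: q_gt0.
- by move=> x xG; rewrite powR_gt0 ?q_gt0.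
Qed.

(** The maximum of [nu] over the minors is locally constant: by the ultrametric inequality a
    non-zero minor keeps its value of [nu] near [x], and a minor vanishing at [x] stays below the
    maximum. *)
Lemma nonarchimedean_block_norm m n : real_line LF = None ->
  (forall x y, abs (x + y) <= Num.max (abs x) (abs y)) -> exists Nrm, @block_norm_spec m n Nrm.
Proof.
move=> E um.
have absC x y : abs (y - x) < abs x -> abs y = abs x.
  move=> h; apply/eqP; rewrite eq_le; apply/andP; split.
    by have := um (y - x) x; rewrite subrK => /le_trans; apply; rewrite ge_max (ltW h) lexx.
  have := um (x - y) y; rewrite subrK (vf_distC V) le_max => /orP[|//].
  by rewrite leNgt h.
have nuC (h : 'M[F]_(m + n) -> F) x : continuous h -> h x != 0 ->
    \forall y \near x, nu (h y) = nu (h x).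
  move=> ch hx; have ax : 0 < abs (h x) by rewrite (vf_gt0 V).
  have /(vf_cont_at V) cx := ch x.
  apply: filterS (cx _ ax) => y /absC e.
  by apply/eqP; rewrite eq_le !nu_le// e.
pose Nrm x := \big[Num.max/0]_(S : {ffun 'I_n -> 'I_(m + n)}) nu (\det (lower_minor S x)).
have N_ge S x : nu (\det (lower_minor S x)) <= Nrm x by exact: le_bigmax.
have N_gt0 x : x \in unitmx -> 0 < Nrm x.
  move=> /lower_minor_unit [S uS]; apply: lt_le_trans (N_ge S x).
  by apply: nu_gt0; rewrite -unitfE -unitmxE.
exists Nrm; split=> //.
- move=> p x up dp ux.
  rewrite /Nrm (big_endo (fun r => nu (\det (drsubmx p)) * r)) ?mulr0//.
    by apply: eq_bigr => S _; rewrite lower_minor_mul// det_mulmx nuM.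
  by move=> a b; rewrite maxr_pMr.
move=> s t; rewrite /smooth E => x xG.
have dx : \det x != 0 by rewrite -unitfE -unitmxE.
have near1 : \forall y \near x, y \in unitmx.
  by apply: open_nbhs_nbhs; split=> //; exact: (@GL_open _ _ _ V).
have near2 := nuC _ x (@det_continuous _ _ _ V _) dx.
have near_minor (S : {ffun 'I_n -> 'I_(m + n)}) : \forall y \near x,
    (\det (lower_minor S x) = 0 -> nu (\det (lower_minor S y)) < Nrm x) /\
    (\det (lower_minor S x) != 0 -> nu (\det (lower_minor S y)) = nu (\det (lower_minor S x))).
  have [S0|Sn] := eqVneq (\det (lower_minor S x)) 0; last first.
    by apply: filterS (nuC _ _ (@lower_minor_continuous m n S) Sn) => y e; split=> // S0; rewrite S0 eqxx in Sn.
  have [d d0 dN] := nu_cvg0 V mu_haar nu0 nuE (N_gt0 _ xG).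
  have /(vf_cont_at V)/(_ _ d0) := @lower_minor_continuous m n S x.
  by apply: filterS => y; rewrite S0 subr0 => /dN h; split=> //; rewrite eqxx.
apply: filterS3 near1 near2 (filter_forall _ near_minor) => y uy dy Sy.
rewrite uy (_ : x \in unitmx)// dy; suff -> : Nrm y = Nrm x by [].
apply/eqP; rewrite eq_le; apply/andP; split; apply: bigmax_le => [|S _].
- by rewrite ltW ?N_gt0.
- have [S0 Sn] := Sy S; have [/S0/ltW//|/Sn ->//] := eqVneq (\det (lower_minor S x)) 0.
- by rewrite ltW ?N_gt0.
- have [S0 Sn] := Sy S; have [->|/Sn <-//] := eqVneq (\det (lower_minor S x)) 0.
  by rewrite nu0 ltW ?N_gt0.
Qed.

Lemma exists_block_norm m n :
  (exists Psi iota, real_line LF = Some iota /\ archimedean_field abs Psi iota) \/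
    (real_line LF = None /\ forall x y, abs (x + y) <= Num.max (abs x) (abs y)) ->
  exists Nrm, @block_norm_spec m n Nrm.
Proof.
case=> [[Psi [iota [E af]]]|[E um]]; first exact: archimedean_block_norm E af.
exact: nonarchimedean_block_norm.
Qed.

End SmoothFunctions.

(** * The intertwining operator *)

Lemma det_castmx (F : comUnitRingType) a b (e : a = b) (A : 'M[F]_a) :
  \det (castmx (e, e) A) = \det A.
Proof. by subst b; rewrite castmx_id. Qed.

Lemma powR_modular (R : realType) (x y a b : R) i j : 0 < x -> 0 < y ->
  x `^ a * y `^ b * Num.sqrt (x ^+ j * y ^- i) =
  x `^ (a + j%:R / 2) * y `^ (b - i%:R / 2).
Proof.
move=> x0 y0; rewrite sqrtrM ?exprn_ge0 ?(ltW x0)// mulrACA; congr (_ * _).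
  rewrite powRD; last by rewrite (gt_eqF x0) implybT.
  by rewrite powRrM powR_mulrn ?(ltW x0)// -powR12_sqrt ?exprn_ge0 ?(ltW x0)// -!powR_mulrn ?(ltW x0)// -!powRrM.
rewrite powRD; last by rewrite (gt_eqF y0) implybT.
rewrite powRN -powR12_sqrt; last by rewrite invr_ge0 exprn_ge0// ltW.
by rewrite -powR_mulrn ?(ltW y0)// -powRN -powRrM mulNr powRN.
Qed.

Lemma smooth_continuous (R : realType) (F : topFieldType) (LF : local_field R F)
    N (f : 'M[F]_N -> R[i]) x : smooth LF f -> GL x ->
  continuous_at x (fun y => complex.Re (f y) : R^o) /\
  continuous_at x (fun y => complex.Im (f y) : R^o).
Proof.
rewrite /smooth; case: real_line => [iota [Cr Ci] xG|lc xG].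
  by split; [exact: (Cr [::] x xG).1|exact: (Ci [::] x xG).1].
have h (L : R[i] -> R) : continuous_at x (fun y => L (f y) : R^o).
  move=> A /nbhs_singleton Ax; apply: filterS (lc x xG) => y /= ->; exact: Ax.
by split; exact: h.
Qed.

(** Off GL the function is [0] and may be discontinuous, so a superlevel set is an open subset of
    GL, joined by the complement of GL when [c < 0]. *)
Lemma continuous_GL_measurable (R : realType) (F : topFieldType) (abs : F -> R)
    (V : valued_field abs) N (g : 'M[F]_N -> R) :
  (forall x, GL x -> continuous_at x (g : _ -> R^o)) -> (forall x, ~ GL x -> g x = 0) ->
  measurable_fun setT (g : mxborel F N N -> R).
Proof.
move=> cg g0; apply: (measurability _ (RGenOInfty.measurableE R)).
move=> _ [_ [c ->] <-]; rewrite setTI.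
have mG : measurable (@GL F N : set (mxborel F N N)).
  by apply: open_mxborel; exact: (@GL_open _ _ _ V).
have m1 : measurable ([set x | GL x /\ c < g x] : set (mxborel F N N)).
  apply: open_mxborel; rewrite openE => x [xG cx].
  have h1 : nbhs x (@GL F N) by apply: open_nbhs_nbhs; split=> //; exact: (@GL_open _ _ _ V).
  have h2 : nbhs x [set y | c < g y].
    apply: (cg x xG [set r : R^o | c < r]).
    by apply: open_nbhs_nbhs; split=> //; exact: open_gt.
  exact: filterS2 h1 h2.
have [c0|c0] := leP 0 c.
  rewrite [X in measurable X](_ : _ = [set x | GL x /\ c < g x])//.
  apply/seteqP; split=> x /=; rewrite in_itv /= andbT; last by case.
  move=> cx; split=> //; apply: contrapT => /g0 gx; by rewrite gx ltNge c0 in cx.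
rewrite [X in measurable X](_ : _ = [set x | GL x /\ c < g x] `|` ~` @GL F N).
  by apply: measurableU => //; exact: measurableC.
apply/seteqP; split=> x /=; rewrite in_itv /= andbT.
  by move=> cx; have [xG|nG] := pselect (GL x); [left|right].
by case=> [[]//|/g0 ->].
Qed.

(** * The invariant functional on twisted densities *)

Section Functional.
Context (R : realType) (F : topFieldType) (LF : local_field R F) (abs : F -> R).
Hypothesis V : valued_field abs.
Context (mu : {sigma_finite_measure set (borel F) -> \bar R}).
Hypothesis mu_haar : haar_measure mu.
Context (nu : F -> R).
Hypothesis nu0 : nu 0 = 0.
Hypothesis nuE : haar_modulus mu nu.
Context (m n : nat).
Local Notation N := (m + n)%N.
Local Notation s := (N%:R / 2 : R).
Implicit Types (f h : 'M[F]_N -> R[i]) (x p g : 'M[F]_N).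

Let nuM := nuM V mu_haar nu0 nuE.
Let nu_gt0 := nu_gt0 nuE.

(* The smooth functions nu(det x)^s u(x) with u a density: by the exponents in
   [tdE] this is the space of [alphat]. *)
Record twisted_density f : Prop := {
  td_out : forall x, ~ GL x -> f x = 0;
  td_smooth : smooth LF f;
  tdE : forall p x, p \in unitmx -> dlsubmx p = 0 -> GL x ->
    f (p *m x) = (nu (\det (ulsubmx p)) `^ (n%:R + s) *
      nu (\det (drsubmx p)) `^ (s - m%:R))%:C%C * f x
}.

(** [L] is the real or the imaginary part. Removing the power [N / 2] of [nu (\det x)] leaves a real
    density, the kind of function that is integrated. *)
Definition untwist (L : R[i] -> R) f x := L (f x) * nu (\det x) `^ (- s).

Let det_gt0 k (x : 'M[F]_k) : x \in unitmx -> 0 < nu (\det x).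
Proof. by move=> ux; apply: nu_gt0; rewrite -unitfE -unitmxE. Qed.

Let part (L : R[i] -> R) := L 0 = 0 /\ forall (r : R) z, L (r%:C%C * z) = r * L z.

Let part_Re : part (@complex.Re R).
Proof. by split=> // r [a b] /=; rewrite mul0r subr0. Qed.

Let part_Im : part (@complex.Im R).
Proof. by split=> // r [a b] /=; rewrite mul0r addr0. Qed.

Let untwist_density L f : part L -> twisted_density f ->
  (forall x, GL x -> continuous_at x (fun y => L (f y) : R^o)) ->
  block_density nu (untwist L f).
Proof.
move=> [L0 LZ] tf cf; split.
- apply: measurable_funM.
    apply: (continuous_GL_measurable V cf) => x xG.
    by rewrite (td_out tf xG).
  apply: (measurableT_comp (measurable_powR _)).
  apply: (measurableT_comp (measurable_nu V mu_haar nu0 nuE)).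
  apply: (@measurable_continuous_borel F _ (mxborel F N N) 'M[F]_N id (fun x => \det x)).
    exact: open_mxborel.
  exact: (det_continuous V).
- by move=> x /negP nx; rewrite /untwist (td_out tf nx) L0 mul0r.
- move=> p x up dp ux; rewrite /untwist (tdE tf)// LZ det_mulmx nuM.
  have dE : \det p = \det (ulsubmx p) * \det (drsubmx p).
    by rewrite -{1}[p]submxK dp det_ublock.
  have /andP[u1 u2] : (ulsubmx p \in unitmx) && (drsubmx p \in unitmx).
    by move: up; rewrite !unitmxE dE unitrM.
  have x1 := det_gt0 u1; have x2 := det_gt0 u2; have x3 := det_gt0 ux.
  rewrite dE nuM !powRM ?mulr_ge0 ?ltW//.
  have D (y a b : R) : 0 < y -> y `^ (a + b) = y `^ a * y `^ b.
    by move=> y0; rewrite powRD// (gt_eqF y0) implybT.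
  rewrite !D//.
  rewrite !powRN !powR_mulrn ?ltW//.
  have y1 : nu (\det (ulsubmx p)) `^ s != 0 by rewrite gt_eqF// powR_gt0.
  have y2 : nu (\det (drsubmx p)) `^ s != 0 by rewrite gt_eqF// powR_gt0.
  have y3 : nu (\det x) `^ s != 0 by rewrite gt_eqF// powR_gt0.
  have y4 : nu (\det (drsubmx p)) != 0 by rewrite gt_eqF.
  by field; rewrite y1 y2 y3 expf_neq0.
Qed.

(** Lower blocks have determinant [1] and permutation matrices [1] or [-1]. On this compact set the
    twist is invisible, so bounds on [f] are bounds on the density. *)
Let nu_big_cell x : big_cell_compact abs x -> nu (\det x) = 1.
Proof.
move=> [X _ [w _ <-]]; rewrite det_mulmx det_lower_block mul1r det_perm.
by rewrite (nuX V mu_haar nu0 nuE) (nuN1 V mu_haar nu0 nuE) expr1n.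
Qed.

Let untwist_big_cell L f x : big_cell_compact abs x -> untwist L f x = L (f x).
Proof. by move=> Kx; rewrite /untwist nu_big_cell// powR1 mulr1. Qed.

Let untwist_bounded L f : (forall x, GL x -> continuous_at x (fun y => L (f y) : R^o)) ->
  bounded_on_big_cell abs (untwist L f).
Proof.
move=> cf; have [c Hc] := continuous_bounded_on_big_cell V cf.
by exists c => y Ky; rewrite untwist_big_cell// Hc.
Qed.

Definition twisted_integral f : R[i] :=
  (block_integral mu (untwist (@complex.Re R) f) +i*
   block_integral mu (untwist (@complex.Im R) f))%C.

Let bdR f : twisted_density f -> block_density nu (untwist (@complex.Re R) f).
Proof.
move=> tf; apply: untwist_density => // x xG.
exact: (smooth_continuous (td_smooth tf) xG).1.
Qed.

Let bdI f : twisted_density f -> block_density nu (untwist (@complex.Im R) f).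
Proof.
move=> tf; apply: untwist_density => // x xG.
exact: (smooth_continuous (td_smooth tf) xG).2.
Qed.

Let bR f : twisted_density f -> bounded_on_big_cell abs (untwist (@complex.Re R) f).
Proof. by move=> tf; apply: untwist_bounded => x xG; exact: (smooth_continuous (td_smooth tf) xG).1. Qed.

Let bI f : twisted_density f -> bounded_on_big_cell abs (untwist (@complex.Im R) f).
Proof. by move=> tf; apply: untwist_bounded => x xG; exact: (smooth_continuous (td_smooth tf) xG).2. Qed.

Let boundedZ c u : bounded_on_big_cell abs u ->
  bounded_on_big_cell abs (fun x : 'M[F]_N => c * u x).
Proof. by move=> [d ud]; exists (`|c| * d) => y Ky; rewrite normrM ler_wpM2l ?ud. Qed.

Let boundedD u v : bounded_on_big_cell abs u -> bounded_on_big_cell abs v ->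
  bounded_on_big_cell abs (fun x : 'M[F]_N => u x + v x).
Proof.
move=> [d ud] [e ve]; exists (d + e) => y Ky.
by rewrite (le_trans (ler_normD _ _))// lerD ?ud ?ve.
Qed.

Lemma twisted_integral_linear (a : R[i]) f h : twisted_density f -> twisted_density h ->
  twisted_integral (fun x => a * f x + h x) = a * twisted_integral f + twisted_integral h.
Proof.
move=> tf th; rewrite /twisted_integral.
have E (c d : R) (u v w : 'M[F]_N -> R) :
    block_density nu u -> block_density nu v -> block_density nu w ->
    bounded_on_big_cell abs u -> bounded_on_big_cell abs v -> bounded_on_big_cell abs w ->
    block_integral mu (fun x => (c * u x + d * v x) + w x) =
    c * block_integral mu u + d * block_integral mu v + block_integral mu w.
  move=> bu bv bw cu cv cw.
  have bcu := block_densityZ c bu; have bdv := block_densityZ d bv.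
  rewrite (block_integralD V mu_haar nu0 nuE)//; [|exact: block_densityD|by apply: boundedD; exact: boundedZ].
  rewrite (block_integralD V mu_haar nu0 nuE)//; [|exact: boundedZ|exact: boundedZ].
  by rewrite !(block_integralZ V mu_haar nu0 nuE).
have eR : untwist (@complex.Re R) (fun x => a * f x + h x) =
   (fun x => (complex.Re a * untwist (@complex.Re R) f x +
     (- complex.Im a) * untwist (@complex.Im R) f x) + untwist (@complex.Re R) h x).
  apply/funext => x; rewrite /untwist; case: (a) (f x) (h x) => [a1 a2] [f1 f2] [h1 h2] /=; ring.
have eI : untwist (@complex.Im R) (fun x => a * f x + h x) =
   (fun x => (complex.Re a * untwist (@complex.Im R) f x +
     complex.Im a * untwist (@complex.Re R) f x) + untwist (@complex.Im R) h x).
  apply/funext => x; rewrite /untwist; case: (a) (f x) (h x) => [a1 a2] [f1 f2] [h1 h2] /=; ring.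
rewrite eR eI !E; [|by auto..].
by case: (a) => a1 a2 /=; apply/eqP; rewrite eq_complex /=; apply/andP; split; apply/eqP; ring.
Qed.

Lemma twisted_integral_mulr f g : g \in unitmx -> twisted_density f ->
  twisted_integral (rtranslate g f) = (nu (\det g) `^ s)%:C%C * twisted_integral f.
Proof.
move=> ug tf; rewrite /twisted_integral.
have g0 := det_gt0 ug.
have E L : part L -> untwist L (rtranslate g f) =
    (fun x => nu (\det g) `^ s * untwist L f (x *m g)).
  move=> [L0 _]; apply/funext => x; rewrite /untwist /rtranslate.
  have [ux|nx] := boolP (x \in unitmx); last first.
    by rewrite (td_out tf) ?L0 ?mul0r ?mulr0// /GL /= unitmx_mul (negbTE nx).
  rewrite det_mulmx nuM powRM ?ltW ?det_gt0// !powRN.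
  have y1 : nu (\det g) `^ s != 0 by rewrite gt_eqF// powR_gt0.
  have y2 : nu (\det x) `^ s != 0 by rewrite gt_eqF// powR_gt0// det_gt0.
  by field; rewrite y1 y2.
have I L : part L -> block_density nu (untwist L f) -> bounded_on_big_cell abs (untwist L f) ->
    block_integral mu (untwist L (rtranslate g f)) =
    nu (\det g) `^ s * block_integral mu (untwist L f).
  move=> pL bu cu; rewrite E// -(block_integralZ V mu_haar nu0 nuE _ bu cu).
  apply: (block_integral_mulr V mu_haar nu0 nuE ug (u := fun x => _ * untwist L f x)).
    exact: block_densityZ.
  exact: boundedZ.
rewrite !I//; [|exact: bdI|exact: bI|exact: bdR|exact: bR].
by apply/eqP; rewrite eq_complex /=; apply/andP; split; apply/eqP; ring.
Qed.

(** Values on one compact set are all that enters, which makes the operator continuous without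
    control of derivatives. The factor 2 bounds the square root of 2 from combining real and
    imaginary parts. *)
Lemma twisted_integral_dist : exists2 B : R, 0 <= B & forall f h (c : R),
  twisted_density f -> twisted_density h ->
  (forall x, big_cell_compact abs x -> `|f x - h x| <= c%:C%C) ->
  `|twisted_integral f - twisted_integral h| <= (c * B)%:C%C.
Proof.
exists (2 * block_integral_bound abs mu m n).
  by rewrite mulr_ge0// block_integral_bound_ge0.
move=> f h c tf th fh.
have I L : part L -> (forall z w, L (z - w) = L z - L w) -> (forall z, `|L z|%:C%C <= `|z|) ->
    block_density nu (untwist L f) -> block_density nu (untwist L h) ->
    bounded_on_big_cell abs (untwist L f) -> bounded_on_big_cell abs (untwist L h) ->
    `|block_integral mu (untwist L f) - block_integral mu (untwist L h)| <=
    c * block_integral_bound abs mu m n.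
  move=> pL LB Ln bf bh cf ch.
  have bN := block_densityZ (-1) bh.
  have cN : bounded_on_big_cell abs (fun x => -1 * untwist L h x) by exact: boundedZ.
  rewrite -mulN1r -(block_integralZ V mu_haar nu0 nuE (-1) bh ch).
  rewrite -(block_integralD V mu_haar nu0 nuE bf cf bN cN).
  apply: (block_integral_le V mu_haar nu0 nuE); first exact: block_densityD.
  move=> y Ky; rewrite !untwist_big_cell// mulN1r -LB -lecR.
  exact: le_trans (Ln _) (fh y Ky).
have h1 := I _ part_Re (fun z w => raddfB _ z w) (@normc_ge_Re R) (bdR tf) (bdR th) (bR tf) (bR th).
have h2 := I _ part_Im (fun z w => raddfB _ z w) (@normc_ge_Im R) (bdI tf) (bdI th) (bI tf) (bI th).
have c0 : 0 <= c * block_integral_bound abs mu m n := le_trans (normr_ge0 _) h1.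
rewrite normc_def lecR /=.
set a := block_integral mu _ - _ in h1 *; set b := block_integral mu _ - _ in h2 *.
rewrite mulrCA.
have -> : 2 * (c * block_integral_bound abs mu m n) =
    Num.sqrt ((2 * (c * block_integral_bound abs mu m n)) ^+ 2).
  by rewrite sqrtr_sqr ger0_norm// mulr_ge0.
rewrite ler_wsqrtr//.
have q (r : R) : `|r| <= c * block_integral_bound abs mu m n ->
    r ^+ 2 <= (c * block_integral_bound abs mu m n) ^+ 2.
  by move=> h'; rewrite -real_normK ?num_real// lerXn2r ?nnegrE.
apply: le_trans (lerD (q _ h1) (q _ h2)) _; rewrite exprMn.
by have := sqr_ge0 (c * block_integral_bound abs mu m n); lra.
Qed.

Lemma twisted_integral_nonzero (Nrm : 'M[F]_N -> R) :
  @block_norm_spec _ _ LF nu m n Nrm ->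
  exists2 f, twisted_density f & twisted_integral f != 0.
Proof.
move=> [Nrm_gt0 NrmE Nrm_smooth].
pose r (a b : R) x : R := if x \in unitmx then nu (\det x) `^ a * Nrm x `^ b else 0.
have r_ge0 a b x : 0 <= r a b x.
  by rewrite /r; case: ifP => // _; rewrite mulr_ge0 ?powR_ge0.
have rsm a b : smooth LF (fun x => (r a b x)%:C%C) by exact: Nrm_smooth.
have rN a b x : GL x -> r a b x * r (- a) (- b) x = 1.
  move=> ux; rewrite /r (_ : x \in unitmx)// !powRN mulrACA.
  have y1 : nu (\det x) `^ a != 0 by rewrite gt_eqF// powR_gt0// det_gt0.
  have y2 : Nrm x `^ b != 0 by rewrite gt_eqF// powR_gt0// Nrm_gt0.
  by rewrite !divff// mulr1.
(* On the upper block of the parabolic only the exponent [n + s] acts; on the lower block the two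
   add up to [n + s - N = s - m]. *)
pose f x := (r (n%:R + s) (- N%:R) x)%:C%C.
have tf : twisted_density f.
  split; [|exact: rsm|].
    by move=> x /negP nx; rewrite /f /r (negbTE nx).
  move=> p x up dp ux; rewrite /f -rmorphM; congr (_%:C%C).
  rewrite /r unitmx_mul up (_ : x \in unitmx)// det_mulmx nuM NrmE//.
  have dE : \det p = \det (ulsubmx p) * \det (drsubmx p).
    by rewrite -{1}[p]submxK dp det_ublock.
  have /andP[u1 u2] : (ulsubmx p \in unitmx) && (drsubmx p \in unitmx).
    by move: up; rewrite !unitmxE dE unitrM.
  have x1 := det_gt0 u1; have x2 := det_gt0 u2; have x3 := det_gt0 ux; have x4 := Nrm_gt0 x ux.
  rewrite dE nuM !powRM ?mulr_ge0 ?ltW//.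
  have -> : (s - m%:R : R) = n%:R + s + - N%:R by rewrite natrD; field.
  rewrite [in RHS](@powRD _ (nu (\det (drsubmx p)))); last by rewrite (gt_eqF x2) implybT.
  by ring.
exists f => //.
have bR' := bR tf; have bRd := bdR tf.
have u_ge0 x : 0 <= untwist (@complex.Re R) f x.
  by rewrite /untwist /= mulr_ge0 ?powR_ge0.
(* The reciprocal of [f] belongs to the same smooth family, hence is bounded by [M] on the compact
   set, and [f] is at least [1 / (M + 1)] there. *)
have [M HM] : bounded_on_big_cell abs (r (- (n%:R + s)) (- (- N%:R))).
  apply: (continuous_bounded_on_big_cell V) => x ux.
  exact: (smooth_continuous (rsm _ _) ux).1.
have lowK (X : 'M[F]_(n, m)) : (forall i j, abs (X i j) <= 1) -> big_cell_compact abs (lower_block X).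
  by move=> hX; exists X => //; exists 1%g => //; rewrite perm_mx1 mulmx1.
have M0 : 0 <= M.
  apply: le_trans (normr_ge0 _) (HM (lower_block 0) (lowK 0 _)) => i j.
  by rewrite mxE (vf0 V).
have M1 : 0 < M + 1 by rewrite ltr_wpDl.
have pos := @block_integral_gt0 _ _ _ V mu mu_haar nu nu0 nuE m n
  (untwist (@complex.Re R) f) (M + 1)^-1 bRd bR' u_ge0.
suff : 0 < block_integral mu (untwist (@complex.Re R) f).
  by move=> h; rewrite /twisted_integral eq_complex /= negb_and gt_eqF.
apply: pos; first by rewrite invr_gt0.
move=> X hX; rewrite untwist_big_cell; last exact: lowK.
have := HM _ (lowK _ hX); rewrite ger0_norm// => HX.
have e := rN (n%:R + s) (- N%:R) (lower_block X) (lower_block_unit X).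
set a := r (n%:R + s) _ _ in e *; set b := r (- _) _ _ in e HX.
have a0 : 0 <= a by exact: r_ge0.
rewrite /f /= -/a -[leLHS]mul1r ler_pdivrMr// -[leLHS]e ler_wpM2l//.
by rewrite (le_trans HX)// lerDl.
Qed.

End Functional.

(** * Continuity and equivariance of the operator *)

Lemma real_Cinfty_bounded (R : realType) (F : topFieldType) (iota : R -> F) N
    (h : 'M[F]_N -> R) (K : set 'M[F]_N) (vss : seq (seq 'M[F]_N)) :
  real_Cinfty iota h -> compact K -> K `<=` @GL F N ->
  exists2 M : R, 0 <= M & forall vs x, vs \in vss -> K x -> `|dderivs iota vs h x| <= M.
Proof.
move=> hC cK KG; elim: vss => [|vs vss [M M0 HM]]; first by exists 0.
have : compact [set (dderivs iota vs h x : R^o) | x in K].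
  apply: continuous_compact cK; apply: continuous_in_subspaceT => x.
  by rewrite inE => /KG xG; exact: (hC vs x xG).1.
move=> /compact_bounded[M' [_ HM']]; exists (Num.max M (M' + 1)).
  by rewrite le_max M0.
move=> ws x; rewrite inE le_max => /orP[/eqP->|wi] Kx; last by rewrite HM.
by rewrite (HM' (M' + 1)) ?orbT ?ltrDl//; exists x.
Qed.

Section ComplexMultiples.
Context (R : realType) (F : topFieldType) (abs : F -> R).
Hypothesis V : valued_field abs.
Context (Psi : {rmorphism F -> R[i]}) (iota : R -> F) (N : nat).
Hypothesis af : archimedean_field abs Psi iota.
Implicit Types (h : 'M[F]_N -> R) (l : R[i]).

Let ReE l h : (fun x => complex.Re (l * (h x)%:C%C)) = (fun x => complex.Re l * h x).
Proof. by apply/funext => x; case: l => a b /=; ring. Qed.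

Let ImE l h : (fun x => complex.Im (l * (h x)%:C%C)) = (fun x => complex.Im l * h x).
Proof. by apply/funext => x; case: l => a b /=; ring. Qed.

Lemma cdderivsZ l h vs x : real_Cinfty iota h -> GL x ->
  cdderivs iota vs (fun y => l * (h y)%:C%C) x = l * (dderivs iota vs h x)%:C%C.
Proof.
move=> hC xG; rewrite /cdderivs ReE ImE.
rewrite !(dderivsZ V (af_iota af) (af_iota_continuous af))//.
case: l => a b; apply/eqP; rewrite eq_complex /=; apply/andP; split; apply/eqP; ring.
Qed.

Lemma CinftyZ l h : real_Cinfty iota h -> Cinfty iota (fun x => l * (h x)%:C%C).
Proof.
move=> hC; rewrite /Cinfty ReE ImE.
by split; apply: (real_CinftyZ V (af_iota af) (af_iota_continuous af)).
Qed.

End ComplexMultiples.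

Lemma smoothZ (R : realType) (F : topFieldType) (LF : local_field R F) N
    (l : R[i]) (h : 'M[F]_N -> R) :
  smooth LF (fun x => (h x)%:C%C) -> smooth LF (fun x => l * (h x)%:C%C).
Proof.
rewrite /smooth; case E : (real_line LF) => [iota|].
  have [abs [Psi [V af]]] := local_field_archimedean E.
  by case=> hC _; exact: (CinftyZ V af).
by move=> sh x xG; apply: filterS (sh x xG) => y ->.
Qed.

Definition det_power (R : realType) (F : topFieldType) (nu : F -> R) N (a : R) (x : 'M[F]_N) : R :=
  if x \in unitmx then nu (\det x) `^ a else 0.

Section Operator.
Context (R : realType) (F : topFieldType) (LF : local_field R F) (abs : F -> R).
Hypothesis V : valued_field abs.
Context (mu : {sigma_finite_measure set (borel F) -> \bar R}).
Hypothesis mu_haar : haar_measure mu.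
Context (nu : F -> R).
Hypothesis nu0 : nu 0 = 0.
Hypothesis nuE : haar_modulus mu nu.

Let nuM := nuM V mu_haar nu0 nuE.
Let nu_gt0 := nu_gt0 nuE.
Let nu_ge0 := nu_ge0 nu0 nuE.

Let det_gt0 k (x : 'M[F]_k) : x \in unitmx -> 0 < nu (\det x).
Proof. by move=> ux; apply: nu_gt0; rewrite -unitfE -unitmxE. Qed.

Lemma parabolic_det m n (p : 'M[F]_(m + n)) : parabolic p ->
  [/\ ulsubmx p \in unitmx, drsubmx p \in unitmx &
    \det p = \det (ulsubmx p) * \det (drsubmx p)].
Proof.
case=> up dp.
have dE : \det p = \det (ulsubmx p) * \det (drsubmx p).
  by rewrite -{1}[p]submxK dp det_ublock.
by have := up; rewrite [p \in _]unitmxE dE unitrM -!unitmxE => /andP[].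
Qed.

(** The numerical conditions say that both inducing exponents, shifted by the square root of the
    modular function, equal [c]; the parabolic law is then that of a power of the full
    determinant. *)
Lemma induced_det_power m n N (e : (m + n)%N = N) (a b c : R) (l : R[i]) :
  a + n%:R / 2 = c -> b - m%:R / 2 = c ->
  smooth LF (fun x : 'M[F]_N => (det_power nu c x)%:C%C) ->
  Defs.induced LF nu e (fun g => (nu (\det g) `^ a)%:C%C) (fun g => (nu (\det g) `^ b)%:C%C)
    (fun x => l * (det_power nu c x)%:C%C).
Proof.
move=> ac bc sm; split; [|exact: smoothZ|].
  by move=> x /negP nx; rewrite /det_power (negbTE nx) mulr0.
move=> p x pp ux; have [u1 u2 dE] := parabolic_det pp.
rewrite /det_power unitmx_mul.
have -> : (castmx (e, e) p \in unitmx) by rewrite unitmxE det_castmx -unitmxE; case: pp.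
rewrite (_ : x \in unitmx)//= det_mulmx det_castmx dE !nuM.
rewrite !powRM ?mulr_ge0//.
rewrite -!rmorphM [RHS]mulrCA -rmorphM; congr (l * _%:C%C).
by rewrite /modular powR_modular ?det_gt0// ac bc.
Qed.

Lemma induced_twisted_density m n (a b : R) :
  a + n%:R / 2 = n%:R + (m + n)%:R / 2 -> b - m%:R / 2 = (m + n)%:R / 2 - m%:R ->
  Defs.induced LF nu (erefl (m + n)%N)
    (fun g => (nu (\det g) `^ a)%:C%C) (fun g => (nu (\det g) `^ b)%:C%C) =
  [set f | twisted_density LF nu f].
Proof.
move=> ha hb; apply/seteqP.
have E (p : 'M[F]_(m + n)) : parabolic p ->
    (nu (\det (ulsubmx p)) `^ a)%:C%C * (nu (\det (drsubmx p)) `^ b)%:C%C *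
      (Num.sqrt (modular nu p))%:C%C =
    (nu (\det (ulsubmx p)) `^ (n%:R + (m + n)%:R / 2) *
      nu (\det (drsubmx p)) `^ ((m + n)%:R / 2 - m%:R))%:C%C :> R[i].
  move=> pp; have [u1 u2 _] := parabolic_det pp.
  by rewrite -!rmorphM /modular powR_modular ?det_gt0// ha hb.
split=> f [fo fs fE]; split=> // p x.
  by move=> up dp xG; rewrite -E// -fE// castmx_id.
by move=> pp xG; rewrite E// castmx_id fE//; case: pp.
Qed.

Section Image.
Context (m n : nat).
Local Notation N := (m + n)%N.
Local Notation eta := (@det_power R F nu N (N%:R / 2)).
Hypothesis eta_smooth : smooth LF (fun x => (eta x)%:C%C).

Definition det_twist (f : 'M[F]_N -> R[i]) (x : 'M[F]_N) : R[i] :=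
  twisted_integral mu nu f * (eta x)%:C%C.

(** All outputs lie on one line, so a derivative of the output is the scalar [twisted_integral]
    times a fixed derivative, bounded on the compact set. *)
Lemma det_twist_continuous iota : real_line LF = Some iota ->
  forall f, twisted_density LF nu f ->
  det_twist @ within [set f | twisted_density LF nu f] (Cinfty_nbhs iota f) `=>`
    Cinfty_nbhs iota (det_twist f).
Proof.
move=> E f tf A [K [vss [e [cK KG e0 HA]]]].
have [abs' [Psi [V' af]]] := local_field_archimedean E.
have eC : real_Cinfty iota eta by move: eta_smooth; rewrite /smooth E => -[].
have [B B0 HB] := twisted_integral_dist LF V mu_haar nu0 nuE m n.
have [M M0 HM] := real_Cinfty_bounded vss eC cK KG.
have BM : 0 < (B + 1) * (M + 1) by rewrite mulr_gt0 ?ltr_wpDl.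
(* The list [[:: [::]]] controls values only, on which alone the scalar depends. The summands [1]
   keep the denominator positive and the final inequality strict. *)
exists (@big_cell_compact _ _ abs m n), [:: [::]], (e / ((B + 1) * (M + 1))).
split; [exact: (compact_big_cell V)|by move=> x /big_cell_unit|by rewrite divr_gt0|].
move=> h hC hf th; apply: HA; first exact: (CinftyZ V' af).
move=> vs x vsi Kx.
have dE u : cdderivs iota vs (det_twist u) x =
    twisted_integral mu nu u * (dderivs iota vs eta x)%:C%C.
  by apply: (cdderivsZ V' af) => //; exact: KG.
rewrite !dE -mulrBl normrM.
have hB : `|twisted_integral mu nu h - twisted_integral mu nu f| <=
    (e / ((B + 1) * (M + 1)) * B)%:C%C.
  apply: HB => // y Ky; have := hf [::] y (mem_head _ _) Ky.
  by rewrite /cdderivs /=; case: (h y) (f y) => [a b] [c d] /= /ltW.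
have hM : `|(dderivs iota vs eta x)%:C%C| <= M%:C%C :> R[i].
  by rewrite normc_def /= expr0n /= addr0 sqrtr_sqr lecR HM.
apply: le_lt_trans (ler_pM _ _ hB hM) _ => //.
rewrite -rmorphM ltcR.
rewrite [ltLHS](_ : _ = e * ((B * M) / ((B + 1) * (M + 1)))); last by ring.
rewrite -[ltRHS]mulr1 ltr_pM2l// ltr_pdivrMr// mul1r.
by have := mulr_ge0 B0 M0; lra.
Qed.

Lemma intertwining_det_twist (W : set ('M[F]_N -> R[i])) :
  (forall l : R[i], W (fun x => l * (eta x)%:C%C)) ->
  intertwining LF [set f | twisted_density LF nu f] W det_twist.
Proof.
move=> HW; split; [by move=> f _; exact: HW| | |exact: det_twist_continuous].
- move=> a f g tf tg; apply/funext => x; rewrite /det_twist.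
  by rewrite (twisted_integral_linear V mu_haar nu0 nuE _ tf tg) mulrDl mulrA.
- move=> g f ug tf; apply/funext => x; rewrite /det_twist /rtranslate.
  rewrite -/(rtranslate g f) (twisted_integral_mulr V mu_haar nu0 nuE ug tf).
  rewrite mulrAC mulrC; congr (_ * _); rewrite -rmorphM; congr (_%:C%C).
  rewrite /det_power unitmx_mul (_ : g \in unitmx)// andbT.
  by case: ifP => [ux|_]; rewrite ?mulr0// det_mulmx nuM powRM// mulrC.
Qed.

Lemma det_twist_nonzero f : twisted_integral mu nu f != 0 -> det_twist f <> (fun=> 0).
Proof.
move=> f0 /(congr1 (fun h => h 1%:M)) /eqP; rewrite /det_twist mulf_eq0 (negbTE f0) /=.
rewrite /det_power unitmx1 det1 (nu1 V mu_haar nu0 nuE) powR1.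
by rewrite eq_complex /= oner_eq0.
Qed.

End Image.
End Operator.

(** * Sigma-finiteness of Haar measure and choice of the exponents *)

Section HaarSigmaFinite.
Context (R : realType) (F : topFieldType) (abs : F -> R).
Hypothesis V : valued_field abs.
Context (mu : {measure set (borel F) -> \bar R}).
Hypothesis mu_haar : haar_measure mu.

(** Tonelli requires a sigma-finite measure, whereas Haar measure is given as a bare measure; the
    alias receives the extra structure from the exhaustion by compact balls. *)
Definition sigma_finite_haar : set (borel F) -> \bar R := mu.
HB.instance Definition _ := Measure.on sigma_finite_haar.

Let haar_sigma_finiteT : sigma_finite setT sigma_finite_haar.
Proof.
exists (fun i => [set x | abs x <= i%:R] : set (borel F)); last first.
  move=> i; split; first exact: (measurable_vf_ball V).
  by apply: (haar_compact mu_haar); exact: (@vf_compact _ _ _ V).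
apply/seteqP; split=> // x _; exists (Num.bound (abs x)) => //=.
exact/ltW/(archi_boundP (vf_ge0 V x)).
Qed.

HB.instance Definition _ :=
  Measure_isSigmaFinite.Build _ _ _ sigma_finite_haar haar_sigma_finiteT.

Lemma haar_sigma_finite : exists mu' : {sigma_finite_measure set (borel F) -> \bar R},
  (mu' : {measure set (borel F) -> \bar R}) = mu.
Proof. by exists sigma_finite_haar; apply: eq_measure. Qed.

End HaarSigmaFinite.

(** The law evaluates [nu] at determinants of invertible matrices only, so its value at [0] can be
    reset. *)
Lemma eq_induced_power (R : realType) (F : topFieldType) (LF : local_field R F)
    (nu nu' : F -> R) m n N (e : (m + n)%N = N) (a b : R) :
  (forall z, z != 0 -> nu z = nu' z) ->
  Defs.induced LF nu e (fun g => (nu (\det g) `^ a)%:C%C) (fun g => (nu (\det g) `^ b)%:C%C) =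
  Defs.induced LF nu' e (fun g => (nu' (\det g) `^ a)%:C%C) (fun g => (nu' (\det g) `^ b)%:C%C).
Proof.
move=> nn; apply/seteqP; split=> f [fo fs fE]; split=> // p x pp xG;
  rewrite fE// /modular; have [u1 u2 _] := parabolic_det pp;
  by rewrite !nn// -unitfE -unitmxE.
Qed.

(** Block sizes and exponents are free, tied by four equations: the first two make the source the
    space of twisted densities, the last two put the power [N / 2] of [nu (\det x)] into the
    target. *)
Lemma exists_intertwining (R : realType) (F : topFieldType) (LF : local_field R F)
    (mu : {measure set (borel F) -> \bar R}) (mu_haar : haar_measure mu)
    (nu : F -> R) (nuE : haar_modulus mu nu) (m n p q N : nat)
    (e : (m + n)%N = N) (e' : (p + q)%N = N) (a b c d : R) :
  a + n%:R / 2 = n%:R + N%:R / 2 -> b - m%:R / 2 = N%:R / 2 - m%:R ->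
  c + q%:R / 2 = N%:R / 2 -> d - p%:R / 2 = N%:R / 2 ->
  let power t k (g : 'M[F]_k) := (nu (\det g) `^ t)%:C%C in
  let V := Defs.induced LF nu e (power a m) (power b n) in
  exists T, intertwining LF V (Defs.induced LF nu e' (power c p) (power d q)) T /\
    exists2 f, V f & T f <> (fun=> 0).
Proof.
move=> ha hb hc hd power V; rewrite {}/V {}/power.
have [abs V absE] := local_field_valued LF.
have [mu' mu'E] := haar_sigma_finite V mu_haar; subst mu.
(* With the value [0] at [0], the modulus is multiplicative and monotone in [abs] on all of [F]. *)
pose nu' z := if z == 0 then 0 else nu z.
have nn z : z != 0 -> nu z = nu' z by rewrite /nu' => /negbTE ->.
have nu0 : nu' 0 = 0 by rewrite /nu' eqxx.
have nuE' : haar_modulus mu' nu' by move=> z z0; rewrite -nn//; exact: nuE.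
rewrite !(eq_induced_power LF _ _ _ nn); subst N.
have [Nrm NrmP] := exists_block_norm V mu_haar nu0 nuE' m n absE.
have sm : smooth LF (fun x : 'M[F]_(m + n) => (det_power nu' ((m + n)%:R / 2) x)%:C%C).
  case: (NrmP) => _ _ /(_ ((m + n)%:R / 2) 0).
  congr smooth; apply/funext => x; rewrite /det_power; case: ifP => // _.
  by rewrite powRr0 mulr1.
rewrite (induced_twisted_density LF nuE' ha hb).
exists (@det_twist _ _ mu' nu' m n); split.
  apply: (intertwining_det_twist V mu_haar nu0 nuE' sm) => l.
  exact: (induced_det_power V mu_haar nu0 nuE').
have [f tf f0] := twisted_integral_nonzero V mu_haar nu0 nuE' NrmP.
exists f => //; exact: (det_twist_nonzero V mu_haar nu0 nuE').
Qed.

Theorem proposition1p2 (R : realType) (F : topFieldType)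
    (LF : local_field R F)
    (mu : {measure set (borel F) -> \bar R}) (mu_haar : haar_measure mu)
    (nu : F -> R) (nuE : haar_modulus mu nu)
    (k : nat) (k_gt0 : (0 < k)%N) (i j : 'I_k) (ji : j <> i) :
  exists T : ('M[F]_k -> R[i]%C) -> ('M[F]_k -> R[i]%C),
    intertwining LF (alphat LF nu j) (alpha LF nu i) T /\
    exists2 f, alphat LF nu j f & T f <> (fun=> 0).
Proof.
have [jk ik] := (ltn_ord j, ltn_ord i).
have kB (r : 'I_k) : (k - r)%:R = k%:R - r%:R :> R by rewrite natrB// ltnW.
(* Here [m = k - j], [n = j], [p = i] and [q = k - i]; what remains are exponent identities such as
   [(j + k)/2 + j/2 = j + k/2]. *)
apply: (exists_intertwining LF mu_haar nuE);
  rewrite ?subn0 ?kB ?natrD ?addn0 ?add0n; lra.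
Qed.
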